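(* Let $p\colon H\to M$ be an open compact group bundle over a compact space $M$. For every $[\pi]\in\hat H$ there is a local continuous section $\hat\sigma$ of the bundle $\hat p\colon\hat H\to M$ (defined on an open neighborhood of $\hat p([\pi])$ in $M$) with $\hat\sigma(\hat p([\pi]))=[\pi]$.
   Context: All compact and locally compact spaces are Hausdorff; vector spaces are complex. A compact group bundle over a compact space $M$ is a continuous surjection $p\colon H\to M$ from a compact space $H$ such that every fiber $H_m=p^{-1}(m)$ is a group and the maps $H\times_MH\to H$, $(x,y)\mapsto xy$ (with $H\times_MH=\{(x,y):p(x)=p(y)\}$), $x\mapsto x^{-1}$, and $m\mapsto1_{H_m}$ are continuous; it is open if $p$ is an open map. $\lambda_{H_m}$ denotes the Haar probability measure of $H_m$. Dual. $\mathrm{C}(H)$ is a *-algebra with $(f*g)(x)=\int_{H_{p(x)}}f(xy)g(y^{-1})\,\mathrm{d}\lambda_{H_{p(x)}}(y)$ and $f^*(x)=\overline{f(x^{-1})}$. A bounded representation is a *-homomorphism $\pi\colon\mathrm{C}(H)\to\mathscr{L}(E)$, $E$ a Hilbert space, with $\|\pi(f)\|\le\sup_m\int_{H_m}|f|\,\mathrm{d}\lambda_{H_m}$ and $E=\overline{\mathrm{lin}}\{\pi(f)v\}$. $\mathrm{C}^*(H)$ is the completion of $\mathrm{C}(H)$ under $\|f\|=\sup\{\|\pi(f)\|:\pi\text{ bounded representation}\}$. The dual $\hat H$ is the spectrum of $\mathrm{C}^*(H)$ (equivalence classes of non-zero irreducible representations) with its usual C*-algebraic (hull-kernel) topology. Each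 irreducible unitary representation $\varrho$ of a fiber group $H_m$ defines an irreducible representation $\pi_\varrho$ of $\mathrm{C}^*(H)$ with $\pi_\varrho(f)=\int_{H_m}f(x)\varrho(x)\,\mathrm{d}\lambda_{H_m}(x)$ for $f\in\mathrm{C}(H)$; this induces a bijection from the disjoint union $\bigcup_{m\in M}\hat H_m$ of the unitary duals onto $\hat H$, and the two sets are identified. $\hat p\colon\hat H\to M$ maps elements of $\hat H_m$ to $m$. A local continuous section of $\hat p$ is a continuous map $\hat\sigma\colon O\to\hat H$ with $O\subseteq M$ open and $\hat p\circ\hat\sigma=\mathrm{id}_O$. *)

(* Defs.v *)
From HB Require Import structures.
From mathcomp Require Import all_boot all_order all_algebra.
From mathcomp Require Import complex.
From mathcomp Require Import all_classical all_reals all_analysis.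

Set Implicit Arguments.
Unset Strict Implicit.
Unset Printing Implicit Defensive.

Import Order.TTheory GRing.Theory Num.Theory numFieldNormedType.Exports.

Local Open Scope classical_set_scope.
Local Open Scope ring_scope.
Local Open Scope complex_scope.

Notation borel H := (g_sigma_algebraType (@open H)).

(* [R[i]^o] is [R[i]] as a one-dimensional normed space, which is how the
   library finds the topology of the complex numbers. *)
Notation CH R H := (continuousType H R[i]^o).

(* Norms of complex vectors take their values in [R[i]]. *)
Definition normr_of (R : realType) (V : normedModType R[i]) (v : V) : R :=
  complex.Re `|v|.

Definition cintegral (R : realType) d (T : measurableType d)
    (mu : {measure set T -> \bar R}) (D : set T) (f : T -> R[i]) : R[i] :=
  (\int[mu]_(x in D) complex.Re (f x)) +i* (\int[mu]_(x in D) complex.Im (f x)).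

(* The operations are total functions on [H]; the values of [gb_mul] on pairs
   lying in different fibers are never used. *)
Record compact_group_bundle (M H : topologicalType) := CompactGroupBundle {
  gb_proj :> H -> M ;
  gb_mul : H -> H -> H ;
  gb_inv : H -> H ;
  gb_one : M -> H ;
  gb_compactM : compact [set: M] ;
  gb_hausdorffM : hausdorff_space M ;
  gb_compactH : compact [set: H] ;
  gb_hausdorffH : hausdorff_space H ;
  gb_proj_continuous : continuous gb_proj ;
  gb_proj_surj : forall m, exists x, gb_proj x = m ;
  gb_proj_mul : forall x y, gb_proj x = gb_proj y ->
    gb_proj (gb_mul x y) = gb_proj x ;
  gb_proj_inv : forall x, gb_proj (gb_inv x) = gb_proj x ;
  gb_proj_one : forall m, gb_proj (gb_one m) = m ;
  gb_mulA : forall x y z, gb_proj x = gb_proj y -> gb_proj y = gb_proj z ->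
    gb_mul x (gb_mul y z) = gb_mul (gb_mul x y) z ;
  gb_mul1x : forall x, gb_mul (gb_one (gb_proj x)) x = x ;
  gb_mulx1 : forall x, gb_mul x (gb_one (gb_proj x)) = x ;
  gb_mulVx : forall x, gb_mul (gb_inv x) x = gb_one (gb_proj x) ;
  gb_mulxV : forall x, gb_mul x (gb_inv x) = gb_one (gb_proj x) ;
  gb_mul_continuous : {within [set z : H * H | gb_proj z.1 = gb_proj z.2],
    continuous (fun z : H * H => gb_mul z.1 z.2)} ;
  gb_inv_continuous : continuous gb_inv ;
  gb_one_continuous : continuous gb_one
}.

Definition open_bundle (M H : topologicalType) (p : compact_group_bundle M H) :=
  forall U : set H, open U -> open (p @` U).

Definition fiber (M H : topologicalType) (p : compact_group_bundle M H) (m : M)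
  : set H := [set x | p x = m].

(* The Haar probability measure of the fiber over [m], as a Borel measure on
   [H] carried by that (closed) fiber.  As [H] need not be metrizable,
   regularity has to be required. *)
Record is_haar (R : realType) (M : topologicalType) (H : ptopologicalType)
    (p : compact_group_bundle M H) (m : M) (mu : probability (borel H) R)
  : Prop := IsHaar {
  haar_fiber : mu (fiber p m) = 1%E ;
  haar_invariant : forall x (B : set (borel H)), fiber p m x ->
    measurable B -> B `<=` fiber p m -> mu (gb_mul p x @` B) = mu B ;
  haar_regular : forall (B : set (borel H)) (eps : R), measurable B -> 0 < eps ->
    exists K : set H, [/\ compact K, K `<=` B & (mu (B `\` K) < eps%:E)%E]
}.

(* Inner products are linear in the first argument. *)
Record hilbert (R : realType) := Hilbert {
  hilbert_sort :> completeNormedModType R[i] ;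
  ip : {dot hilbert_sort for Num.conj} ;
  ip_norm : forall v, ip v v = `|v| ^+ 2
}.

Definition lin (R : realType) (E : lmodType R[i]) (S : set E) : set E :=
  [set w | exists (n : nat) (a : 'I_n -> R[i]) (s : 'I_n -> E),
     (forall i, S (s i)) /\ w = \sum_(i < n) a i *: s i].

Definition closed_subspace (R : realType) (E : normedModType R[i]) (F : set E) :=
  [/\ F 0, forall (a : R[i]) u v, F u -> F v -> F (a *: u + v) & closed F].

Definition topologically_irreducible (R : realType) (I : Type)
    (E : normedModType R[i]) (D : set I) (T : I -> E -> E) :=
  forall F : set E, closed_subspace F ->
    (forall i v, D i -> F v -> F (T i v)) -> F = [set 0] \/ F = setT.

Definition opnorm (R : realType) (E : normedModType R[i]) (T : E -> E) : R :=
  sup [set normr_of (T v) | v in [set v | normr_of v <= 1]].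

Section convolution_algebra.
Context (R : realType) (M : topologicalType) (H : ptopologicalType).
Variables (p : compact_group_bundle M H) (lambda : M -> probability (borel H) R).

Definition conv (f g : H -> R[i]) (x : H) : R[i] :=
  cintegral (lambda (p x)) (fiber p (p x))
    (fun y => f (gb_mul p x y) * g (gb_inv p y)).

Definition cstar (f : H -> R[i]) (x : H) : R[i] := Num.conj (f (gb_inv p x)).

(* The operations of C(H) enter as relations between elements of C(H).  For the
   Haar measures of an open bundle, [conv f g] is continuous, so that it is
   always represented by an element of C(H). *)
Record is_bounded_rep (E : hilbert R) (pi : CH R H -> {linear E -> E})
  : Prop := IsBoundedRep {
  brep_continuous : forall f, continuous (pi f) ;
  brep_linear : forall (a : R[i]) (f g h : CH R H),
    (forall x, h x = a * f x + g x) -> forall v, pi h v = a *: pi f v + pi g v ;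
  brep_conv : forall f g h : CH R H,
    (forall x, h x = conv f g x) -> forall v, pi h v = pi f (pi g v) ;
  brep_star : forall f h : CH R H,
    (forall x, h x = cstar f x) ->
    forall v w, ip E (pi h v) w = ip E v (pi f w) ;
  brep_bound : forall f, opnorm (pi f) <=
    sup [set \int[lambda m]_(x in fiber p m) normr_of (f x) | m in [set: M]] ;
  brep_nondegenerate : dense (lin [set pi f v | f in setT & v in setT])
}.

Definition bounded_rep_norm (f : CH R H) : R :=
  sup [set r | exists (E : hilbert R) (pi : CH R H -> {linear E -> E}),
    is_bounded_rep pi /\ r = opnorm (pi f)].

End convolution_algebra.

Record cstar_algebra (R : realType) := CStarAlgebra {
  ca_sort :> completeNormedModType R[i] ;
  ca_mul : ca_sort -> ca_sort -> ca_sort ;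
  ca_star : ca_sort -> ca_sort ;
  ca_mulA : associative ca_mul ;
  ca_mulDl : forall (k : R[i]) a b c,
    ca_mul (k *: a + b) c = k *: ca_mul a c + ca_mul b c ;
  ca_mulDr : forall (k : R[i]) a b c,
    ca_mul a (k *: b + c) = k *: ca_mul a b + ca_mul a c ;
  ca_starK : involutive ca_star ;
  ca_starD : forall (k : R[i]) a b,
    ca_star (k *: a + b) = Num.conj k *: ca_star a + ca_star b ;
  ca_starM : forall a b, ca_star (ca_mul a b) = ca_mul (ca_star b) (ca_star a) ;
  ca_normM : forall a b, `|ca_mul a b| <= `|a| * `|b| ;
  ca_normS : forall a, `|ca_mul (ca_star a) a| = `|a| ^+ 2
}.

(* [A], with the map [iota], is the completion of C(H) under
   [bounded_rep_norm]; this determines [A] up to isometric *-isomorphism. *)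
Record is_group_cstar_algebra (R : realType) (M : topologicalType)
    (H : ptopologicalType) (p : compact_group_bundle M H)
    (lambda : M -> probability (borel H) R)
    (A : cstar_algebra R) (iota : CH R H -> A) : Prop := IsGroupCStarAlgebra {
  gca_linear : forall (a : R[i]) (f g h : CH R H),
    (forall x, h x = a * f x + g x) -> iota h = a *: iota f + iota g ;
  gca_conv : forall f g h : CH R H,
    (forall x, h x = conv p lambda f g x) ->
    iota h = ca_mul (iota f) (iota g) ;
  gca_star : forall f h : CH R H,
    (forall x, h x = cstar p f x) -> iota h = ca_star (iota f) ;
  gca_norm : forall f, normr_of (iota f) = bounded_rep_norm p lambda f ;
  gca_dense : dense (range iota)
}.

Section spectrum.
Context (R : realType) (A : cstar_algebra R).

Record irrep := Irrep {
  irrep_space : hilbert R ;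
  irrep_op :> A -> {linear irrep_space -> irrep_space} ;
  irrep_continuous : forall a, continuous (irrep_op a) ;
  irrep_linear : forall (k : R[i]) a b v,
    irrep_op (k *: a + b) v = k *: irrep_op a v + irrep_op b v ;
  irrep_mul : forall a b v, irrep_op (ca_mul a b) v = irrep_op a (irrep_op b v) ;
  irrep_star : forall a v w,
    ip irrep_space (irrep_op (ca_star a) v) w =
    ip irrep_space v (irrep_op a w) ;
  irrep_nonzero : exists a v, irrep_op a v != 0 ;
  irrep_irreducible : topologically_irreducible [set: A] irrep_op
}.

Definition equivalent (pi rho : irrep) :=
  exists U : {linear irrep_space pi -> irrep_space rho},
  [/\ bijective U,
      forall v w, ip (irrep_space rho) (U v) (U w) = ip (irrep_space pi) v w &
      forall a v, U (pi a v) = rho a (U v)].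

(* The points of the spectrum are equivalence classes of representations on
   arbitrary Hilbert spaces.  They therefore live in a universe above that of
   [hilbert], and [spectrum] cannot be made a [topologicalType] without
   forbidding Hilbert spaces built from functions on [topologicalType]s.  Hence
   its open sets are given by the predicate [hk_open]. *)
Record spectrum := Spectrum {
  spec_class :> irrep -> Prop ;
  spec_classP : exists pi, spec_class = equivalent pi
}.

Definition spec_of (pi : irrep) : spectrum :=
  Spectrum (ex_intro (fun pi' => equivalent pi = equivalent pi') pi erefl).

Definition spec_ker (c : spectrum) : set A :=
  [set a | forall pi : irrep, c pi -> forall v, pi a v = 0].

Definition hk_closure (T : spectrum -> Prop) (c : spectrum) : Prop :=
  [set a | forall d, T d -> spec_ker d a] `<=` spec_ker c.

Definition hk_open (U : spectrum -> Prop) : Prop :=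
  forall c, hk_closure (fun d => ~ U d) c -> ~ U c.

Lemma equivalent_ker (pi rho : irrep) a : equivalent pi rho ->
  (forall v, pi a v = 0) -> forall v, rho a v = 0.
Proof.
move=> [U [[V _ VK] _ UJ]] pia0 v.
by rewrite -(VK v) -UJ pia0 linear0.
Qed.

Lemma equivalent_refl (pi : irrep) : equivalent pi pi.
Proof. by exists idfun; split=> //; exists idfun. Qed.

Lemma spec_ker_of (pi : irrep) :
  spec_ker (spec_of pi) = [set a | forall v, pi a v = 0].
Proof.
apply/seteqP; split=> a /=; first by apply; exact: equivalent_refl.
by move=> pia0 rho /= pirho; exact: equivalent_ker pirho pia0.
Qed.

Lemma spec_ofP (c : spectrum) : exists pi, c = spec_of pi.
Proof.
case: c => s sP; have [pi spi] := sP; exists pi.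
by rewrite /spec_of; subst s; congr Spectrum; exact: Prop_irrelevance.
Qed.

Lemma irrep_prime (pi : irrep) a b :
  (forall x v, pi (ca_mul (ca_mul a x) b) v = 0) ->
  (forall v, pi a v = 0) \/ (forall v, pi b v = 0).
Proof.
move=> axb0; pose F := [set w | forall x, pi a (pi x w) = 0].
have Fb v : F (pi b v).
  by move=> x; rewrite -!irrep_mul; exact: axb0.
have clF : closed F.
  rewrite (_ : F = \bigcap_(x in [set: A]) (pi a \o pi x) @^-1` [set 0]).
    apply: closed_bigI => x _; apply: preimage_closed.
      by move=> w _; apply: continuous_comp; exact: irrep_continuous.
    exact: (accessible_closed_set1 (hausdorff_accessible (@norm_hausdorff _ _))).
  by apply/seteqP; split=> [w Fw x _|w Fw x] /=; [exact: Fw|exact: (Fw x I)].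
have subF : closed_subspace F.
  split=> // [x|k u v Fu Fv x]; first by rewrite !linear0.
  by rewrite 2!linearP Fu Fv scaler0 addr0.
have invF x v : [set: A] x -> F v -> F (pi x v).
  by move=> _ Fv y; rewrite -(irrep_mul y x); exact: Fv.
have [F0|FT] := irrep_irreducible subF invF.
  by right=> v; have := Fb v; rewrite F0.
left=> v.
have star0 w : pi (ca_star a) w = 0.
  apply/eqP; rewrite -normr_eq0 -sqrf_eq0 -ip_norm.
  have Fw : F w by rewrite FT.
  by rewrite irrep_star Fw linear0.
have : ip _ (pi a v) (pi a v) = 0.
  by rewrite -irrep_star star0 linear0l.
by rewrite ip_norm => /eqP; rewrite expf_eq0 normr_eq0 => /eqP.
Qed.

(* The sets satisfying [hk_open] form a topology. *)
Lemma hk_openT : hk_open (fun=> True).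
Proof.
move=> c; have [pi ->] := spec_ofP c.
rewrite /hk_closure spec_ker_of => sub _.
have [a [v /eqP]] := irrep_nonzero pi; apply.
by apply: sub => d /(_ I).
Qed.

Lemma hk_openI U V : hk_open U -> hk_open V -> hk_open (fun c => U c /\ V c).
Proof.
move=> Uo Vo c cUV [Uc Vc].
have [a [aU ac]] : exists a, (forall d, ~ U d -> spec_ker d a) /\ ~ spec_ker c a.
  apply: contrapT => Na; apply: (Uo c) => // a aU.
  by apply: contrapT => ac; apply: Na; exists a.
have [b [bV bc]] : exists b, (forall d, ~ V d -> spec_ker d b) /\ ~ spec_ker c b.
  apply: contrapT => Nb; apply: (Vo c) => // b bV.
  by apply: contrapT => bc; apply: Nb; exists b.
have axb x : spec_ker c (ca_mul (ca_mul a x) b).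
  apply: cUV => d /not_andP[/aU da|/bV db] rho drho v.
    by rewrite !irrep_mul da.
  by rewrite irrep_mul db // linear0.
have [pi cpi] := spec_ofP c; subst c.
move: ac bc axb; rewrite spec_ker_of /= => ac bc axb.
by have [] := irrep_prime axb.
Qed.

Lemma hk_open_bigcup (I : Type) (U : I -> spectrum -> Prop) :
  (forall i, hk_open (U i)) -> hk_open (fun c => exists i, U i c).
Proof.
move=> Uo c cU [i Uic]; apply: (Uo i c) => // a ka; apply: cU => d Ud.
by apply: ka => Uid; apply: Ud; exists i.
Qed.

End spectrum.

Section dual_bundle.
Context (R : realType) (M : topologicalType) (H : ptopologicalType).
Variables (p : compact_group_bundle M H) (lambda : M -> probability (borel H) R).

Record is_irreducible_unitary_rep (m : M) (E : hilbert R)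
    (rho : H -> {linear E -> E}) : Prop := IsIrreducibleUnitaryRep {
  urep_one : forall v, rho (gb_one p m) v = v ;
  urep_mul : forall x y, fiber p m x -> fiber p m y ->
    forall v, rho (gb_mul p x y) v = rho x (rho y v) ;
  urep_unitary : forall x, fiber p m x ->
    forall v w, ip E (rho x v) (rho x w) = ip E v w ;
  urep_continuous : forall v, {within fiber p m, continuous (fun x => rho x v)} ;
  urep_nonzero : exists v : E, v != 0 ;
  urep_irreducible : topologically_irreducible (fiber p m) rho
}.

Variables (A : cstar_algebra R) (iota : CH R H -> A).

(* [c] is the class of some [pi_rho] with [rho] an irreducible unitary
   representation of the fiber over [m]; the integral defining [pi_rho] is
   understood in the weak sense. *)
Definition dual_fiber (m : M) (c : spectrum A) : Prop :=
  exists (pi : irrep A)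
         (rho : H -> {linear irrep_space pi -> irrep_space pi}),
  [/\ is_irreducible_unitary_rep m rho,
      forall (f : CH R H) v w,
        ip (irrep_space pi) (pi (iota f) v) w =
        cintegral (lambda m) (fiber p m)
          (fun x => f x * ip (irrep_space pi) (rho x v) w) &
      c = spec_of pi].

(* Every [c] lies in [dual_fiber m] for exactly one [m]; the default value
   [p point] is not used. *)
Definition dual_proj (c : spectrum A) : M :=
  xget (p point) [set m | dual_fiber m c].

(* [sigma] is a section over [O]; its values outside [O] are irrelevant. *)
Record is_local_continuous_section (O : set M) (sigma : M -> spectrum A)
  : Prop := IsLocalContinuousSection {
  section_open : open O ;
  section_continuous : forall U : spectrum A -> Prop, hk_open U ->
    open [set m | O m /\ U (sigma m)] ;
  section_proj : forall m, O m -> dual_proj (sigma m) = m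
}.

End dual_bundle.

(* Main.v *)
(* An irreducible representation of C^*(H) lives over a single fiber H_m,
   because multiplication by functions on M separates the fibers and kernels of
   irreducible representations are prime.  Averaging matrix coefficients over
   H_m gives Schur's relations, hence finite dimension, and exhibits the
   representation as the integrated form of a unitary matrix representation r
   of H_m.  By Tietze, r extends to a continuous matrix-valued map on H, which
   is almost multiplicative on the fibers near m.  The Newton-like correction
     r(x) + \int (r(xz) - r(x) r(z)) r(z^-1) dz
   squares the defect of multiplicativity, so its iterates converge uniformly
   over a neighborhood of m to a map rho that represents every nearby fiber and
   equals r on H_m.  As p is open, Haar integrals depend continuously on the
   fiber; therefore Schur's relations at m prevent nonzero matrix coefficients
   of rho from vanishing on a nearby fiber, that is, rho is irreducible there,
   and averaging an inner product makes it unitary.  The resulting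
   representations pi_n of C^*(H) satisfy tr pi_n(f) = \int_{H_n} f tr(rho), so
   that n |-> tr pi_n(a^* a) is continuous for every a; hence the set of those n
   with pi_n(a) <> 0 is open, which is continuity for the hull-kernel topology. *)
Require Import Defs.
From HB Require Import structures.
From mathcomp Require Import all_boot all_order all_algebra.
From mathcomp Require Import complex.
From mathcomp Require Import all_classical all_reals all_analysis.
From mathcomp Require Import measurable_realfun.
From mathcomp Require Import ring lra.

Set Implicit Arguments.
Unset Strict Implicit.
Unset Printing Implicit Defensive.

Import Order.TTheory GRing.Theory Num.Theory numFieldNormedType.Exports.

Local Open Scope classical_set_scope.
Local Open Scope ring_scope.
Local Open Scope complex_scope.

(** * Norms and continuity *)

(** The measures [lambda m] live on a space that need not be metrizable, and no product measure is
    formed. Instead [riemann_sum] replaces a Haar integral by one finite convex combination of point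
    evaluations that serves a whole family of functions at once; Fubini, continuity of integrals in
    the fiber and the weak formula for convolutions all rest on it. Multiplication is continuous
    only on the closed set of pairs in a common fiber, so expressions such as [f (xy)] are first
    extended by Tietze to the compact square of [H]; this is why lemmas on translates constrain
    functions on one fiber only. No Peter-Weyl theory is presupposed: the scalar in Schur's
    relations is found as a largest eigenvalue, attained by a compactness argument. Finally, neither
    the unitarizing matrices nor the representations [pi_n] are chosen continuously in [n]. All that
    links the fibers is the character [tr rho], which conjugation does not change, and this is
    enough because the hull-kernel topology sees only kernels. *)

Section norms.
Context (R : realType).
Implicit Types (V : normedModType R[i]).

Lemma normE V (v : V) : `|v| = (normr_of v)%:C.
Proof.
have := normr_ge0 v; rewrite /normr_of; case: `|v| => a b /=.
by rewrite lecE /= => /andP[/eqP -> _].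
Qed.

Lemma normcE (z : R[i]) : `|z| = (normr_of (z : R[i]^o))%:C.
Proof. exact: (normE (z : R[i]^o)). Qed.

Lemma nr_ge0 V (v : V) : 0 <= normr_of v.
Proof. by have := normr_ge0 v; rewrite normE lecR. Qed.

Lemma nrD V (v w : V) : normr_of (v + w) <= normr_of v + normr_of w.
Proof. by have := ler_normD v w; rewrite !normE -rmorphD /= lecR. Qed.

Lemma nrN V (v : V) : normr_of (- v) = normr_of v.
Proof. by rewrite /normr_of normrN. Qed.

Lemma nrB V (v w : V) : normr_of (v - w) <= normr_of v + normr_of w.
Proof. by rewrite -(nrN w); exact: nrD. Qed.

Lemma nr_distC V (v w : V) : normr_of (v - w) = normr_of (w - v).
Proof. by rewrite -nrN opprB. Qed.

Lemma nrZ V (k : R[i]) (v : V) :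
  normr_of (k *: v) = normr_of (k : R[i]^o) * normr_of v.
Proof.
by apply: (@complexI R); rewrite rmorphM /= -!normE normrZ.
Qed.

Lemma nr0 V : normr_of (0 : V) = 0.
Proof. by rewrite /normr_of normr0. Qed.

Lemma nr_eq0 V (v : V) : normr_of v = 0 -> v = 0.
Proof. by move=> v0; apply/eqP; rewrite -normr_eq0 normE v0. Qed.

Lemma nr_gt0 V (v : V) : (0 < normr_of v) = (v != 0).
Proof. by rewrite -normr_gt0 normE ltcR. Qed.

Lemma nrM (a b : R[i]) :
  normr_of (a * b : R[i]^o) = normr_of (a : R[i]^o) * normr_of (b : R[i]^o).
Proof. exact: nrZ. Qed.

Lemma nr_real (r : R) : normr_of (r%:C : R[i]^o) = `|r|.
Proof. by apply: (@complexI R); rewrite -normE normc_def /= expr0n addr0 sqrtr_sqr. Qed.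

Lemma nr_conj (z : R[i]) : normr_of (Num.conj z : R[i]^o) = normr_of (z : R[i]^o).
Proof. by rewrite /normr_of norm_conjC. Qed.

Lemma nrCK (z : R[i]) : z * Num.conj z = (normr_of (z : R[i]^o) ^+ 2)%:C.
Proof. by rewrite -normCK rmorphXn /=; congr (_ ^+ 2); exact: normcE. Qed.

Lemma nr_sum V (I : Type) (r : seq I) (P : pred I) (F : I -> V) :
  normr_of (\sum_(i <- r | P i) F i) <= \sum_(i <- r | P i) normr_of (F i).
Proof.
elim/big_ind2 : _ => [|x1 x2 y1 y2 h1 h2|//]; first by rewrite nr0.
by apply: le_trans (nrD _ _) _; exact: lerD.
Qed.

Lemma le_nr_Re (z : R[i]) : `|complex.Re z| <= normr_of (z : R[i]^o).
Proof.
rewrite -lecR -normE normc_def lecR; case: z => a b /=.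
by rewrite -{1}sqrtr_sqr ler_wsqrtr// lerDl sqr_ge0.
Qed.

Lemma le_nr_Im (z : R[i]) : `|complex.Im z| <= normr_of (z : R[i]^o).
Proof.
rewrite -lecR -normE normc_def lecR; case: z => a b /=.
by rewrite -{1}sqrtr_sqr ler_wsqrtr// lerDr sqr_ge0.
Qed.

Lemma nr_le_ReIm (z : R[i]) :
  normr_of (z : R[i]^o) <= `|complex.Re z| + `|complex.Im z|.
Proof.
rewrite {1}[z]complexE; apply: le_trans (nrD _ _) _.
rewrite nr_real lerD2l nrM nr_real (_ : normr_of _ = 1) ?mul1r //.
by rewrite /normr_of normc_def /= expr0n expr1n add0r sqrtr1.
Qed.

Lemma nr_triB V (u v w : V) :
  normr_of (u - w) <= normr_of (u - v) + normr_of (v - w).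
Proof. by rewrite (_ : u - w = (u - v) + (v - w)) ?nrD // addrA subrK. Qed.

Lemma nr_triD V (u v : V) : normr_of u <= normr_of (u - v) + normr_of v.
Proof. by rewrite -{1}(subrK v u) nrD. Qed.

End norms.

Section continuity.
Context (R : realType) (T : topologicalType).

Lemma cont_nrP (V : normedModType R[i]) (f : T -> V) :
  continuous f <-> forall x (e : R), 0 < e ->
    \forall y \near x, normr_of (f y - f x) < e.
Proof.
split=> [cf x e e0|cf x].
  have /cvgrPdist_lt /(_ (e%:C)) := cf x; rewrite ltcR => /(_ e0).
  by apply: filterS => y; rewrite normE ltcR nr_distC.
apply/cvgrPdist_lt => e e0.
(* The order of [R[i]] forces a positive [e] to be real; what remains is a real estimate. *)
have eE : e = (complex.Re e)%:C by move: e0; case: (e) => a b; rewrite ltcE /= => /andP[/eqP -> _].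
move: e0; rewrite eE ltcR => e0; have := cf x _ e0.
by apply: filterS => y; rewrite normE ltcR nr_distC.
Qed.

Lemma cont_cst (V : topologicalType) (v : V) : continuous (fun _ : T => v).
Proof. by move=> x; exact: cvg_cst. Qed.

Lemma contD (V : normedModType R[i]) (f g : T -> V) :
  continuous f -> continuous g -> continuous (fun x => f x + g x).
Proof. by move=> cf cg x; apply: cvgD; [exact: cf|exact: cg]. Qed.

Lemma contN (V : normedModType R[i]) (f : T -> V) :
  continuous f -> continuous (fun x => - f x).
Proof. by move=> cf x; apply: cvgN; exact: cf. Qed.

Lemma contB (V : normedModType R[i]) (f g : T -> V) :
  continuous f -> continuous g -> continuous (fun x => f x - g x).
Proof. by move=> cf cg x; apply: cvgB; [exact: cf|exact: cg]. Qed.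

Lemma contZ (V : normedModType R[i]) (f : T -> R[i]^o) (g : T -> V) :
  continuous f -> continuous g -> continuous (fun x => f x *: g x).
Proof. by move=> cf cg x; apply: cvgZ; [exact: cf|exact: cg]. Qed.

Lemma contM (f g : T -> R[i]^o) :
  continuous f -> continuous g -> continuous (fun x => f x * g x : R[i]^o).
Proof. exact: contZ. Qed.

Lemma cont_sum (V : normedModType R[i]) (I : Type) (r : seq I) (P : pred I)
    (F : I -> T -> V) : (forall i, continuous (F i)) ->
  continuous (fun x => \sum_(i <- r | P i) F i x).
Proof.
move=> cF; elim: r => [|i r IHr].
  by under eq_fun do rewrite big_nil; exact: cont_cst.
under eq_fun do rewrite big_cons.
by case: (P i) => //; apply: contD.
Qed.

Lemma cont_conj (f : T -> R[i]^o) : continuous f ->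
  continuous (fun x => Num.conj (f x) : R[i]^o).
Proof.
move=> /cont_nrP cf; apply/cont_nrP => x e e0.
by apply: filterS (cf x e e0) => y; rewrite -rmorphB nr_conj.
Qed.

Lemma cont_nr (V : normedModType R[i]) (f : T -> V) : continuous f ->
  continuous (fun x => normr_of (f x) : R^o).
Proof.
move=> /cont_nrP cf x; apply/cvgrPdist_lt => e e0.
apply: filterS (cf x e e0) => y; apply: le_lt_trans.
have := nr_triD (f x) (f y); have := nr_triD (f y) (f x).
by rewrite (nr_distC (f x)) ler_distl => h1 h2; apply/andP; split; lra.
Qed.

Lemma cont_real (f : T -> R^o) : continuous f -> continuous (fun x => (f x)%:C : R[i]^o).
Proof.
move=> cf; apply/cont_nrP => x e e0; move/cvgrPdist_lt : (cf x) => /(_ e e0).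
by apply: filterS => y; rewrite -rmorphB nr_real distrC.
Qed.

Lemma cont_Re (f : T -> R[i]^o) : continuous f -> continuous (fun x => complex.Re (f x) : R^o).
Proof.
move=> /cont_nrP cf x; apply/cvgrPdist_lt => e e0.
apply: filterS (cf x e e0) => y; apply: le_lt_trans; rewrite distrC.
by rewrite -raddfB; exact: le_nr_Re.
Qed.

Lemma cont_Im (f : T -> R[i]^o) : continuous f -> continuous (fun x => complex.Im (f x) : R^o).
Proof.
move=> /cont_nrP cf x; apply/cvgrPdist_lt => e e0.
apply: filterS (cf x e e0) => y; apply: le_lt_trans; rewrite distrC.
by rewrite -raddfB; exact: le_nr_Im.
Qed.

Lemma cont_ReIm (f g : T -> R^o) : continuous f -> continuous g ->
  continuous (fun x => f x +i* g x : R[i]^o).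
Proof.
move=> cf cg; under eq_fun do rewrite [_ +i* _]complexE /=.
apply: contD; first exact: cont_real.
by apply: contM; [exact: cont_cst|exact: cont_real].
Qed.

End continuity.

Lemma cont_comp (S T U : topologicalType) (f : S -> T) (g : T -> U) :
  continuous f -> continuous g -> continuous (fun x => g (f x)).
Proof. by move=> cf cg x; apply: continuous_comp; [exact: cf|exact: cg]. Qed.

Lemma cont_pair (S T U : topologicalType) (f : S -> T) (g : S -> U) :
  continuous f -> continuous g -> continuous (fun x => (f x, g x)).
Proof. by move=> cf cg x; apply: cvg_pair; [exact: cf|exact: cg]. Qed.

Lemma cont_fst (T U : topologicalType) : continuous (fun z : T * U => z.1).
Proof. by move=> z; exact: cvg_fst. Qed.

Lemma cont_snd (T U : topologicalType) : continuous (fun z : T * U => z.2).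
Proof. by move=> z; exact: cvg_snd. Qed.

(* Complex-valued functions are kept at type [R[i]], so that the ring
   operations on their values are those of [R[i]] and not those of [R[i]^o]. *)
Section complex_valued.
Context (R : realType).
Implicit Types (a b c : R[i]).

Definition nc (z : R[i]) : R := normr_of (z : R[i]^o).

Lemma nc_ge0 a : 0 <= nc a. Proof. exact: nr_ge0. Qed.
Lemma ncD a b : nc (a + b) <= nc a + nc b. Proof. exact: (nrD (a : R[i]^o)). Qed.
Lemma ncN a : nc (- a) = nc a. Proof. exact: (nrN (a : R[i]^o)). Qed.
Lemma ncB a b : nc (a - b) <= nc a + nc b. Proof. exact: (nrB (a : R[i]^o)). Qed.
Lemma nc_distC a b : nc (a - b) = nc (b - a). Proof. exact: (nr_distC (a : R[i]^o)). Qed.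
Lemma nc0 : nc 0 = 0. Proof. exact: nr0. Qed.
Lemma nc_eq0 a : nc a = 0 -> a = 0. Proof. exact: (@nr_eq0 R R[i]^o). Qed.
Lemma nc_gt0 a : (0 < nc a) = (a != 0). Proof. exact: (@nr_gt0 R R[i]^o). Qed.
Lemma ncM a b : nc (a * b) = nc a * nc b. Proof. exact: nrM. Qed.
Lemma nc_real (r : R) : nc r%:C = `|r|. Proof. exact: nr_real. Qed.
Lemma nc_conj a : nc (Num.conj a) = nc a. Proof. exact: nr_conj. Qed.
Lemma ncCK a : a * Num.conj a = (nc a ^+ 2)%:C. Proof. exact: nrCK. Qed.
Lemma nc_sum (I : Type) (r : seq I) (P : pred I) (F : I -> R[i]) :
  nc (\sum_(i <- r | P i) F i) <= \sum_(i <- r | P i) nc (F i).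
Proof. exact: (@nr_sum R R[i]^o). Qed.
Lemma nc_triB a b c : nc (a - c) <= nc (a - b) + nc (b - c).
Proof. exact: (@nr_triB R R[i]^o). Qed.
Lemma nc_triD a b : nc a <= nc (a - b) + nc b.
Proof. exact: (@nr_triD R R[i]^o). Qed.
Lemma nrZc (V : normedModType R[i]) a (v : V) : normr_of (a *: v) = nc a * normr_of v.
Proof. exact: nrZ. Qed.
Lemma le_nc_Re a : `|complex.Re a| <= nc a. Proof. exact: le_nr_Re. Qed.
Lemma le_nc_Im a : `|complex.Im a| <= nc a. Proof. exact: le_nr_Im. Qed.
Lemma nc_le0_eq0 a : (forall e : R, 0 < e -> nc a <= e) -> a = 0.
Proof.
move=> ae; apply: nc_eq0; apply/eqP; rewrite eq_le nc_ge0 andbT.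
by apply/ler_addgt0Pr => e e0; rewrite add0r; exact: ae.
Qed.

Context (T : topologicalType).
Implicit Types f g : T -> R[i].

Definition ccont f := continuous (f : T -> R[i]^o).

Lemma ccontP f : ccont f <-> forall x (e : R), 0 < e -> \forall y \near x, nc (f y - f x) < e.
Proof. exact: cont_nrP. Qed.
Lemma ccont_cst a : ccont (fun=> a). Proof. exact: cont_cst. Qed.
Lemma ccontD f g : ccont f -> ccont g -> ccont (fun x => f x + g x). Proof. exact: contD. Qed.
Lemma ccontN f : ccont f -> ccont (fun x => - f x). Proof. exact: contN. Qed.
Lemma ccontB f g : ccont f -> ccont g -> ccont (fun x => f x - g x). Proof. exact: contB. Qed.
Lemma ccontM f g : ccont f -> ccont g -> ccont (fun x => f x * g x). Proof. exact: contZ. Qed.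
Lemma ccont_sum (I : Type) (r : seq I) (P : pred I) (F : I -> T -> R[i]) :
  (forall i, ccont (F i)) -> ccont (fun x => \sum_(i <- r | P i) F i x).
Proof. exact: (@cont_sum R T R[i]^o). Qed.
Lemma ccont_conj f : ccont f -> ccont (fun x => Num.conj (f x)). Proof. exact: cont_conj. Qed.
Lemma cont_nc f : ccont f -> continuous (fun x => nc (f x) : R^o). Proof. exact: cont_nr. Qed.
Lemma ccont_real (f : T -> R^o) : continuous f -> ccont (fun x => (f x)%:C). Proof. exact: cont_real. Qed.
Lemma ccont_Re f : ccont f -> continuous (fun x => complex.Re (f x) : R^o). Proof. exact: cont_Re. Qed.
Lemma ccont_Im f : ccont f -> continuous (fun x => complex.Im (f x) : R^o). Proof. exact: cont_Im. Qed.
End complex_valued.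

Lemma ccont_comp (R : realType) (S T : topologicalType) (f : S -> T) (g : T -> R[i]) :
  continuous f -> ccont g -> ccont (fun x => g (f x)).
Proof. exact: cont_comp. Qed.

(** * Compact Hausdorff spaces: tube lemma, extension of functions, fibers *)

Lemma prod_hausdorff (S T : topologicalType) :
  hausdorff_space S -> hausdorff_space T -> hausdorff_space (S * T)%type.
Proof.
move=> hS hT [p1 p2] [q1 q2] pq; congr pair.
  apply: hS => A B Ap Bq.
  have [||[x y] [/= Ax Bx]] := pq (A `*` setT) (B `*` setT).
  - by exists (A, setT) => //; split => //; exact: filterT.
  - by exists (B, setT) => //; split => //; exact: filterT.
  by exists x; split; [case: Ax|case: Bx].
apply: hT => A B Ap Bq.
have [||[x y] [/= Ax Bx]] := pq (setT `*` A) (setT `*` B).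
- by exists (setT, A) => //; split => //; exact: filterT.
- by exists (setT, B) => //; split => //; exact: filterT.
by exists y; split; [case: Ax|case: Bx].
Qed.

Lemma compact_prod (S T : topologicalType) :
  compact [set: S] -> compact [set: T] -> compact [set: (S * T)%type].
Proof. by move=> cS cT; rewrite -setXTT; exact: compact_setX. Qed.

Section compactness.
Context (R : realType).

Lemma near_compact (S T : topologicalType) (P : S -> T -> Prop) (s : S) :
  compact [set: T] -> (forall t : T, \forall t' \near t & s' \near s, P s' t') ->
  \forall s' \near s, forall t, P s' t.
Proof.
move=> /compact_near_coveringP cT nP.
have nPs := cT S (nbhs s) P (nbhs_filter s) (fun t _ => nP t).
by apply: (@filterS _ (nbhs s) _ _ _ _ nPs) => s' sP t; exact: sP.
Qed.

(** Continuity in two variables is uniform over a compact second variable. Most neighborhoods fed to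
    [riemann_sum] are obtained this way. *)
Lemma tube (S T : topologicalType) (V : normedModType R[i]) (f : S * T -> V)
    (s : S) (e : R) : compact [set: T] -> continuous f -> 0 < e ->
  \forall s' \near s, forall t, normr_of (f (s', t) - f (s, t)) < e.
Proof.
move=> cT /cont_nrP cf e0; apply: near_compact cT _ => t.
have e2 : 0 < e / 2 by rewrite divr_gt0.
have [[A B] /= [As Bt] AB] := cf (s, t) _ e2.
exists (B, A) => //= -[t' s'] /= [Bt' As'].
(* [f (s', t')] and [f (s, t')] are both compared with the value at the one point [(s, t)]. *)
apply: le_lt_trans (nr_triB _ (f (s, t)) _) _.
rewrite [e]splitr ltrD//; first exact: (AB (s', t')).
by rewrite nr_distC; apply: (AB (s, t')); split => //=; exact: nbhs_singleton.
Qed.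

Lemma ctube (S T : topologicalType) (f : S * T -> R[i]) (s : S) (e : R) :
  compact [set: T] -> ccont f -> 0 < e ->
  \forall s' \near s, forall t, nc (f (s', t) - f (s, t)) < e.
Proof. exact: tube. Qed.

Lemma compact_nr_bounded (T : topologicalType) (V : normedModType R[i]) (f : T -> V) :
  compact [set: T] -> continuous f ->
  exists2 b : R, 0 < b & forall x, normr_of (f x) <= b.
Proof.
move=> cT /cont_nr cf.
have : compact ((fun x => normr_of (f x) : R^o) @` setT).
  by apply: continuous_compact => //; exact: continuous_subspaceT.
move=> /compact_bounded [b [_ bP]].
exists (`|b| + 1); first by rewrite ltr_wpDl.
move=> x; have := bP (`|b| + 1) _ _ (imageT _ x).
rewrite ltr_pwDr ?ler_norm// => /(_ isT); apply: le_trans.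
exact: ler_norm.
Qed.

Lemma compact_nc_bounded (T : topologicalType) (f : T -> R[i]) :
  compact [set: T] -> ccont f -> exists2 b : R, 0 < b & forall x, nc (f x) <= b.
Proof. exact: compact_nr_bounded. Qed.

Section extension.
Context (T : topologicalType) (cT : compact [set: T]) (hT : hausdorff_space T).

Lemma real_tietze (A : set T) (f : T -> R^o) : closed A -> {within A, continuous f} ->
  exists2 g : T -> R^o, continuous g & forall x, A x -> g x = f x.
Proof.
move=> clA cf.
have : compact (f @` A).
  by apply: continuous_compact => //; exact: subclosed_compact clA cT _.
move=> /compact_bounded [b [_ bP]].
have b0 : 0 < `|b| + 1 by rewrite ltr_wpDl.
have fb x : A x -> `|f x| <= `|b| + 1.
  move=> Ax; apply: (bP (`|b| + 1)); last by exists x.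
  by rewrite ltr_pwDr ?ler_norm.
have [g [fg cg _]] := continuous_bounded_extension (compact_normal hT cT) clA b0 cf fb.
by exists g => // x Ax; rewrite fg// inE.
Qed.

Lemma complex_tietze (A : set T) (f : T -> R[i]^o) : closed A -> {within A, continuous f} ->
  exists2 g : T -> R[i]^o, continuous g & forall x, A x -> g x = f x.
Proof.
move=> clA cf.
have [g1 cg1 g1f] := real_tietze clA (@cont_Re R (subspace A) f cf).
have [g2 cg2 g2f] := real_tietze clA (@cont_Im R (subspace A) f cf).
exists (fun x => g1 x +i* g2 x); first exact: cont_ReIm.
by move=> x Ax; rewrite g1f// g2f//; case: (f x).
Qed.

Lemma ccont_tietze (A : set T) (f : T -> R[i]) : closed A ->
  {within A, continuous (f : T -> R[i]^o)} ->
  exists2 g : T -> R[i], ccont g & forall x, A x -> g x = f x.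
Proof. exact: complex_tietze. Qed.

Lemma urysohn_bump (U : set T) (x : T) : nbhs x U ->
  exists g : T -> R^o, [/\ continuous g, g x = 1, forall y, 0 <= g y <= 1
    & forall y, ~ U y -> g y = 0].
Proof.
rewrite nbhsE => -[W [oW Wx] WU].
have [] := @urysohn_ext_itv T R (compact_normal hT cT) (~` W) [set x] 0 1.
- exact: open_closedC.
- exact: (accessible_closed_set1 (hausdorff_accessible hT)).
- by rewrite -subset0 => y [/= nW yx]; apply: nW; rewrite yx.
- exact: ltr01.
move=> g [cg g0 g1 g01]; exists g; split => //.
- by apply: g1; exists x.
- by move=> y; have := g01 (g y) (imageT _ y); rewrite /= in_itv.
- by move=> y nU; apply: g0; exists y => // /WU.
Qed.

End extension.

(** A continuous map from a compact space to a Hausdorff space is closed, so its fibers are upper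
    semicontinuous. *)
Lemma fiber_nbhs (T M : topologicalType) (p : T -> M) (U : set T) (m : M) :
  compact [set: T] -> hausdorff_space M -> continuous p -> open U ->
  (forall x, p x = m -> U x) -> \forall m' \near m, forall x, p x = m' -> U x.
Proof.
move=> cT hM cp oU mU; apply: near_compact cT _ => x.
have [pxm|pxm] := pselect (p x = m).
  exists (U, setT) => /=; last by case=> a b /= [].
  by split; [apply: open_nbhs_nbhs; split => //; exact: mU|exact: filterT].
(* Off the fiber, [p x] and [m] have disjoint neighborhoods, so the premise [p x = m'] fails near
   [(x, m)]. *)
have /eqP pxm' := pxm; move: hM; rewrite open_hausdorff.
move=> /(_ _ _ pxm') [[A B] /= [/set_mem Ax /set_mem Bm] [oA oB /eqP AB0]].
exists (p @^-1` A, B) => /=.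
  by split; [apply: cp|]; apply: open_nbhs_nbhs.
case=> a b /= [Aa Bb] ab; exfalso.
have : (A `&` B) b by split => //; rewrite -ab.
by rewrite AB0.
Qed.

End compactness.

Section borel_sets.
Context (T : ptopologicalType).

Lemma borel_open (U : set T) : open U -> measurable (U : set (borel T)).
Proof. exact: sub_sigma_algebra. Qed.

Lemma borel_closed (F : set T) : closed F -> measurable (F : set (borel T)).
Proof. by move=> /closed_openC /borel_open /measurableC; rewrite setCK. Qed.

Lemma borel_cont (R : realType) (f : T -> R^o) : continuous f ->
  measurable_fun (setT : set (borel T)) (f : borel T -> R).
Proof.
move=> /continuousP cf; apply: (measurability _ (RGenOpens.measurableE R)).
move=> _ [_ [a [b ->] <-]]; rewrite setTI.
by apply: borel_open; apply/cf/interval_open.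
Qed.

End borel_sets.

(** * Haar integrals on the fibers *)

Section bundle_group.
Context (M H : topologicalType) (p : compact_group_bundle M H).
Implicit Types x y z : H.

Lemma gb_mulKx x y : p x = p y -> gb_mul p (gb_inv p x) (gb_mul p x y) = y.
Proof.
by move=> xy; rewrite gb_mulA ?gb_proj_inv// gb_mulVx xy gb_mul1x.
Qed.

Lemma gb_mulVKx x y : p x = p y -> gb_mul p x (gb_mul p (gb_inv p x) y) = y.
Proof.
by move=> xy; rewrite gb_mulA ?gb_proj_inv// gb_mulxV xy gb_mul1x.
Qed.

Lemma gb_invK x : gb_inv p (gb_inv p x) = x.
Proof.
rewrite -[RHS](@gb_mulKx (gb_inv p x) x) ?gb_proj_inv//.
by rewrite gb_mulVx -(gb_proj_inv p x) -(gb_proj_inv p (gb_inv p x)) gb_mulx1.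
Qed.

Lemma gb_mulxK x y : p x = p y -> gb_mul p (gb_mul p x y) (gb_inv p y) = x.
Proof.
by move=> xy; rewrite -gb_mulA ?gb_proj_inv// gb_mulxV -xy gb_mulx1.
Qed.

Lemma gb_mulxVK x y : p x = p y -> gb_mul p (gb_mul p x (gb_inv p y)) y = x.
Proof.
by move=> xy; rewrite -gb_mulA ?gb_proj_inv// gb_mulVx -xy gb_mulx1.
Qed.

Lemma gb_invM x y : p x = p y ->
  gb_inv p (gb_mul p x y) = gb_mul p (gb_inv p y) (gb_inv p x).
Proof.
move=> xy; rewrite -(@gb_mulKx (gb_mul p x y) (gb_mul p (gb_inv p y) (gb_inv p x))); last first.
  by rewrite !gb_proj_mul ?gb_proj_inv.
rewrite [gb_mul p (gb_mul p x y) _]gb_mulA ?gb_proj_mul ?gb_proj_inv// gb_mulxK// gb_mulxV.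
by rewrite -(gb_proj_mul xy) -gb_proj_inv gb_mulx1.
Qed.

Lemma gb_inv1 m : gb_inv p (gb_one p m) = gb_one p m.
Proof.
have := gb_mulx1 p (gb_inv p (gb_one p m)); rewrite gb_proj_inv gb_proj_one.
by have := gb_mulVx p (gb_one p m); rewrite gb_proj_one => -> <-.
Qed.

Lemma gb_mul1 m x : p x = m -> gb_mul p (gb_one p m) x = x.
Proof. by move=> <-; rewrite gb_mul1x. Qed.

End bundle_group.

Section haar_integral.
Context (R : realType) (M : topologicalType) (H : ptopologicalType)
  (p : compact_group_bundle M H) (lambda : M -> probability (borel H) R)
  (lambda_haar : forall m : M, is_haar p m (lambda m)).
Implicit Types (m : M) (x y : H).

Lemma closed_fiber m : closed (fiber p m).
Proof.
have : closed [set m] by apply: (accessible_closed_set1 (hausdorff_accessible (gb_hausdorffM p))).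
by move=> /preimage_closed; apply => x _; exact: gb_proj_continuous.
Qed.

Lemma measurable_fiber m : measurable (fiber p m : set (borel H)).
Proof. by apply: borel_closed; exact: closed_fiber. Qed.

Lemma real_compact_bounded (f : H -> R^o) : continuous f -> exists2 b : R, 0 < b & forall x, `|f x| <= b.
Proof.
move=> /cont_real /(compact_nr_bounded (gb_compactH p))[b b0 fb].
by exists b => // x; rewrite -nr_real.
Qed.

Lemma integrable_cont m (f : H -> R^o) : continuous f ->
  (lambda m).-integrable (fiber p m) (EFin \o (f : borel H -> R)).
Proof.
move=> cf; apply: measurable_bounded_integrable.
- exact: measurable_fiber.
- by rewrite (le_lt_trans (probability_le1 _ (measurable_fiber m))) ?ltry.
- by apply: measurable_funTS; exact: borel_cont.
have [b b0 fb] := real_compact_bounded cf.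
exists b; split; first exact: num_real.
by move=> c bc x _; exact: le_trans (fb x) (ltW bc).
Qed.

Definition rint m (f : H -> R) : R := \int[lambda m]_(x in fiber p m) f x.

Lemma rintD m (f g : H -> R^o) : continuous f -> continuous g ->
  rint m (fun x => f x + g x) = rint m f + rint m g.
Proof.
by move=> cf cg; rewrite /rint RintegralD//;
  [exact: measurable_fiber|exact: integrable_cont|exact: integrable_cont].
Qed.

Lemma rintZ m (r : R) (f : H -> R^o) : continuous f ->
  rint m (fun x => r * f x) = r * rint m f.
Proof.
by move=> cf; rewrite /rint RintegralZl//; [exact: measurable_fiber|exact: integrable_cont].
Qed.

Lemma rint_cst m (r : R) : rint m (fun=> r) = r.
Proof.
rewrite /rint Rintegral_cst; last exact: measurable_fiber.
rewrite -[RHS]mulr1; congr (_ * _); exact: (congr1 fine (haar_fiber (lambda_haar m))).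
Qed.

Lemma rint_le m (f g : H -> R^o) : continuous f -> continuous g ->
  (forall x, p x = m -> f x <= g x) -> rint m f <= rint m g.
Proof.
move=> cf cg fg; apply: le_Rintegral => //; first exact: measurable_fiber.
- exact: integrable_cont.
- exact: integrable_cont.
Qed.

Lemma eq_rint m (f g : H -> R) : (forall x, p x = m -> f x = g x) -> rint m f = rint m g.
Proof. by move=> fg; apply: eq_Rintegral => x /set_mem; exact: fg. Qed.

Lemma mul_fiber_cont m x : p x = m ->
  {within fiber p m, continuous (gb_mul p x : H -> H)}.
Proof.
move=> xm; apply/subspace_continuousP => y ym.
have /subspace_continuousP cm := @gb_mul_continuous _ _ p.
have := cm (x, y); rewrite /= xm => /(_ (esym ym)) h.
move=> A /= nA; have [[B C] /= [Bx Cy] BC] := h A nA.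
apply: filterS Cy => z Cz zm; apply: (BC (x, z)) => //=.
  by split => //=; exact: nbhs_singleton.
by rewrite xm zm.
Qed.

(** Translation by [x] makes sense on one fiber only. Completed by the identity it is a Borel, in
    general discontinuous, self-map of [H] along which [lambda m] can be pushed forward. *)
Definition fiber_translate m x y := if p y == m then gb_mul p x y else y.

Lemma measurable_translate m x : p x = m ->
  measurable_fun (setT : set (borel H)) (fiber_translate m x : borel H -> borel H).
Proof.
move=> xm; apply: (@measurability _ _ (borel H) (borel H) setT _ (@open H)) => //.
move=> _ [U oU <-]; rewrite setTI.
have -> : fiber_translate m x @^-1` U =
    (fiber p m `&` gb_mul p x @^-1` U) `|` (~` fiber p m `&` U).
  apply/seteqP; split => y /=; rewrite /fiber_translate; case: eqP.
  - by move=> ym Uy; left.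
  - by move=> ym Uy; right.
  - by move=> ym [[]|[]].
  - by move=> ym [[]|[]].
apply: measurableU; last first.
  by apply: measurableI; [apply: measurableC; exact: measurable_fiber|exact: borel_open].
have /continuousP/(_ _ oU)/open_subspaceP[V oV VU] := mul_fiber_cont xm.
rewrite setIC -VU; apply: measurableI; [exact: borel_open|exact: measurable_fiber].
Qed.

(** Change of variables along [fiber_translate]. The function [g] is prescribed on the fiber only,
    since [gb_mul p x] need not be continuous on [H]. *)
Lemma rint_translate m x (f g : H -> R^o) : p x = m -> continuous f ->
  (forall y, p y = m -> g y = f (gb_mul p x y)) -> rint m g = rint m f.
Proof.
move=> xm cf gf.
have mF := measurable_fiber m; have mT := measurable_translate xm.
have TF : fiber_translate m x @^-1` fiber p m = fiber p m.
  apply/seteqP; split => y /=; rewrite /fiber /= /fiber_translate; case: eqP => // ym.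
  by rewrite gb_proj_mul ?xm ?ym.
rewrite (@eq_rint m g (f \o fiber_translate m x)); last first.
  by move=> y ym; rewrite /= /fiber_translate ym eqxx gf.
rewrite /rint /Rintegral; congr fine.
have mf : measurable_fun (setT : set (borel H)) (fun y : borel H => (f y : R)%:E).
  by apply/measurable_EFinP; exact: borel_cont.
rewrite -[in LHS]TF -(@integral_pushforward _ _ _ _ _ _ mT (lambda m) (fiber p m) _ mf) //; last first.
  rewrite TF; apply: measurable_bounded_integrable => //.
  - by rewrite (le_lt_trans (probability_le1 _ (measurable_fiber m))) ?ltry.
  - by apply: measurable_funTS; exact: (measurableT_comp (borel_cont cf) mT).
  have [b b0 fb] := real_compact_bounded cf.
  exists b; split; first exact: num_real.
  by move=> c bc y _; exact: le_trans (fb _) (ltW bc).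
apply: eq_measure_integral => A mA AF.
rewrite /pushforward.
(* [haar_invariant] speaks of images under translation, so the preimage of [A] is rewritten as an
   image under the inverse of [x]. *)
pose C := gb_mul p (gb_inv p x) @` A.
have Tx : fiber_translate m x @^-1` A = C.
  apply/seteqP; split => y /=.
    have [ym Ay|ym Ay] := pselect (p y = m); last first.
      by exfalso; apply: (ym); apply: AF; move: Ay; rewrite /fiber_translate; case: eqP.
    move: Ay; rewrite /fiber_translate ym eqxx => Ay.
    by exists (gb_mul p x y) => //; rewrite gb_mulKx// xm ym.
  move=> [z Az <-]; rewrite /fiber_translate.
  have zm : p z = m := AF _ Az.
  by rewrite gb_proj_mul ?gb_proj_inv ?xm ?zm// eqxx gb_mulVKx// xm zm.
have CA : lambda m C = lambda m A.
  by apply: (haar_invariant (lambda_haar m)) => //; rewrite /fiber /= gb_proj_inv.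
exact: etrans (congr1 (lambda m) Tx) CA.
Qed.

End haar_integral.

Lemma compact_finite (T : ptopologicalType) (A : set T) (V : T -> set T) :
  compact A -> (forall x, A x -> nbhs x (V x)) ->
  exists s : seq T, (forall x, x \in s -> A x) /\ forall y, A y -> exists2 x, x \in s & V x y.
Proof.
rewrite compact_cover => cA nV.
have [||D DA Dcov] := cA _ A (fun x => interior (V x)).
- by move=> x _; exact: open_interior.
- by move=> x Ax; exists x => //; exact: nV.
exists (finmap.enum_fset D); split; first by move=> x /DA /set_mem.
by move=> y /Dcov [x /= xD /interior_subset Vy]; exists x.
Qed.

(** * Complex Haar integrals and uniform Riemann sums *)

Section complex_haar.
Context (R : realType) (M : topologicalType) (H : ptopologicalType)
  (p : compact_group_bundle M H) (lambda : M -> probability (borel H) R)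
  (lambda_haar : forall m : M, is_haar p m (lambda m)).
Implicit Types (m : M) (x y : H).
Notation rint := (rint p lambda).

Definition cint m (f : H -> R[i]) : R[i] := cintegral (lambda m) (fiber p m) f.

Lemma cintE m f : cint m f = rint m (fun x => complex.Re (f x)) +i* rint m (fun x => complex.Im (f x)).
Proof. by []. Qed.

Lemma eq_cint m (f g : H -> R[i]) : (forall x, p x = m -> f x = g x) -> cint m f = cint m g.
Proof. by move=> fg; rewrite !cintE; congr (_ +i* _); apply: eq_rint => x /fg ->. Qed.

Lemma cintD m (f g : H -> R[i]) : ccont f -> ccont g ->
  cint m (fun x => f x + g x) = cint m f + cint m g.
Proof.
move=> cf cg; rewrite !cintE.
rewrite -[RHS]/((_ + _) +i* (_ + _)); congr (_ +i* _).
  by rewrite -rintD; [by apply: eq_rint => x _; case: (f x) (g x) => ? ? []|exact: ccont_Re..].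
by rewrite -rintD; [by apply: eq_rint => x _; case: (f x) (g x) => ? ? []|exact: ccont_Im..].
Qed.

Lemma cintZ m (a : R[i]) (f : H -> R[i]) : ccont f ->
  cint m (fun x => a * f x) = a * cint m f.
Proof.
move=> cf; rewrite !cintE; case: a => a b.
have cr := ccont_Re cf; have ci := ccont_Im cf.
have cZ (r : R) (h : H -> R^o) : continuous h -> continuous (fun x => r * h x : R^o).
  by move=> ch x; apply: cvgM; [exact: cvg_cst|exact: ch].
rewrite -[RHS]/((_ - _) +i* (_ + _)); congr (_ +i* _).
  rewrite -mulNr -!(@rintZ R M H p lambda m) // -rintD; [|exact: cZ..].
  by apply: eq_rint => x _; case: (f x) => ? ? /=; rewrite mulNr.
rewrite -!(@rintZ R M H p lambda m) // -rintD; [|exact: cZ..].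
by apply: eq_rint => x _; case: (f x).
Qed.

Lemma cintB m (f g : H -> R[i]) : ccont f -> ccont g ->
  cint m (fun x => f x - g x) = cint m f - cint m g.
Proof.
move=> cf cg; rewrite cintD; [|exact: cf|by apply: ccontN; exact: cg].
congr (_ + _); rewrite -mulN1r -cintZ; last exact: cg.
by apply: eq_cint => x _; rewrite mulN1r.
Qed.

Lemma cint_real m (f : H -> R) : cint m (fun x => (f x)%:C) = (rint m f)%:C.
Proof. by rewrite cintE /=; congr (_ +i* _); rewrite rint_cst. Qed.

Lemma cint_cst m (a : R[i]) : cint m (fun=> a) = a.
Proof. by rewrite cintE !rint_cst//; case: a. Qed.

Lemma cint_conj m (f : H -> R[i]) : ccont f ->
  cint m (fun x => Num.conj (f x)) = Num.conj (cint m f).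
Proof.
move=> cf; rewrite !cintE.
rewrite -[RHS]/(_ +i* - _); congr (_ +i* _); first by apply: eq_rint => x _; case: (f x).
rewrite -mulN1r -rintZ; last exact: ccont_Im.
by apply: eq_rint => x _; rewrite mulN1r; case: (f x).
Qed.

Lemma cint_sum m (I : Type) (r : seq I) (P : pred I) (F : I -> H -> R[i]) :
  (forall i, ccont (F i)) ->
  cint m (fun x => \sum_(i <- r | P i) F i x) = \sum_(i <- r | P i) cint m (F i).
Proof.
move=> cF; elim: r => [|i r IHr].
  by rewrite big_nil -[RHS](cint_cst m); apply: eq_cint => x _; rewrite big_nil.
rewrite big_cons -IHr; case: ifP => Pi.
  rewrite -cintD//; last exact: ccont_sum.
  by apply: eq_cint => x _; rewrite big_cons Pi.
by apply: eq_cint => x _; rewrite big_cons Pi.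
Qed.

(* Rotating the integral to the positive axis reduces to the real case. *)
Lemma cint_nr m (f : H -> R[i]) : ccont f ->
  nc (cint m f) <= rint m (fun x => nc (f x)).
Proof.
move=> cf; set z := cint m f.
have [->|z0] := eqVneq z 0.
  by rewrite nc0 -(rint_cst lambda_haar m 0); apply: rint_le => //;
    [exact: cont_cst|exact: cont_nc|move=> *; exact: nc_ge0].
pose u : R[i] := Num.conj z * (nc (z))^-1%:C.
have nz : 0 < nc (z) by rewrite nc_gt0.
have nu : nc (u) = 1.
  by rewrite /u ncM nc_conj nc_real ger0_norm ?invr_ge0 ?nc_ge0// divff// gt_eqF.
have uz : u * z = (nc (z))%:C.
  by rewrite /u mulrAC [_ * z]mulrC ncCK -rmorphM /= expr2 mulfK// gt_eqF.
have -> : nc (z) = rint m (fun x => complex.Re (u * f x)).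
  transitivity (complex.Re (u * z)); first by rewrite uz.
  by rewrite -cintZ.
apply: rint_le => //.
- by apply: ccont_Re; apply: ccontM; [exact: ccont_cst|exact: cf].
- exact: cont_nc.
- move=> x _; rewrite -[leRHS]mul1r -nu -ncM; exact: le_trans (ler_norm _) (le_nc_Re _).
Qed.

Lemma cint_nr_le m (b : R) (f : H -> R[i]) : ccont f ->
  (forall x, p x = m -> nc (f x) <= b) -> nc (cint m f) <= b.
Proof.
move=> cf fb; apply: le_trans (cint_nr _ cf) _.
rewrite -(rint_cst lambda_haar m b); apply: rint_le => //; [exact: cont_nc|exact: cont_cst].
Qed.

Lemma cint_translate m x (f g : H -> R[i]) : p x = m -> ccont f ->
  (forall y, p y = m -> g y = f (gb_mul p x y)) -> cint m g = cint m f.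
Proof.
move=> xm cf gf; rewrite !cintE; congr (_ +i* _).
  by apply: (rint_translate lambda_haar xm (ccont_Re cf)) => y /gf ->.
by apply: (rint_translate lambda_haar xm (ccont_Im cf)) => y /gf ->.
Qed.

(** The weights are the integrals of a partition of unity on the fiber subordinate to [V]. Nodes and
    weights are chosen before [f], so one Riemann sum serves every continuous function whose
    oscillation along [V] is at most [e]. *)
Lemma riemann_sum m (e : R) (V : H -> set H) : 0 <= e -> (forall x, nbhs x (V x)) ->
  exists (n : nat) (a : 'I_n -> R) (t : 'I_n -> H),
  [/\ forall i, 0 <= a i, \sum_i a i = 1, forall i, p (t i) = m
    & forall f : H -> R[i], ccont f ->
      (forall x y, V x y -> nc (f y - f x) <= e) ->
      nc (cint m f - \sum_i (a i)%:C * f (t i)) <= e].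
Proof.
move=> e0 nV.
have /choice[g gP] x := urysohn_bump R (gb_compactH p) (gb_hausdorffH p) (nV x).
have cfib : compact (fiber p m).
  by apply: subclosed_compact (gb_compactH p) _ => //; exact: closed_fiber.
have [|s [sm scov]] := @compact_finite _ (fiber p m) (fun x => [set y | 1/2 < g x y]) cfib.
  move=> x _; have [cg g1 _ _] := gP x; apply: (cg x [set r : R^o | 1/2 < r]).
  by apply: open_nbhs_nbhs; split; [exact: open_gt|rewrite /= g1; lra].
pose G y := \sum_(x <- s) g x y.
have cg x : continuous (g x) by case: (gP x).
have g0 x y : 0 <= g x y by case: (gP x) => _ _ /(_ y)/andP[].
have cG : continuous (G : H -> R^o).
  rewrite /G; elim: (s) => [|x s' IHs].
    by under eq_fun do rewrite big_nil; exact: cont_cst.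
  by under eq_fun do rewrite big_cons; move=> y; apply: cvgD; [exact: cg|exact: IHs].
have Gge y : p y = m -> 1/2 <= G y.
  move=> /scov [x xs /ltW gxy]; apply: le_trans gxy _.
  rewrite /G (big_rem x xs) /= lerDl; exact: sumr_ge0.
(* [G] may vanish off the fiber. On the fiber it is at least [1/2], so this truncation changes
   nothing there and makes the quotient continuous on all of [H]. *)
pose N y : R := Num.max (G y) (1/2).
have N0 y : 0 < N y by rewrite lt_max; apply/orP; right; lra.
have cN : continuous (N : H -> R^o).
  by move=> y; apply: (@continuous_max R H G (fun=> 1/2)); [exact: cG|exact: cvg_cst].
pose phi x y : R^o := g x y / N y.
have cphi x : continuous (phi x).
  move=> y; apply: cvgM; first exact: cg.
  by apply: cvgV; [rewrite gt_eqF|exact: cN].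
have phi0 x y : 0 <= phi x y by rewrite divr_ge0// ltW.
have phi1 y : p y = m -> \sum_(x <- s) phi x y = 1.
  move=> /Gge Gy; rewrite /phi -mulr_suml -/(G y) /N.
  by rewrite (max_idPl Gy) divff// gt_eqF//; apply: lt_le_trans Gy; lra.
exists (size s), (fun i => rint m (phi (nth point s i))), (fun i => nth point s i).
have sumE (F : H -> R[i]) : \sum_(i < size s) F (nth point s i) = \sum_(x <- s) F x.
  by rewrite (big_nth point) big_mkord.
have sumER (F : H -> R) : \sum_(i < size s) F (nth point s i) = \sum_(x <- s) F x.
  by rewrite (big_nth point) big_mkord.
split.
- move=> i; rewrite -(rint_cst lambda_haar m 0); apply: rint_le => //; exact: cont_cst.
- rewrite (sumER (fun x => rint m (phi x))); apply: (@complexI R); rewrite rmorph_sum /=.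
  under eq_bigr do rewrite -cint_real.
  rewrite -cint_sum => [|x]; last exact: ccont_real.
  rewrite (@eq_cint m _ (fun=> 1)) ?cint_cst// => x /phi1 phix1.
  by rewrite -rmorph_sum /= phix1.
- by move=> i; apply: sm; exact: mem_nth.
move=> f cf fV.
rewrite (sumE (fun x => (rint m (phi x))%:C * f x)).
have cphif x : ccont (fun y => (phi x y)%:C * f x).
  by apply: ccontM; [exact: ccont_real|exact: cont_cst].
have -> : \sum_(x <- s) (rint m (phi x))%:C * f x =
    cint m (fun y => \sum_(x <- s) (phi x y)%:C * f x).
  rewrite cint_sum//; apply: eq_bigr => x _; rewrite mulrC -cint_real -cintZ; last exact: ccont_real.
  by apply: eq_cint => y _; rewrite mulrC.
have csum : ccont (fun y => \sum_(x <- s) (phi x y)%:C * f x) by exact: ccont_sum.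
rewrite -cintB; [|exact: cf|exact: csum].
apply: cint_nr_le; first by apply: ccontB; [exact: cf|exact: csum].
move=> y ym.
have {1}-> : f y = \sum_(x <- s) (phi x y)%:C * f y.
  by rewrite -mulr_suml -rmorph_sum /= phi1// mul1r.
rewrite -sumrB.
apply: le_trans (nc_sum _ _ _) _.
rewrite -[leRHS]mul1r -(phi1 _ ym) mulr_suml; apply: ler_sum => x _.
rewrite -mulrBr ncM nc_real ger0_norm//.
(* Outside [V x] the bump [g x] is 0, so only terms of small oscillation count. *)
have [Vxy|nVxy] := pselect (V x y); first by rewrite ler_wpM2l// fV.
by have [_ _ _ /(_ _ nVxy) gxy] := gP x; rewrite /phi gxy !mul0r.
Qed.

End complex_haar.

(** * Fubini, inversion and continuity in the fiber *)

Section haar_theory.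
Context (R : realType) (M : topologicalType) (H : ptopologicalType)
  (p : compact_group_bundle M H) (lambda : M -> probability (borel H) R)
  (lambda_haar : forall m : M, is_haar p m (lambda m)).
Implicit Types (m : M) (x y : H).
Notation rint := (rint p lambda).
Notation cint := (cint p lambda).
Local Notation mul := (gb_mul p).
Local Notation inv := (gb_inv p).

Lemma cont_slice (T S : topologicalType) (V : topologicalType) (F : T * S -> V) (t : T) :
  continuous F -> continuous (fun y : S => F (t, y)).
Proof. by apply: cont_comp; apply: cont_pair; [exact: cont_cst|move=> ?; exact: cvg_id]. Qed.

Lemma cont_slice2 (T S : topologicalType) (V : topologicalType) (F : T * S -> V) (s : S) :
  continuous F -> continuous (fun x : T => F (x, s)).
Proof. by apply: cont_comp; apply: cont_pair; [move=> ?; exact: cvg_id|exact: cont_cst]. Qed.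

Lemma ccont_slice (T S : topologicalType) (F : T * S -> R[i]) (t : T) :
  ccont F -> ccont (fun y : S => F (t, y)).
Proof. exact: cont_slice. Qed.

Lemma ccont_slice2 (T S : topologicalType) (F : T * S -> R[i]) (s : S) :
  ccont F -> ccont (fun x : T => F (x, s)).
Proof. exact: cont_slice2. Qed.

Arguments cont_slice {T S V F} t _.
Arguments cont_slice2 {T S V F} s _.
Arguments ccont_slice {T S F} t _.
Arguments ccont_slice2 {T S F} s _.

Lemma cint_param_le m (T : topologicalType) (F : T * H -> R[i]) (s s' : T) (e : R) :
  ccont F -> (forall y, nc (F (s', y) - F (s, y)) <= e) ->
  nc (cint m (fun y => F (s', y)) - cint m (fun y => F (s, y))) <= e.
Proof.
move=> cF Fe; have cFs (t : T) : ccont (fun y : H => F (t, y)).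
  exact: ccont_slice.
rewrite -cintB; [|exact: cFs|exact: cFs].
apply: (cint_nr_le lambda_haar); first by apply: ccontB; [exact: cFs|exact: cFs].
by move=> x _; exact: Fe.
Qed.

Lemma cint_fiber_cont m (T : topologicalType) (F : T * H -> R[i]) :
  ccont F -> ccont (fun x : T => cint m (fun y => F (x, y))).
Proof.
move=> cF; apply/ccontP => x e e0.
have e2 : 0 < e / 2 by lra.
have := ctube x (gb_compactH p) cF e2; apply: filterS => x' Fx.
apply: (@le_lt_trans _ _ (e / 2)); last lra.
by apply: cint_param_le => // y; exact: ltW (Fx y).
Qed.

(** Nodes in the first variable that are good for all values of the second approximate both iterated
    integrals by the same finite combination of single integrals. *)
Lemma cint_fubini m (F : H * H -> R[i]) : ccont F ->
  cint m (fun x => cint m (fun y => F (x, y))) =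
  cint m (fun y => cint m (fun x => F (x, y))).
Proof.
move=> cF; apply/eqP; rewrite -subr_eq0; apply/eqP; apply: nc_eq0.
apply/eqP; rewrite eq_le nc_ge0 andbT; apply/ler_addgt0Pr => e e0; rewrite add0r.
have e2 : 0 < e / 2 by lra.
have [|n [a [t [a0 a1 tm rs]]]] := riemann_sum lambda_haar m (ltW e2)
    (V := fun x => [set x' | forall y, nc (F (x', y) - F (x, y)) < e / 2]).
  by move=> x; exact: (ctube x (gb_compactH p) cF e2).
have cF' : ccont (fun z : H * H => F (z.2, z.1)).
  by apply: ccont_comp cF; apply: cont_pair; [exact: cont_snd|exact: cont_fst].
have rs1 := rs (fun x => cint m (fun y => F (x, y))) (cint_fiber_cont cF).
have {}rs1 := rs1 (fun x x' V => cint_param_le m cF (fun y => ltW (V y))).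
have ciF i : ccont (fun y => (a i)%:C * F (t i, y)).
  by apply: ccontM; [exact: ccont_cst|exact: (ccont_slice (t i) cF)].
have rs2 : nc (cint m (fun y => cint m (fun x => F (x, y))) -
    \sum_i (a i)%:C * cint m (fun y => F (t i, y))) <= e / 2.
  have -> : \sum_i (a i)%:C * cint m (fun y => F (t i, y)) =
      cint m (fun y => \sum_i (a i)%:C * F (t i, y)).
    rewrite cint_sum//; apply: eq_bigr => i _; rewrite cintZ//; exact: (ccont_slice (t i) cF).
  have c1 : ccont (fun y => cint m (fun x => F (x, y))).
    exact: (cint_fiber_cont cF').
  have c2 : ccont (fun y => \sum_i (a i)%:C * F (t i, y)) by exact: ccont_sum.
  rewrite -cintB; [|exact: c1|exact: c2].
  apply: (cint_nr_le lambda_haar); first by apply: ccontB; [exact: c1|exact: c2].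
  move=> y ym; apply: (rs (fun x => F (x, y))); first exact: (ccont_slice2 y cF).
  by move=> x x' Vxx'; exact: ltW.
apply: le_trans (nc_triB _ (\sum_i (a i)%:C * cint m (fun y => F (t i, y))) _) _.
by rewrite [e]splitr; apply: lerD; [exact: rs1|rewrite nc_distC; exact: rs2].
Qed.

(** The pairs lying in a common fiber form a closed subset of the compact space [H * H], on which
    multiplication is continuous; Tietze does the rest. Later uses evaluate [F] inside one fiber
    only. *)
Lemma mul_ext (f : H -> R[i]) : ccont f ->
  exists2 F : H * H -> R[i], ccont F &
    forall x y, p x = p y -> F (x, y) = f (mul x y).
Proof.
move=> cf.
have [||||F cF FE] := @ccont_tietze R (H * H)%type _ _ [set z | p z.1 = p z.2] (fun z => f (mul z.1 z.2)).
- exact: (compact_prod (gb_compactH p) (gb_compactH p)).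
- exact: (prod_hausdorff (gb_hausdorffH p) (gb_hausdorffH p)).
- have -> : [set z : H * H | p z.1 = p z.2] = (fun z => (p z.1, p z.2)) @^-1` [set u | u.1 = u.2].
    by [].
  apply: preimage_closed.
    move=> z _; apply: cont_pair.
    + by apply: cont_comp (@gb_proj_continuous _ _ p); exact: cont_fst.
    + by apply: cont_comp (@gb_proj_continuous _ _ p); exact: cont_snd.
  move=> [u v] uv /=; apply: (gb_hausdorffM p) => A B Au Bv.
  have [|[a b] [/= ab [Aa Bb]]] := uv (A `*` B); first by exists (A, B).
  by exists a; split => //; rewrite ab.
- move=> z; apply: continuous_comp; first exact: gb_mul_continuous.
  exact: cf.
by exists F => // x y xy; rewrite FE.
Qed.

Lemma translate_ext (f : H -> R[i]) : ccont f ->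
  exists2 F : H * H -> R[i], ccont F &
    forall x y, p x = p y -> F (x, y) = f (mul (inv x) y).
Proof.
move=> /mul_ext[F cF FE]; exists (fun z => F (inv z.1, z.2)).
  apply: ccont_comp cF; apply: cont_pair; last exact: cont_snd.
  by apply: cont_comp (@gb_inv_continuous _ _ p); exact: cont_fst.
by move=> x y xy /=; rewrite FE// gb_proj_inv.
Qed.

(* Both iterated integrals of [f (y^-1 x)] are evaluated by left invariance. *)
Lemma cint_inv m (f : H -> R[i]) : ccont f -> cint m (fun x => f (inv x)) = cint m f.
Proof.
move=> cf; have [F cF FE] := translate_ext cf.
have cfi : ccont (fun x => f (inv x)) by apply: ccont_comp cf; exact: gb_inv_continuous.
have := cint_fubini m cF.
rewrite [LHS](@eq_cint _ _ _ _ _ m _ (fun=> cint m f)); last first.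
  move=> x xm; apply: (cint_translate lambda_haar (x := inv x)) => //; first by rewrite gb_proj_inv.
  by move=> y ym; rewrite FE// xm ym.
rewrite [RHS](@eq_cint _ _ _ _ _ m _ (fun=> cint m (fun x => f (inv x)))).
  by rewrite !cint_cst.
move=> y ym; apply: (cint_translate lambda_haar (x := inv y)) => //; first by rewrite gb_proj_inv.
by move=> x xm; rewrite FE ?xm ?ym// gb_invM ?gb_proj_inv ?xm ?ym// gb_invK.
Qed.

(** Inversion exchanges left and right translations and preserves the integral: compact groups are
    unimodular. *)
Lemma cint_translater m x (f g : H -> R[i]) : p x = m -> ccont f -> ccont g ->
  (forall y, p y = m -> g y = f (mul y x)) -> cint m g = cint m f.
Proof.
move=> xm cf cg gf; rewrite -cint_inv// -[RHS]cint_inv//.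
have cfi : ccont (fun x => f (inv x)) by apply: ccont_comp cf; exact: gb_inv_continuous.
apply: (cint_translate lambda_haar (x := inv x)) => //; first by rewrite gb_proj_inv.
move=> y ym; rewrite gf ?gb_proj_inv//.
by rewrite gb_invM ?gb_proj_inv ?xm ?ym// gb_invK.
Qed.

(** If the integral were 0, so would be that of any finite sum of translates of [f]; yet by
    compactness some such sum is at least [f x / 2] on the whole fiber. *)
Lemma rint_gt0 m x (f : H -> R^o) : p x = m -> continuous f ->
  (forall y, p y = m -> 0 <= f y) -> 0 < f x -> 0 < rint m f.
Proof.
move=> xm cf f0 fx.
have [F cF FE] := mul_ext (ccont_real cf).
pose G z : R^o := complex.Re (F z).
have cG : continuous G by exact: ccont_Re.
have GE y z : p y = p z -> G (y, z) = f (mul y z) by move=> yz; rewrite /G FE.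
(* [t y] carries [y] to [x], so the translate of [f] by [t y] takes the value [f x] at [y]. *)
pose t y := mul x (inv y).
have tm y : p y = m -> p (t y) = m by move=> ym; rewrite gb_proj_mul ?gb_proj_inv ?xm ?ym.
have cfib : compact (fiber p m).
  by apply: subclosed_compact (gb_compactH p) _ => //; exact: closed_fiber.
have [|s [sm scov]] := @compact_finite _ (fiber p m) (fun y => [set z | f x / 2 < G (t y, z)]) cfib.
  move=> y ym; apply: (cont_slice (t y) cG y [set r : R^o | f x / 2 < r]).
  apply: open_nbhs_nbhs; split; first exact: open_gt.
  by rewrite /= GE ?tm// /t gb_mulxVK ?xm ?ym//; lra.
have cs : continuous (fun z => \sum_(y <- s) G (t y, z) : R^o).
  elim: (s) => [|y s' IHs].
    by under eq_fun do rewrite big_nil; exact: cont_cst.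
  by under eq_fun do rewrite big_cons; move=> z; apply: cvgD; [exact: (cont_slice (t y) cG)|exact: IHs].
have rs y : y \in s -> rint m (fun z => G (t y, z)) = rint m f.
  move=> ys; apply: (rint_translate lambda_haar (tm y (sm y ys)) cf) => z zm.
  by rewrite GE// tm ?zm//; exact: sm.
have le1 : f x / 2 <= rint m (fun z => \sum_(y <- s) G (t y, z)).
  rewrite -[leLHS](rint_cst lambda_haar m); apply: rint_le => //; first exact: cont_cst.
  move=> z zm; have [y ys /ltW yz] := scov z zm; apply: le_trans yz _.
  rewrite (big_rem y ys) /= lerDl big_seq; apply: sumr_ge0 => u /mem_rem us.
  have um := sm _ us.
  by rewrite GE ?tm ?um// f0// gb_proj_mul ?tm ?um// ?zm.
rewrite lt_neqAle; apply/andP; split; last first.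
  by rewrite -(rint_cst lambda_haar m 0); apply: rint_le => //; exact: cont_cst.
apply/eqP => r0; move: le1; suff -> : rint m (fun z => \sum_(y <- s) G (t y, z)) = 0 by lra.
have : forall s', {subset s' <= s} -> rint m (fun z => \sum_(y <- s') G (t y, z)) = 0.
  elim=> [|y s' IHs] ss.
    by under [fun z => _]eq_fun do rewrite big_nil; exact: rint_cst.
  have {}IHs : rint m (fun z => \sum_(y <- s') G (t y, z)) = 0.
    by apply: IHs => u us; apply: ss; rewrite inE us orbT.
  rewrite (@eq_rint _ _ _ _ _ m _ (fun z => G (t y, z) + \sum_(y <- s') G (t y, z))).
    rewrite rintD//; [|exact: (cont_slice (t y) cG)|].
      by rewrite IHs rs ?addr0// ss// inE eqxx.
    elim: (s') => [|y' s'' IHs'].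
      by under eq_fun do rewrite big_nil; exact: cont_cst.
    by under eq_fun do rewrite big_cons; move=> z; apply: cvgD; [exact: (cont_slice (t y') cG)|exact: IHs'].
  by move=> z _; rewrite big_cons.
by apply.
Qed.

Hypothesis p_open : open_bundle p.

(** The one place where openness of [p] is used directly: it allows the nodes of a Riemann sum to be
    moved to nearby fibers. *)
Lemma open_lift (x : H) (U : set H) : nbhs x U ->
  \forall m \near p x, exists2 y, U y & p y = m.
Proof.
rewrite nbhsE => -[W [oW Wx] WU].
apply: (@filterS _ _ _ (p @` W)); first by move=> m [y Wy ym]; exists y => //; exact: WU.
by apply: open_nbhs_nbhs; split; [exact: p_open|exists x].
Qed.

(** The average of the right translates [f (y t_i)] with weights [a i] is nearly the constant [c]
    for [y] over [m], hence also for [y] over nearby [m']. Moving the nodes [t i] to points [u i]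
    over [m'] changes it little, and by right invariance its integral over the fiber at [m'] is then
    exactly that of [f]. *)
Lemma cint_cont (f : H -> R[i]) : ccont f -> ccont (fun m => cint m f).
Proof.
move=> cf; apply/ccontP => m e e0.
have [F cF FE] := mul_ext cf.
have cF' : ccont (fun z : H * H => F (z.2, z.1)).
  by apply: ccont_comp cF; apply: cont_pair; [exact: cont_snd|exact: cont_fst].
(* Moving the nodes costs [d] and [S] costs at most [d + d], which leaves room below [e]. *)
pose d := e / 4; have d0 : 0 < d by rewrite /d; lra.
pose V x := [set x' | forall y, nc (F (y, x') - F (y, x)) < d].
have nV x : nbhs x (V x) by exact: (ctube x (gb_compactH p) cF' d0).
have [n [a [t [a0 a1 tm rs]]]] := riemann_sum lambda_haar m (ltW d0) nV.
set c := cint m f.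
pose S y := \sum_i (a i)%:C * F (y, t i) - c.
have cS : ccont S.
  apply: ccontB; last exact: ccont_cst.
  by apply: ccont_sum => i; apply: ccontM; [exact: ccont_cst|exact: (ccont_slice2 (t i) cF)].
have FV x x' y : V x x' -> nc (F (y, x') - F (y, x)) <= d by move=> /(_ y)/ltW.
have Sm y : p y = m -> nc (S y) < d + d.
  move=> ym; apply: (@le_lt_trans _ _ d); last lra.
  rewrite /S nc_distC (_ : c = cint m (fun x => F (y, x))).
    by apply: (rs (fun x => F (y, x))); [exact: (ccont_slice y cF)|move=> x x'; exact: FV].
  by apply/esym/(cint_translate lambda_haar ym) => // z zm; rewrite FE// ym zm.
have oS : open [set y | nc (S y) < d + d].
  have := cont_nc cS => /continuousP /(_ [set r : R^o | r < d + d]); apply; exact: open_lt.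
have near1 := fiber_nbhs (gb_compactH p) (gb_hausdorffM p) (@gb_proj_continuous _ _ p) oS Sm.
have near2 : \forall m' \near m, forall i, exists2 y, V (t i) y & p y = m'.
  apply: filter_forall => i; have := open_lift (nV (t i)); rewrite tm; exact.
near=> m'.
have S' : forall y, p y = m' -> nc (S y) < d + d by near: m'; exact: near1.
have /choice[u uP] : forall i, exists y, V (t i) y /\ p y = m'.
  suff h : forall i, exists2 y, V (t i) y & p y = m' by move=> i; have [y] := h i; exists y.
  by near: m'; exact: near2.
have -> : cint m' f = cint m' (fun y => \sum_i (a i)%:C * F (y, u i)).
  rewrite (cint_sum lambda_haar) => [|i]; last by apply: ccontM; [exact: ccont_cst|exact: (ccont_slice2 (u i) cF)].
  transitivity (\sum_i (a i)%:C * cint m' f).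
    by rewrite -mulr_suml -rmorph_sum a1 mul1r.
  apply: eq_bigr => i _; rewrite cintZ; last exact: (ccont_slice2 (u i) cF).
  congr (_ * _); apply/esym; have [_ um] := uP i.
  apply: (cint_translater um cf (ccont_slice2 (u i) cF)).
  by move=> y ym; rewrite FE// ym; case: (uP i).
rewrite -(cint_cst lambda_haar m' c) -cintB; last exact: ccont_cst; last first.
  by apply: ccont_sum => i; apply: ccontM; [exact: ccont_cst|exact: (ccont_slice2 (u i) cF)].
apply: (@le_lt_trans _ _ (d + (d + d))); last by rewrite /d; lra.
apply: (cint_nr_le lambda_haar).
  apply: ccontB; last exact: ccont_cst.
  by apply: ccont_sum => i; apply: ccontM; [exact: ccont_cst|exact: (ccont_slice2 (u i) cF)].
move=> y ym'; have /ltW Sy := S' y ym'.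
rewrite (_ : _ - c = \sum_i (a i)%:C * (F (y, u i) - F (y, t i)) + S y); last first.
  by rewrite /S addrA -big_split /=; congr (_ - c); apply: eq_bigr => i _; rewrite -mulrDr subrK.
apply: le_trans (ncD _ _) _; apply: lerD => //.
apply: le_trans (nc_sum _ _ _) _.
rewrite -[leRHS]mul1r -a1 mulr_suml; apply: ler_sum => i _.
by rewrite ncM nc_real ger0_norm// ler_wpM2l//; apply: FV; case: (uP i).
Unshelve. all: by end_near. Qed.

Lemma cint_param_cont (T : topologicalType) (q : T -> M) (F : T * H -> R[i]) :
  continuous q -> ccont F ->
  ccont (fun x : T => cint (q x) (fun y => F (x, y))).
Proof.
move=> cq cF; apply/ccontP => x e e0.
have e2 : 0 < e / 2 by lra.
have t1 := ctube x (gb_compactH p) cF e2.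
have /ccontP/(_ x _ e2) t2 : ccont (fun x' : T => cint (q x') (fun y => F (x, y))).
  exact: (ccont_comp cq (cint_cont (ccont_slice x cF))).
near=> x'.
apply: le_lt_trans (nc_triB _ (cint (q x') (fun y => F (x, y))) _) _.
rewrite [e]splitr ler_ltD//.
  apply: cint_param_le => // y; apply: ltW; move: y; near: x'; exact: t1.
by near: x'; exact: t2.
Unshelve. all: by end_near. Qed.

End haar_theory.

Arguments cont_slice {T S V F} t _.
Arguments cont_slice2 {T S V F} s _.
Arguments ccont_slice {R T S F} t _.
Arguments ccont_slice2 {R T S F} s _.

(** * Hilbert spaces and representations of C*-algebras *)

Section hilbert_basics.
Context (R : realType) (E : hilbert R).
Implicit Types (u v w : E) (a : R[i]).

Lemma ipDl u v w : ip E (u + v) w = ip E u w + ip E v w. Proof. by rewrite linearDl. Qed.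
Lemma ipBl u v w : ip E (u - v) w = ip E u w - ip E v w. Proof. by rewrite linearBl. Qed.
Lemma ipZl a u w : ip E (a *: u) w = a * ip E u w. Proof. by rewrite linearZl_LR. Qed.
Lemma ipDr w u v : ip E w (u + v) = ip E w u + ip E w v. Proof. by rewrite linearDr. Qed.
Lemma ipBr w u v : ip E w (u - v) = ip E w u - ip E w v. Proof. by rewrite linearBr. Qed.
Lemma ipZr w a u : ip E w (a *: u) = Num.conj a * ip E w u. Proof. by rewrite linearZr_LR. Qed.
Lemma ipC w u : ip E w u = Num.conj (ip E u w). Proof. by rewrite hermC /= expr0 mul1r. Qed.
Lemma ip0l w : ip E 0 w = 0. Proof. by rewrite linear0l. Qed.
Lemma ip0r w : ip E w 0 = 0. Proof. by rewrite linear0r. Qed.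
Lemma ip_suml (I : Type) (r : seq I) (P : pred I) (F : I -> E) w :
  ip E (\sum_(i <- r | P i) F i) w = \sum_(i <- r | P i) ip E (F i) w.
Proof. by elim/big_rec2 : _ => [|i x y _ <-]; rewrite ?ip0l ?ipDl. Qed.
Lemma ip_sumr (I : Type) (r : seq I) (P : pred I) (F : I -> E) w :
  ip E w (\sum_(i <- r | P i) F i) = \sum_(i <- r | P i) ip E w (F i).
Proof. by elim/big_rec2 : _ => [|i x y _ <-]; rewrite ?ip0r ?ipDr. Qed.

Lemma ipE v : ip E v v = (normr_of v ^+ 2)%:C.
Proof. by rewrite ip_norm normE rmorphXn. Qed.

Lemma nr_sqrD u v :
  normr_of (u + v) ^+ 2 = normr_of u ^+ 2 + 2 * complex.Re (ip E u v) + normr_of v ^+ 2.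
Proof.
apply: (@complexI R); rewrite -ipE ipDl !ipDr !ipE [ip E v u]ipC.
case: (ip E u v) => x y; rewrite -[Num.conj _]/(x +i* - y).
by apply/eqP; rewrite eq_complex /=; apply/andP; split; apply/eqP; ring.
Qed.

Lemma nr_sqrB u v :
  normr_of (u - v) ^+ 2 = normr_of u ^+ 2 - 2 * complex.Re (ip E u v) + normr_of v ^+ 2.
Proof.
by rewrite nr_sqrD nrN linearNr raddfN mulrN.
Qed.

Lemma cauchy_schwarz v w : nc (ip E v w) <= normr_of v * normr_of w.
Proof.
have [->|w0] := eqVneq w 0; first by rewrite ip0r nc0 nr0 mulr0.
have nw : 0 < normr_of w by rewrite nr_gt0.
set c := ip E v w; set s := normr_of w.
(* The component of [v] orthogonal to [w], scaled so that no division occurs. *)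
have := sqr_ge0 (normr_of ((s ^+ 2)%:C *: v - c *: w)).
rewrite nr_sqrB !nrZc ipZl ipZr -/c mulrA mulrAC -mulrA ncCK -rmorphM /= nc_real.
rewrite ger0_norm ?sqr_ge0// -/s => h.
have {}h : 0 <= s ^+ 2 * ((normr_of v * s) ^+ 2 - nc c ^+ 2) by move: h; nra.
have {}h : nc c ^+ 2 <= (normr_of v * s) ^+ 2.
  by move: h; rewrite pmulr_rge0 ?exprn_gt0// subr_ge0.
by move: h; rewrite ler_pXn2r// nnegrE ?nc_ge0// mulr_ge0 ?nr_ge0.
Qed.

Lemma ip_eq0 v : (forall w, ip E v w = 0) -> v = 0.
Proof.
move=> /(_ v); rewrite ipE => /(@complexI R) /eqP; rewrite expf_eq0 /= => /eqP; exact: nr_eq0.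
Qed.

Lemma ip_inj v v' : (forall w, ip E v w = ip E v' w) -> v = v'.
Proof.
by move=> vv'; apply/eqP; rewrite -subr_eq0; apply/eqP/ip_eq0 => w; rewrite ipBl vv' subrr.
Qed.

Lemma ip_cont (T : topologicalType) (f g : T -> E) : continuous f -> continuous g ->
  ccont (fun x => ip E (f x) (g x)).
Proof.
move=> cf cg; apply/ccontP => x e e0.
(* Since [d <= 1], the quadratic error is below [d], and the three errors add up to at most
   [d * K]. *)
pose K := normr_of (f x) + normr_of (g x) + 1.
have nf := nr_ge0 (f x); have ng := nr_ge0 (g x).
pose d := Num.min 1 (e / (2 * K)).
have K0 : 0 < K by rewrite /K; lra.
have d0 : 0 < d by rewrite lt_min ltr01 divr_gt0// mulr_gt0.
have dK : d * (2 * K) <= e.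
  by rewrite -ler_pdivlMr ?mulr_gt0// ge_min lexx orbT.
have d1 : d <= 1 by rewrite ge_min lexx.
have /cont_nrP/(_ x d d0) nf' := cf; have /cont_nrP/(_ x d d0) ng' := cg.
apply: filterS2 nf' ng' => y fy gy.
have -> : ip E (f y) (g y) - ip E (f x) (g x) =
   ip E (f y - f x) (g y - g x) + ip E (f y - f x) (g x) + ip E (f x) (g y - g x).
  by rewrite !ipBl !ipBr; ring.
apply: le_lt_trans (ncD _ _) _; apply: le_lt_trans (lerD (ncD _ _) (lexx _)) _.
have h1 := cauchy_schwarz (f y - f x) (g y - g x).
have h2 := cauchy_schwarz (f y - f x) (g x).
have h3 := cauchy_schwarz (f x) (g y - g x).
have := nr_ge0 (f y - f x); have := nr_ge0 (g y - g x).
move: h1 h2 h3 fy gy; set A := normr_of (f y - f x); set B := normr_of (g y - g x).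
move=> h1 h2 h3 Ad Bd B0 A0.
have i1 : A * B <= A by rewrite -[leRHS]mulr1 ler_wpM2l//; lra.
have i2 : A * normr_of (g x) <= d * normr_of (g x) by rewrite ler_wpM2r// ltW.
have i3 : normr_of (f x) * B <= normr_of (f x) * d by rewrite ler_wpM2l// ltW.
have : d * K = d * normr_of (f x) + d * normr_of (g x) + d by rewrite /K; ring.
by have := mulr_gt0 d0 K0; lra.
Qed.

End hilbert_basics.

Section completeness.
Context (R : realType).

Lemma nr_cauchy_cvg (V : completeNormedModType R[i]) (u : nat -> V) :
  (forall e : R, 0 < e -> exists N, forall n m, (N <= n)%N -> (N <= m)%N -> normr_of (u n - u m) < e) ->
  exists l : V, forall e : R, 0 < e -> exists N, forall n, (N <= n)%N -> normr_of (u n - l) < e.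
Proof.
move=> cu.
have : cauchy (u @ \oo).
  apply/cauchy_ballP => e e0.
  have eE : e = (complex.Re e)%:C by move: e0; case: (e) => a b; rewrite ltcE /= => /andP[/eqP -> _].
  move: (e0); rewrite eE ltcR => e0'; have [N NP] := cu _ e0'.
  exists ([set u n | n in [set n | (N <= n)%N]], [set u n | n in [set n | (N <= n)%N]]) => /=.
    by split; exists N => // n /= Nn; exists n.
  case=> x y /= [[n Nn <-] [m Nm <-]]; rewrite -ball_normE /= normE ltcR; exact: NP.
move=> /cauchy_cvg /cvg_ex [l ul]; exists l => e e0.
move/cvgrPdist_lt : ul => /(_ e%:C); rewrite ltcR => /(_ e0) [N _ NP].
by exists N => n Nn; have := NP n Nn; rewrite /= normE ltcR nr_distC.
Qed.

Lemma geometric_cauchy (V : normedModType R[i]) (u : nat -> V) (C q : R) : 0 <= C -> 0 <= q < 1 ->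
  (forall n, normr_of (u n.+1 - u n) <= C * q ^+ n) ->
  (forall n k, normr_of (u (n + k)%N - u n) <= C / (1 - q) * q ^+ n).
Proof.
move=> C0 /andP[q0 q1] uC n k.
have q1' : 0 < 1 - q by lra.
(* The factor [1 - q ^+ k] of a finite geometric sum makes the bound inductive. *)
suff : normr_of (u (n + k)%N - u n) <= C / (1 - q) * q ^+ n * (1 - q ^+ k).
  move=> /le_trans; apply; rewrite -[leRHS]mulr1 ler_wpM2l//; last first.
    by rewrite lerBlDr lerDl exprn_ge0.
  by rewrite mulr_ge0 ?exprn_ge0// divr_ge0// ltW.
elim: k => [|k IHk]; first by rewrite addn0 subrr nr0 expr0 subrr mulr0.
rewrite addnS; apply: le_trans (nr_triB _ (u (n + k)%N) _) _.
apply: le_trans (lerD (uC _) IHk) _.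
rewrite [q ^+ k.+1]exprS exprD.
have -> : C / (1 - q) * q ^+ n * (1 - q * q ^+ k) =
  C * (q ^+ n * q ^+ k) + C / (1 - q) * q ^+ n * (1 - q ^+ k).
  by field; rewrite gt_eqF.
by [].
Qed.

Lemma geometric_cvg0 (C q e : R) : 0 <= C -> 0 <= q < 1 -> 0 < e ->
  exists N, forall n, (N <= n)%N -> C * q ^+ n < e.
Proof.
move=> C0 /andP[q0 q1] e0.
have : (fun n => C * q ^+ n) @ \oo --> (0 : R).
  by have := @cvg_geometric R C q; rewrite ger0_norm// => /(_ q1).
move=> /cvgrPdist_lt /(_ e e0) [N _ NP]; exists N => n Nn; have := NP n Nn.
by rewrite /= sub0r normrN; apply: le_lt_trans; exact: ler_norm.
Qed.

Lemma geometric_cvg (V : completeNormedModType R[i]) (u : nat -> V) (C q : R) :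
  0 <= C -> 0 <= q < 1 -> (forall n, normr_of (u n.+1 - u n) <= C * q ^+ n) ->
  exists l : V, forall n, normr_of (u n - l) <= C / (1 - q) * q ^+ n.
Proof.
move=> C0 q01 uC; have gc := geometric_cauchy C0 q01 uC.
have q1' : 0 < 1 - q by case/andP: q01 => *; lra.
have Cq : 0 <= C / (1 - q) by rewrite divr_ge0// ltW.
have [e e0|l lP] := @nr_cauchy_cvg V u.
  have e2 : 0 < e / 2 by lra.
  have [N NP] := geometric_cvg0 Cq q01 e2; exists N => n m Nn Nm.
  have h k : (N <= k)%N -> normr_of (u k - u N) < e / 2.
    by move=> Nk; rewrite -(subnKC Nk); apply: le_lt_trans (gc _ _) (NP N _).
  apply: le_lt_trans (nr_triB _ (u N) _) _.
  by rewrite [e]splitr ltrD ?h// nr_distC h.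
exists l => n; apply/ler_addgt0Pr => e e0.
have [N NP] := lP e e0.
have Nle : (N <= n + N)%N by rewrite leq_addl.
apply: le_trans (nr_triB _ (u (n + N)%N) _) _.
by apply: lerD; [rewrite nr_distC; exact: gc|exact: ltW (NP _ Nle)].
Qed.

Lemma linear_bound (V W : normedModType R[i]) (f : {linear V -> W}) : continuous f ->
  exists2 C : R, 0 < C & forall v, normr_of (f v) <= C * normr_of v.
Proof.
move=> /cont_nrP/(_ 0 1 ltr01); rewrite linear0.
move=> /nbhs_ballP[e /= e0 eP].
have eE : e = (complex.Re e)%:C by move: e0; case: (e) => a b; rewrite ltcE /= => /andP[/eqP -> _].
move: e0 eP; rewrite eE ltcR; move: (complex.Re e) => {}e {eE} e0 eP.
exists (2 / e); first by rewrite divr_gt0.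
move=> v; have [->|v0] := eqVneq v 0; first by rewrite linear0 !nr0 mulr0.
have nv : 0 < normr_of v by rewrite nr_gt0.
pose t := e / 2 / normr_of v.
have t0 : 0 < t by rewrite /t !divr_gt0.
have := eP (t%:C *: v); rewrite -ball_normE /= sub0r normrN normE ltcR nrZc nc_real gtr0_norm//.
rewrite divfK ?gt_eqF//; have e2 : e / 2 < e by lra.
move=> /(_ e2); rewrite subr0 linearZ nrZc nc_real gtr0_norm// => h.
rewrite -(ler_pM2l t0); apply: le_trans (ltW h) _.
rewrite (_ : t * _ = 1) // /t; field.
by rewrite !gt_eqF.
Qed.

End completeness.

Section irreps.
Context (R : realType) (A : cstar_algebra R) (pi : irrep A).
Local Notation E := (irrep_space pi).
Implicit Types (a b c : A) (v w : E).

Lemma irrepD a b v : pi (a + b) v = pi a v + pi b v.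
Proof. by have := @irrep_linear R A pi 1 a b v; rewrite !scale1r. Qed.

Lemma irrep0 v : pi 0 v = 0.
Proof. by apply: (addrI (pi 0 v)); rewrite -irrepD !addr0. Qed.

Lemma irrepZ (k : R[i]) a v : pi (k *: a) v = k *: pi a v.
Proof. by rewrite -[k *: a]addr0 irrep_linear irrep0 addr0. Qed.

Lemma irrepB a b v : pi (a - b) v = pi a v - pi b v.
Proof. by rewrite irrepD -scaleN1r irrepZ scaleN1r. Qed.

Lemma ca_mulBl a b c : ca_mul (a - b) c = ca_mul a c - ca_mul b c.
Proof.
by rewrite -[a - b]addrC -scaleN1r ca_mulDl scaleN1r addrC.
Qed.

Lemma ca_mulBr a b c : ca_mul c (a - b) = ca_mul c a - ca_mul c b.
Proof.
by rewrite -[a - b]addrC -scaleN1r ca_mulDr scaleN1r addrC.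
Qed.

Lemma nr_ca_mul a b : normr_of (ca_mul a b) <= normr_of a * normr_of b.
Proof. by have := ca_normM a b; rewrite !normE -rmorphM lecR. Qed.

Lemma nr_ca_star a : normr_of (ca_mul (ca_star a) a) = normr_of a ^+ 2.
Proof. by have := ca_normS a; rewrite !normE -rmorphXn => /(@complexI R). Qed.

(** The sum [h + h^2 + ... + h^(n+1)] in Horner form. There is no constant term because [A] is not
    assumed to be unital. *)
Fixpoint ca_power_sum (h : A) n : A :=
  if n is k.+1 then h + ca_mul h (ca_power_sum h k) else h.

(* The sum [b] of the powers of [h] is a quasi-inverse: [(1 - h) (1 + b) = 1]. *)
Lemma quasi_inverse (h : A) : normr_of h < 1 ->
  exists b : A, b = h + ca_mul b h.
Proof.
move=> h1; pose u := ca_power_sum h.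
have uS n : normr_of (u n.+1 - u n) <= normr_of h ^+ 2 * normr_of h ^+ n.
  elim: n => [|n IHn].
    rewrite /u /= addrC addKr expr0 mulr1; apply: le_trans (nr_ca_mul _ _) _.
    by rewrite expr2.
  have -> : u n.+2 - u n.+1 = ca_mul h (u n.+1 - u n).
    by rewrite ca_mulBr /u /= opprD addrACA subrr add0r.
  apply: le_trans (nr_ca_mul _ _) _.
  by rewrite [_ ^+ n.+1]exprS mulrCA ler_wpM2l ?nr_ge0.
(* The Horner recursion multiplies by [h] on the left; powers of [h] commute, so it can be moved to
   the right, as the equation for the limit asks. *)
have ur n : u n.+1 = h + ca_mul (u n) h.
  elim: n => [//|n IHn].
  rewrite -[u n.+2]/(h + ca_mul h (u n.+1)) [in LHS]IHn.
  have -> : h + ca_mul (u n) h = 1 *: h + ca_mul (u n) h by rewrite scale1r.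
  rewrite ca_mulDr scale1r ca_mulA; congr (_ + _).
  have -> : u n.+1 = 1 *: h + ca_mul h (u n) by rewrite scale1r.
  by rewrite ca_mulDl scale1r.
have [|b bP] := geometric_cvg (sqr_ge0 (normr_of h)) _ uS; first by rewrite nr_ge0.
exists b; apply/eqP; rewrite -subr_eq0; apply/eqP/nr_eq0/eqP.
rewrite eq_le nr_ge0 andbT; apply/ler_addgt0Pr => e e0; rewrite add0r.
set C := _ / _ in bP.
have C0 : 0 <= C by rewrite divr_ge0 ?sqr_ge0// subr_ge0 ltW.
have e2 : 0 < e / 2 by lra.
have [|N NP] := geometric_cvg0 C0 _ e2 (q := normr_of h); first by rewrite nr_ge0.
have hN n : (N <= n)%N -> normr_of (u n - b) <= e / 2.
  by move=> Nn; apply: le_trans (bP n) (ltW (NP n Nn)).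
have -> : b - (h + ca_mul b h) = (b - u N.+1) + ca_mul (u N - b) h.
  by rewrite ca_mulBl ur !opprD !addrA subrK.
apply: le_trans (nrD _ _) _; rewrite [e]splitr; apply: lerD.
  by rewrite nr_distC hN.
apply: le_trans (nr_ca_mul _ _) _; rewrite -[leRHS]mulr1; apply: ler_pM => //; rewrite ?nr_ge0 ?hN//.
exact: ltW.
Qed.

(** Let [s] be the square of the operator norm of [pi a]. If it exceeded [|a|^2], then
    [h = a^* a / s] would have norm below 1, and its quasi-inverse would bound [1 - pi h] from
    below; but vectors that nearly attain [s] are almost fixed by [pi h]. *)
Lemma irrep_contract a v : normr_of (pi a v) <= normr_of a * normr_of v.
Proof.
have [C C0 CP] := linear_bound (@irrep_continuous R A pi a).
pose S := [set normr_of (pi a v) ^+ 2 | v in [set v : E | normr_of v <= 1]].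
have S0 : S 0 by exists 0; rewrite /= ?nr0 ?ler01// linear0 nr0 expr0n.
have Sub : has_sup S.
  split; first by exists 0.
  exists (C ^+ 2) => _ [w w1 <-]; rewrite ler_pXn2r ?nnegrE ?nr_ge0 ?(ltW C0)//.
  by apply: le_trans (CP w) _; rewrite -[leRHS]mulr1 ler_wpM2l// ltW.
pose s := sup S.
have s0 : 0 <= s by exact: (ub_le_sup Sub.2 S0).
have sP w : normr_of (pi a w) ^+ 2 <= s * normr_of w ^+ 2.
  have [->|w0] := eqVneq w 0; first by rewrite linear0 !nr0 expr0n mulr0.
  have nw : 0 < normr_of w by rewrite nr_gt0.
  have : S (normr_of (pi a ((normr_of w)^-1%:C *: w)) ^+ 2).
    exists ((normr_of w)^-1%:C *: w) => //=.
    by rewrite nrZc nc_real ger0_norm ?invr_ge0 ?nr_ge0// mulVf// gt_eqF.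
  move/(ub_le_sup Sub.2); rewrite linearZ nrZc nc_real ger0_norm ?invr_ge0 ?nr_ge0//.
  by rewrite exprMn exprVn mulrC ler_pdivrMr ?exprn_gt0.
suff sa : s <= normr_of a ^+ 2.
  rewrite -(@ler_pXn2r _ 2) ?nnegrE ?mulr_ge0 ?nr_ge0// exprMn.
  by apply: le_trans (sP v) _; rewrite ler_wpM2r ?sqr_ge0.
rewrite leNgt; apply/negP => as_.
have {}s0 : 0 < s by apply: le_lt_trans as_; exact: sqr_ge0.
pose h := s^-1%:C *: ca_mul (ca_star a) a.
have h1 : normr_of h < 1.
  rewrite nrZc nc_real ger0_norm ?invr_ge0 ?(ltW s0)// nr_ca_star.
  by rewrite mulrC ltr_pdivrMr// mul1r.
have [b bE] := quasi_inverse h1.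
have [B B0 BP] := linear_bound (@irrep_continuous R A pi b).
have hE w w' : ip E (pi h w) w' = s^-1%:C * ip E (pi a w) (pi a w').
  by rewrite irrepZ ipZl irrep_mul irrep_star.
have hh w : complex.Re (ip E (pi h w) w) = s^-1 * normr_of (pi a w) ^+ 2.
  by rewrite hE ipE -rmorphM.
have saP w : normr_of (pi a w) <= Num.sqrt s * normr_of w.
  rewrite -(@ler_pXn2r _ 2) ?nnegrE ?mulr_ge0 ?sqrtr_ge0 ?nr_ge0// exprMn.
  by rewrite sqr_sqrtr ?(ltW s0).
have hn w : normr_of (pi h w) <= normr_of w.
  have : normr_of (pi h w) ^+ 2 <= normr_of w * normr_of (pi h w).
    have -> : normr_of (pi h w) ^+ 2 = nc (ip E (pi h w) (pi h w)).
      by rewrite ipE nc_real ger0_norm ?sqr_ge0.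
    rewrite hE ncM nc_real ger0_norm ?invr_ge0 ?(ltW s0)// ler_pdivrMl//.
    apply: le_trans (cauchy_schwarz _ _) _.
    apply: le_trans (ler_pM (nr_ge0 _) (nr_ge0 _) (saP _) (saP _)) _.
    by rewrite mulrACA -expr2 sqr_sqrtr ?(ltW s0).
  have [->|n0] := eqVneq (normr_of (pi h w)) 0; first by rewrite nr_ge0.
  by rewrite expr2 ler_pM2r// lt_neqAle eq_sym n0 nr_ge0.
(* The quasi-inverse [b] recovers [pi h w] from [w - pi h w]. *)
have vw w : normr_of w <= (1 + B) * normr_of (w - pi h w).
  have e : pi b (w - pi h w) = pi h w by rewrite linearB -irrep_mul -irrepB {1}bE addrK.
  rewrite -{1}(subrK (pi h w) w) -{2}e; apply: le_trans (nrD _ _) _.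
  by rewrite mulrDl mul1r lerD2l.
have B1 : 1 < (1 + B) ^+ 2 by rewrite expr2; nra.
(* A [w] in the unit ball with [|pi a w|^2 > s - s * e] has [|w - pi h w|^2 <= 2 * e], so [|w|^2] is
   at most [(1 + B)^2 * 2 * e = 1/2], while also [|w|^2 > 1 - e > 3/4]. *)
pose e := (4 * (1 + B) ^+ 2)^-1.
have e0 : 0 < e by rewrite invr_gt0; lra.
have eB : 4 * (1 + B) ^+ 2 * e = 1 by rewrite mulfV// gt_eqF//; lra.
have se : 0 < s * e by rewrite mulr_gt0.
have [_ [w /= w1 <-] ws] := sup_adherent se Sub.
rewrite -/s in ws.
have ws' : 1 - e < s^-1 * normr_of (pi a w) ^+ 2.
  by rewrite ltr_pdivlMl//; apply: le_lt_trans ws; rewrite mulrBr mulr1.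
have w1' : normr_of w ^+ 2 <= 1 by rewrite expr_le1 ?nr_ge0.
have h2 : normr_of (w - pi h w) ^+ 2 <= 2 * e.
  rewrite nr_sqrB ipC; have := hh w; case: (ip E (pi h w) w) => x y /= ->.
  have : normr_of (pi h w) ^+ 2 <= 1 by rewrite expr_le1 ?nr_ge0//; exact: le_trans (hn w) w1.
  by lra.
have h3 : 1 - e < normr_of w ^+ 2.
  by apply: lt_le_trans ws' _; rewrite ler_pdivrMl.
have h4 : normr_of w ^+ 2 <= (1 + B) ^+ 2 * (2 * e).
  apply: le_trans (_ : ((1 + B) * normr_of (w - pi h w)) ^+ 2 <= _).
    by rewrite ler_pXn2r ?vw// nnegrE ?nr_ge0// mulr_ge0 ?nr_ge0//; lra.
  by rewrite exprMn ler_wpM2l ?sqr_ge0.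
have : (1 + B) ^+ 2 * (2 * e) = 1 / 2 by have : (1 + B) ^+ 2 * (4 * e) = 1; [rewrite -[RHS]eB; ring|lra].
have : e < 1 / 4.
  rewrite -(ltr_pM2l (_ : 0 < 4 * (1 + B) ^+ 2)); last by lra.
  by rewrite eB; lra.
lra.
Qed.

End irreps.

Definition mkC (R : realType) (H : topologicalType) (f : H -> R[i]) (cf : ccont f) : CH R H :=
  HB.pack (f : H -> R[i]^o) (isContinuous.Build H R[i]^o f cf).

Lemma CH_cont (R : realType) (H : topologicalType) (f : CH R H) : ccont f.
Proof. exact: cts_fun. Qed.

(** * Representations of the group algebra *)

Section group_algebra.
Context (R : realType) (M : topologicalType) (H : ptopologicalType)
  (p : compact_group_bundle M H) (p_open : open_bundle p)
  (lambda : M -> probability (borel H) R)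
  (lambda_haar : forall m : M, is_haar p m (lambda m)).
Implicit Types (m : M) (x y : H) (f g h : CH R H).
Notation rint := (rint p lambda).
Notation cint := (cint p lambda).
Local Notation mul := (gb_mul p).
Local Notation inv := (gb_inv p).

Lemma conv_cont f g : ccont (Defs.conv p lambda f g).
Proof.
have [F cF FE] := mul_ext p (@CH_cont _ _ f).
have cG : ccont (fun z : H * H => F z * g (inv z.2)).
  apply: ccontM; [exact: cF|apply: ccont_comp (@CH_cont _ _ g)].
  by apply: cont_comp (@gb_inv_continuous _ _ p); exact: cont_snd.
have -> : Defs.conv p lambda f g = (fun x => cint (p x) (fun y => F (x, y) * g (inv y))).
  by apply/funext => x; apply: eq_cint => y yx; rewrite FE ?yx.
exact: (cint_param_cont lambda_haar p_open (@gb_proj_continuous _ _ p) cG).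
Qed.

Definition conv_elt f g : CH R H := mkC (@conv_cont f g).

(** Substituting [x^-1 y] for [y] moves the dependence on [x] from [f] to [g], so that a convolution
    becomes a superposition of left translates of [g] with weight [f]. *)
Lemma convE f g (G : H * H -> R[i]) m x : ccont G ->
  (forall y z, p y = p z -> G (y, z) = g (mul (inv y) z)) -> p x = m ->
  Defs.conv p lambda f g x = cint m (fun y => f y * G (y, x)).
Proof.
move=> cG GE xm; rewrite /Defs.conv -/(cint _ _) xm.
apply: (cint_translate lambda_haar xm).
  by apply: ccontM; [exact: CH_cont|exact: (ccont_slice2 x cG)].
move=> y ym; rewrite GE ?gb_proj_mul ?xm ?ym//.
rewrite gb_invM ?xm ?ym// -gb_mulA ?gb_proj_inv ?xm ?ym//.
by rewrite gb_mulVx xm -ym -gb_proj_inv gb_mulx1.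
Qed.

Lemma cstar_cont f : ccont (cstar p f).
Proof.
by apply: ccont_conj; apply: ccont_comp (@CH_cont _ _ f); exact: gb_inv_continuous.
Qed.

Definition star_elt f : CH R H := mkC (@cstar_cont f).

(** One extension is fixed for each [g], so that the translates of [g] depend continuously on both
    variables jointly. *)
Definition ltr_fun g : H * H -> R[i] := sval (cid2 (translate_ext p (@CH_cont _ _ g))).

Lemma ltr_fun_cont g : ccont (ltr_fun g).
Proof. by rewrite /ltr_fun; case: cid2. Qed.

Lemma ltr_funE g x y : p x = p y -> ltr_fun g (x, y) = g (mul (inv x) y).
Proof. by rewrite /ltr_fun; case: cid2 => F /= _ FE; exact: FE. Qed.

(* On the fiber through [x], [ltr g x] is the left translate of [g] by [x]; off
   that fiber its values are irrelevant. *)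
Definition ltr g x : CH R H := mkC (ccont_slice x (@ltr_fun_cont g)).

Lemma ltrE g x y : p x = p y -> ltr g x y = g (mul (inv x) y).
Proof. exact: ltr_funE. Qed.

Lemma conv_ltrE f g m x : p x = m ->
  Defs.conv p lambda f g x = cint m (fun y => f y * ltr g y x).
Proof. by move=> xm; apply: convE => //; [exact: ltr_fun_cont|exact: ltr_funE]. Qed.

Variables (A : cstar_algebra R) (iota : CH R H -> A).
Hypothesis A_completion : is_group_cstar_algebra p lambda iota.

Lemma iota_eq f g : (forall x, f x = g x) -> iota f = iota g.
Proof.
move=> fg; rewrite (gca_linear A_completion (a := 0) (f := f) (g := g)).
  by rewrite scale0r add0r.
by move=> x; rewrite mul0r add0r.
Qed.

Lemma iota_le f (b : R) : (forall m, rint m (fun x => nc (f x)) <= b) -> normr_of (iota f) <= b.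
Proof.
move=> fb; rewrite (gca_norm A_completion) /bounded_rep_norm.
have b0 : 0 <= b.
  apply: le_trans (fb (p point)); rewrite -(rint_cst lambda_haar (p point) 0).
  apply: rint_le => //; [exact: cont_cst|exact: cont_nc (@CH_cont _ _ f)|].
  by move=> x _; exact: nc_ge0.
have fb' : sup [set rint m (fun x => nc (f x)) | m in [set: M]] <= b.
  apply: ge_sup; first by exists (rint (p point) (fun x => nc (f x))), (p point).
  by move=> _ [m _ <-].
have ub : ubound [set r | exists (E : hilbert R) (pi : CH R H -> {linear E -> E}),
    is_bounded_rep p lambda pi /\ r = opnorm (pi f)] b.
  by move=> _ [E [pi [pib ->]]]; exact: le_trans (brep_bound pib f) fb'.
(* The supremum of the empty set is 0 by convention, so this case is settled by [0 <= b]. *)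
have [->|/set0P ne] := eqVneq [set r | exists (E : hilbert R) (pi : CH R H -> {linear E -> E}),
    is_bounded_rep p lambda pi /\ r = opnorm (pi f)] set0; first by rewrite sup0.
exact: ge_sup.
Qed.

Lemma iota_sup f (b : R) : (forall x, nc (f x) <= b) -> normr_of (iota f) <= b.
Proof.
move=> fb; apply: iota_le => m; rewrite -(rint_cst lambda_haar m b).
apply: rint_le => //; [exact: cont_nc (@CH_cont _ _ f)|exact: cont_cst].
Qed.

Lemma iota_approx (a : A) (e : R) : 0 < e -> exists f, normr_of (iota f - a) < e.
Proof.
move=> e0; have [||x [/interior_subset + [f _ fx]]] :=
    gca_dense A_completion (O := interior (ball a e%:C)).
- by exists a; apply: nbhsx_ballx; rewrite ltcR.
- exact: open_interior.
by rewrite -ball_normE /= normE ltcR -fx => h; exists f; rewrite nr_distC.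
Qed.

Section irreducible.
Variable pi : irrep A.
Local Notation E := (irrep_space pi).
Implicit Types v w : E.

Lemma rep_linear (a : R[i]) f g h v : (forall x, h x = a * f x + g x) ->
  pi (iota h) v = a *: pi (iota f) v + pi (iota g) v.
Proof. by move=> /(gca_linear A_completion) ->; rewrite irrep_linear. Qed.

Lemma rep_conv f g v : pi (iota (conv_elt f g)) v = pi (iota f) (pi (iota g) v).
Proof. by rewrite (gca_conv A_completion (f := f) (g := g)) ?irrep_mul. Qed.

Lemma rep_star f v w : ip E (pi (iota (star_elt f)) v) w = ip E v (pi (iota f) w).
Proof. by rewrite (gca_star A_completion (f := f)) ?irrep_star. Qed.

Lemma rep_dense a v (e : R) : 0 < e -> exists f, normr_of (pi (iota f) v - pi a v) < e.
Proof.
move=> e0; have d0 : 0 < e / (normr_of v + 1) by rewrite divr_gt0// ltr_wpDl ?nr_ge0.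
have [f fa] := iota_approx a d0; exists f.
rewrite -irrepB; apply: le_lt_trans (irrep_contract _ _) _.
have v0 := nr_ge0 v.
apply: (@le_lt_trans _ _ (normr_of (iota f - a) * (normr_of v + 1))).
  by rewrite ler_wpM2l ?nr_ge0// lerDl.
by rewrite -ltr_pdivlMr// ltr_wpDl.
Qed.

Lemma rep_eq0 v : (forall f, pi (iota f) v = 0) -> forall a, pi a v = 0.
Proof.
move=> f0 a; apply/nr_eq0/eqP; rewrite eq_le nr_ge0 andbT.
apply/ler_addgt0Pr => e e0; rewrite add0r.
by have [f] := rep_dense a v e0; rewrite f0 sub0r nrN => /ltW.
Qed.

Lemma rep_nonzero : exists f v, pi (iota f) v != 0.
Proof.
apply: contrapT => h; have [a [v /eqP]] := irrep_nonzero pi; apply.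
apply: rep_eq0 => f; apply/eqP/negP => /negP fv; apply: h.
by exists f, v.
Qed.

(** Otherwise every point of [M] has a neighborhood such that [pi] kills all functions living over
    it. A finite partition of unity pulled back from [M] writes every [f] as a sum of such
    functions, and [pi] would be 0. *)
Lemma rep_support : exists m, forall U, nbhs m U ->
  exists f, (forall x, ~ U (p x) -> f x = 0) /\ exists v, pi (iota f) v != 0.
Proof.
apply: contrapT => nsup.
have h m : exists U, nbhs m U /\ forall f, (forall x, ~ U (p x) -> f x = 0) ->
    forall v, pi (iota f) v = 0.
  apply: contrapT => nU; apply: nsup; exists m => U nU'.
  apply: contrapT => nf; apply: nU; exists U; split => // f fU v.
  by apply/eqP/negP => /negP fv; apply: nf; exists f; split => //; exists v.
have /choice[U UP] := h.
have /choice[g gP] m := urysohn_bump R (gb_compactM p) (gb_hausdorffM p) (UP m).1.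
have cg m : continuous (g m) by case: (gP m).
have cgp m : continuous (fun x : H => g m (p x)).
  by apply: cont_comp (cg m); exact: gb_proj_continuous.
have g0 m (y : M) : 0 <= g m y by case: (gP m) => _ _ /(_ y)/andP[].
have [|s [_ scov]] := @compact_finite _ [set: H] (fun x => [set y | 1/2 < g (p x) (p y)]) (gb_compactH p).
  move=> x _; apply: (cgp (p x) x [set r : R^o | 1/2 < r]).
  apply: open_nbhs_nbhs; split; first exact: open_gt.
  by case: (gP (p x)) => _ /= -> _ _; lra.
pose G y : R := \sum_(x <- s) g (p x) (p y).
have cG : continuous (G : H -> R^o).
  rewrite /G; elim: (s) => [|x s' IHs].
    by under eq_fun do rewrite big_nil; exact: cont_cst.
  by under eq_fun do rewrite big_cons; move=> y; apply: cvgD; [exact: cgp|exact: IHs].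
have G0 y : 0 < G y.
  have [x xs gxy] := scov y I; apply: (@lt_le_trans _ _ (g (p x) (p y))).
    by apply: lt_trans gxy; lra.
  rewrite /G (big_rem x xs) /= lerDl; exact: sumr_ge0.
have cGi : ccont (fun y => ((G y)^-1)%:C).
  by apply: ccont_real => y; apply: cvgV; [rewrite gt_eqF|exact: cG].
(* Partial sums of the bumps, multiplied by [f / G], permit an induction on [s'] that uses only
   linearity of [pi]. *)
have cpart s' f : ccont (fun y => (\sum_(x <- s') g (p x) (p y))%:C * (f y * ((G y)^-1)%:C)).
  apply: ccontM; last by apply: ccontM; [exact: CH_cont|exact: cGi].
  apply: ccont_real; elim: (s') => [|x s'' IHs].
    by under eq_fun do rewrite big_nil; exact: cont_cst.
  by under eq_fun do rewrite big_cons; move=> y; apply: cvgD; [exact: cgp|exact: IHs].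
have part0 s' f v : pi (iota (mkC (cpart s' f))) v = 0.
  elim: s' => [|x s' IHs].
    apply: (UP (p point)).2 => x _.
    by rewrite -[LHS]/(_ * _) big_nil mul0r.
  rewrite (@rep_linear 1 (mkC (cpart [:: x] f)) (mkC (cpart s' f))).
    rewrite IHs addr0 scale1r; apply: (UP (p x)).2 => y nU.
    rewrite -[LHS]/(_ * _) big_seq1.
    by case: (gP (p x)) => _ _ _ /(_ _ nU) ->; rewrite mul0r.
  move=> y; rewrite -[LHS]/(_ * _) big_cons mul1r.
  by rewrite -[X in _ = X + _]/(_ * _) -[X in _ = _ + X]/(_ * _) big_seq1 -mulrDl -rmorphD.
have [f [v /eqP]] := rep_nonzero; apply.
rewrite (@iota_eq f (mkC (cpart s f))) ?part0// => y.
by rewrite -[RHS]/((G y)%:C * (f y * ((G y)^-1)%:C)) mulrCA -rmorphM mulfV ?gt_eqF// mulr1.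
Qed.

Definition rep_base : M := sval (cid rep_support).

(* [f * h * k = 0] for every [h] when [k] lives over [U]; then use that the
   kernel of an irreducible representation is prime. *)
Lemma rep_base_vanish f U : nbhs rep_base U -> (forall x, U (p x) -> f x = 0) ->
  forall v, pi (iota f) v = 0.
Proof.
rewrite /rep_base; case: cid => m /= mP mU fU.
have [k [kU [w kw]]] := mP U mU.
have fhk h v : pi (iota f) (pi (iota h) (pi (iota k) v)) = 0.
  rewrite -!rep_conv.
  rewrite (@rep_linear 0 f (mkC (@ccont_cst R H 0))); last first.
    move=> x; rewrite mul0r add0r -[LHS]/(Defs.conv _ _ _ _ _) /Defs.conv -/(cint _ _) -[RHS](cint_cst lambda_haar (p x)).
    apply: eq_cint => y yx; have [Ux|nUx] := pselect (U (p x)).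
      rewrite [X in X * _](_ : _ = 0) ?mul0r// -[LHS]/(Defs.conv _ _ _ _ _) /Defs.conv -/(cint _ _) -[RHS](cint_cst lambda_haar (p (mul x y))).
      apply: eq_cint => z zx; rewrite fU ?mul0r//.
      by rewrite !gb_proj_mul ?zx// ?gb_proj_mul.
    by rewrite kU ?mulr0// gb_proj_inv yx.
  rewrite scale0r add0r; apply/nr_eq0/eqP; rewrite eq_le nr_ge0 andbT.
  apply: le_trans (irrep_contract _ _) _.
  suff : normr_of (iota (mkC (@ccont_cst R H 0))) <= 0.
    by move=> h0; rewrite -[leRHS](mul0r (normr_of v)) ler_wpM2r ?nr_ge0.
  by apply: iota_sup => x; rewrite -[mkC _ x]/(0 : R[i]) nc0.
have [|//|k0] := @irrep_prime _ _ pi (iota f) (iota k); last by rewrite k0 eqxx in kw.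
(* Primeness asks for every middle factor [a] in [A], whereas [fhk] covers the dense image of
   [iota]. *)
move=> a v; rewrite !irrep_mul.
apply/nr_eq0/eqP; rewrite eq_le nr_ge0 andbT.
apply/ler_addgt0Pr => e e0; rewrite add0r.
have d0 : 0 < e / (normr_of (iota f) + 1) by rewrite divr_gt0// ltr_wpDl ?nr_ge0.
have [h ha] := rep_dense a (pi (iota k) v) d0.
rewrite -[pi (iota f) _]subr0 -(fhk h v) -linearB; apply: le_trans (irrep_contract _ _) _.
rewrite nr_distC; apply: (@le_trans _ _ ((normr_of (iota f) + 1) * (e / (normr_of (iota f) + 1)))).
  by apply: ler_pM; rewrite ?nr_ge0 ?lerDl// ltW.
by rewrite mulrC divfK// gt_eqF// ltr_wpDl ?nr_ge0.
Qed.

(** By [rep_base_vanish], [f] may be cut off away from the base fiber without changing its image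
    under [pi], and near that fiber [|f| < b + e]. *)
Lemma rep_fiber_bound f (b : R) v : (forall x, p x = rep_base -> nc (f x) <= b) ->
  normr_of (pi (iota f) v) <= b * normr_of v.
Proof.
move=> fb; have b0 : 0 <= b.
  by have [x /fb] := gb_proj_surj p rep_base; apply: le_trans; exact: nc_ge0.
suff : forall e : R, 0 < e -> normr_of (pi (iota f) v) <= (b + e) * normr_of v.
  have [->|v0] := eqVneq v 0; first by rewrite linear0 !nr0 mulr0.
  have nv : 0 < normr_of v by rewrite nr_gt0.
  move=> h; rewrite -ler_pdivrMr//; apply/ler_addgt0Pr => e e0.
  by rewrite ler_pdivrMr//; exact: h.
move=> e e0.
have oU : open [set y | nc (f y) < b + e].
  have := cont_nc (@CH_cont _ _ f) => /continuousP /(_ [set r : R^o | r < b + e]); apply; exact: open_lt.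
have fb' x : p x = rep_base -> [set y | nc (f y) < b + e] x.
  by move=> /fb; rewrite /=; lra.
have nU := fiber_nbhs (gb_compactH p) (gb_hausdorffM p) (@gb_proj_continuous _ _ p) oU fb'.
have [g [cg g1 g01 gU]] := urysohn_bump R (gb_compactM p) (gb_hausdorffM p) nU.
(* This cutoff equals 1 wherever [g > 1/2], so [f - k f] vanishes over a whole neighborhood of the
   base point and not merely at it. *)
pose k y : R := Num.min 1 (2 * g (p y)).
have cgp : continuous (fun x : H => g (p x)).
  by apply: cont_comp cg; exact: gb_proj_continuous.
have ck : continuous (k : H -> R^o).
  move=> y; apply: (@continuous_min R H (fun=> 1) (fun y => 2 * g (p y))); first exact: cvg_cst.
  by apply: cvgM; [exact: cvg_cst|exact: cgp].
have cfk : ccont (fun y => (k y)%:C * f y).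
  by apply: ccontM; [exact: ccont_real|exact: CH_cont].
have cfk' : ccont (fun y => f y - (k y)%:C * f y).
  by apply: ccontB; [exact: CH_cont|exact: cfk].
have -> : pi (iota f) v = pi (iota (mkC cfk)) v.
  rewrite (@rep_linear 1 (mkC cfk) (mkC cfk')).
    rewrite scale1r (@rep_base_vanish (mkC cfk') [set m | 1/2 < g m]) ?addr0//.
      apply: (cg rep_base [set r : R^o | 1/2 < r]).
      by apply: open_nbhs_nbhs; split; [exact: open_gt|rewrite /= g1; lra].
    move=> x /= gx; rewrite -[LHS]/(_ - _) (_ : k x = 1) ?mul1r ?subrr//.
    by rewrite /k; apply: min_l; lra.
  by move=> x; rewrite mul1r -[X in _ = X + _]/(_ * _) -[X in _ = _ + X]/(_ - _) addrC subrK.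
apply: le_trans (irrep_contract _ _) _; rewrite ler_wpM2r ?nr_ge0//.
apply: iota_sup => x; rewrite -[mkC cfk x]/(_ * _) ncM nc_real.
have k01 : 0 <= k x <= 1.
  by rewrite /k ge_min lexx le_min ler01 /= mulr_ge0//; case/andP: (g01 (p x)).
case/andP: k01 => k0 k1; rewrite ger0_norm//.
have [/ltW Ux|/negP] := boolP (nc (f x) < b + e).
  by rewrite -[leRHS]mul1r ler_pM ?nc_ge0.
move=> nUx; rewrite (_ : k x = 0) ?mul0r; first by lra.
by rewrite /k gU ?mulr0 ?min_r//= => /(_ x erefl).
Qed.

Lemma rep_fiber_eq f g v : (forall x, p x = rep_base -> f x = g x) ->
  pi (iota f) v = pi (iota g) v.
Proof.
move=> fg; have cfg : ccont (fun x => f x - g x) by apply: ccontB; exact: CH_cont.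
rewrite (@rep_linear 1 (mkC cfg) g f).
  rewrite scale1r [X in X + _](_ : _ = 0) ?add0r//.
  apply/nr_eq0/eqP; rewrite eq_le nr_ge0 andbT -(mul0r (normr_of v)).
  by apply: rep_fiber_bound => x xm; rewrite -[mkC cfg x]/(_ - _) fg// subrr nc0.
by move=> x; rewrite mul1r -[X in _ = X + _]/(_ - _) subrK.
Qed.

End irreducible.
End group_algebra.

(** Bounded intervals are compact. This will give the coefficients at the nodes of a Riemann sum
    limits along an ultrafilter of near-maximizers. *)
Lemma ultra_bounded (R : realType) (T : Type) (U : set_system T) (f : T -> R) (K : R) :
  UltraFilter U -> U [set x | `|f x| <= K] ->
  exists r, forall e : R, 0 < e -> U [set x | `|f x - r| < e].
Proof.
move=> uU fK; have pU := @ultra_proper _ _ uU.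
have [|r [_ rc]] := @segment_compact R (- K) K (f @ U) _.
  by apply: (@filterS _ U _ _ _ _ fK) => x xK; rewrite /= in_itv /= -ler_norml.
exists r => e e0.
have [//|nU] := in_ultra_setVsetC [set x | `|f x - r| < e] uU.
exfalso; have [||z [/= [x nx <-] zr]] := rc (f @` (~` [set x | `|f x - r| < e])) (ball r e).
- by apply: (@filterS _ U _ _ _ _ nU) => x nx; exists x.
- exact: nbhsx_ballx.
by apply: nx; move: zr; rewrite /ball /= distrC.
Qed.

(** * Positive semidefinite sesquilinear forms *)

Section semidefinite.
Context (R : realType) (E : lmodType R[i]) (Q : E -> E -> R[i]).
Hypothesis QDl : forall (a : R[i]) u v w, Q (a *: u + v) w = a * Q u w + Q v w.
Hypothesis QC : forall u v, Q v u = Num.conj (Q u v).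
Hypothesis Q0 : forall v, 0 <= complex.Re (Q v v).

(** With [c = Q w v] and [Q v v = 0], the form at [w - s c v] is affine in the real number [s].
    Being nonnegative for every [s], it has slope 0. *)
Lemma semidefinite_null v w : complex.Re (Q v v) = 0 -> Q v w = 0.
Proof.
move=> Qv; set c := Q w v.
have QDr a u x y : Q u (a *: x + y) = Num.conj a * Q u x + Q u y.
  by rewrite QC QDl rmorphD rmorphM /= -!QC.
have h (s : R) : 0 <= complex.Re (Q w w) - 2 * s * nc c ^+ 2.
  have := Q0 ((- s%:C * c) *: v + w); rewrite QDl !QDr -/c [Q v w]QC -/c.
  have cc : c * Num.conj c = (nc c ^+ 2)%:C := ncCK c.
  have -> : - s%:C * c * (Num.conj (- s%:C * c) * Q v v + Num.conj c) +
      (Num.conj (- s%:C * c) * c + Q w w) =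
      (s ^+ 2 * nc c ^+ 2)%:C * Q v v + Q w w - (2 * s * nc c ^+ 2)%:C.
    have cs : Num.conj (- s%:C * c) = - s%:C * Num.conj c.
      by rewrite rmorphM rmorphN /= -[Num.conj _]/(s +i* - 0) oppr0.
    rewrite cs.
    transitivity (s%:C ^+ 2 * (c * Num.conj c) * Q v v + Q w w - (2%:C * s%:C) * (c * Num.conj c)).
      by rewrite -[2%:C]/((1 + 1)%:C) rmorphD; ring.
    by rewrite cc -!rmorphXn -!rmorphM.
  have QRe : complex.Im (Q v v) = 0.
    have := QC v v; case: (Q v v) => x y /=; rewrite -[Num.conj _]/(x +i* - y) => -[] ?; lra.
  move: Qv QRe; case: (Q v v) => x y /= -> ->; case: (Q w w) => a b /=.
  by rewrite !mulr0 subrr add0r.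
suff c0 : c = 0 by rewrite QC -/c c0 rmorph0.
apply: nc_eq0; apply/eqP/negP => /negP c0.
have cp : 0 < nc c ^+ 2 by rewrite exprn_gt0// lt_neqAle eq_sym c0 nc_ge0.
(* At this [s] the affine function would equal [-1]. *)
have := h ((complex.Re (Q w w) + 1) / (2 * nc c ^+ 2)).
rewrite -mulrA mulrCA; set X := nc c ^+ 2.
have -> : (complex.Re (Q w w) + 1) / (2 * X) * (2 * X) = complex.Re (Q w w) + 1.
  by rewrite divfK// mulf_neq0// gt_eqF.
lra.
Qed.

(** The parallelogram law with the nonnegative term at [u - v] dropped. *)
Lemma semidefinite_parallelogram u v : complex.Re (Q (u + v) (u + v)) <=
  2 * complex.Re (Q u u) + 2 * complex.Re (Q v v).
Proof.
have QA x y z : Q (x + y) z = Q x z + Q y z by rewrite -[x]scale1r QDl mul1r scale1r.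
have QN x z : Q (- x) z = - Q x z.
  by apply: (addrI (Q x z)); rewrite -QA !subrr -[0](addNr 0) -(scaleN1r 0) QDl mulN1r addNr.
have QAr x y z : Q z (x + y) = Q z x + Q z y by rewrite QC QA rmorphD /= -!QC.
have QNr x z : Q z (- x) = - Q z x by rewrite QC QN rmorphN /= -QC.
have := Q0 (u - v); rewrite !QA !QN !QAr !QNr !raddfD !raddfN /=.
lra.
Qed.
End semidefinite.

(** * Matrix coefficients on the base fiber and their averages *)

Section rep_coefficients.
Context (R : realType) (M : topologicalType) (H : ptopologicalType)
  (p : compact_group_bundle M H) (p_open : open_bundle p)
  (lambda : M -> probability (borel H) R)
  (lambda_haar : forall m : M, is_haar p m (lambda m))
  (A : cstar_algebra R) (iota : CH R H -> A)
  (A_completion : is_group_cstar_algebra p lambda iota) (pi : irrep A).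
Implicit Types (x y z : H) (f g h : CH R H).
Notation rint := (rint p lambda).
Notation cint := (cint p lambda).
Local Notation mul := (gb_mul p).
Local Notation inv := (gb_inv p).
Local Notation E := (irrep_space pi).
Local Notation m0 := (rep_base A_completion pi).
Implicit Types v w u : E.

Lemma rep_fiber_boundB f g (b : R) v : (forall x, p x = m0 -> nc (f x - g x) <= b) ->
  normr_of (pi (iota f) v - pi (iota g) v) <= b * normr_of v.
Proof.
move=> fg; have cfg : ccont (fun x => f x - g x) by apply: ccontB; exact: CH_cont.
rewrite (rep_linear A_completion (a := 1) (f := mkC cfg) (g := g) (h := f)).
  by rewrite scale1r addrK; exact: (rep_fiber_bound p_open lambda_haar).
by move=> x; rewrite mul1r -[X in _ = X + _]/(_ - _) subrK.
Qed.

Lemma rep_sum n (c : 'I_n -> R[i]) (F : 'I_n -> CH R H) f v :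
  (forall x, p x = m0 -> f x = \sum_i c i * F i x) ->
  pi (iota f) v = \sum_i c i *: pi (iota (F i)) v.
Proof.
have cF (r : seq 'I_n) : ccont (fun x => \sum_(i <- r) c i * F i x).
  by apply: ccont_sum => i; apply: ccontM; [exact: ccont_cst|exact: CH_cont].
have h (r : seq 'I_n) : pi (iota (mkC (cF r))) v = \sum_(i <- r) c i *: pi (iota (F i)) v.
  elim: r => [|i r IHr].
    rewrite big_nil (@rep_linear _ _ _ _ _ _ _ A_completion pi (-1) (mkC (cF [::])) (mkC (cF [::]))).
      by rewrite scaleN1r addNr.
    by move=> x; rewrite -[mkC _ x]/(\sum_(_ <- _) _) !big_nil mulr0 addr0.
  rewrite big_cons -IHr; apply: (rep_linear A_completion) => x.
  by rewrite -[mkC (cF (i :: r)) x]/(\sum_(_ <- _) _) big_cons.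
by move=> fE; rewrite -h; apply: (rep_fiber_eq p_open lambda_haar) => x /fE.
Qed.

(** Over the base fiber this is [rho x (pi (iota g) v)], where [rho] is the group representation
    underlying [pi]. As [rho] is still to be constructed, it is accessible only through left
    translates of [g]. *)
Definition orbit_map g v x : E := pi (iota (ltr p g x)) v.

Lemma orbit_cont g v : continuous (orbit_map g v).
Proof.
apply/cont_nrP => x e e0.
have d0 : 0 < e / (normr_of v + 1) by rewrite divr_gt0// ltr_wpDl ?nr_ge0.
have := ctube x (gb_compactH p) (@ltr_fun_cont _ _ _ p g) d0.
apply: filterS => y gy; apply: le_lt_trans (rep_fiber_boundB (b := e / (normr_of v + 1)) v _) _.
  by move=> z _; exact: ltW (gy z).
by rewrite mulrAC ltr_pdivrMr ?ltr_wpDl ?nr_ge0// ltr_pM2l// ltrDl.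
Qed.

Lemma orbit1 g v : orbit_map g v (gb_one p m0) = pi (iota g) v.
Proof.
apply: (rep_fiber_eq p_open lambda_haar) => x xm.
by rewrite ltrE ?gb_proj_one// gb_inv1 gb_mul1.
Qed.

Lemma orbit_translate g v x y : p x = m0 -> p y = m0 ->
  orbit_map (ltr p g x) v y = orbit_map g v (mul y x).
Proof.
move=> xm ym; apply: (rep_fiber_eq p_open lambda_haar) => z zm.
rewrite !ltrE ?gb_proj_mul ?gb_proj_inv ?xm ?ym ?zm//.
by rewrite gb_invM ?xm ?ym// gb_mulA ?gb_proj_inv ?xm ?ym.
Qed.

(* Riemann sums of the convolution converge uniformly, hence in operator norm. *)
Lemma rep_weak f g v w :
  ip E (pi (iota f) (pi (iota g) v)) w = cint m0 (fun y => f y * ip E (orbit_map g v y) w).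
Proof.
rewrite -(rep_conv p_open lambda_haar A_completion).
apply/eqP; rewrite -subr_eq0; apply/eqP/nc_le0_eq0 => e e0.
have K0 : 0 < normr_of v * normr_of w + 1 by rewrite ltr_wpDl// mulr_ge0 ?nr_ge0.
pose d := e / (normr_of v * normr_of w + 1).
have d0 : 0 < d by rewrite divr_gt0.
have cG : ccont (fun z : H * H => f z.1 * ltr_fun p g z).
  apply: ccontM; last exact: ltr_fun_cont.
  by apply: ccont_comp (@CH_cont _ _ f); exact: cont_fst.
have cL : ccont (fun y => f y * ip E (orbit_map g v y) w).
  apply: ccontM; first exact: CH_cont.
  by apply: ip_cont; [exact: orbit_cont|exact: cont_cst].
(* The same nodes must serve the convolution integrand, uniformly in [z], and its scalar coefficient
   against [w]. *)
pose V y := [set y' | (forall z, nc (f y' * ltr p g y' z - f y * ltr p g y z) < d) /\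
   nc (f y' * ip E (orbit_map g v y') w - f y * ip E (orbit_map g v y) w) < d].
have nV y : nbhs y (V y).
  have h1 := ctube y (gb_compactH p) cG d0.
  have /ccontP/(_ y d d0) h2 := cL.
  by apply: filterS2 h1 h2 => y' h1 h2; split.
have [n [a [t [a0 a1 tm rs]]]] := riemann_sum lambda_haar m0 (ltW d0) nV.
have rs1 := rs _ cL (fun y y' V => ltW V.2).
pose c i := (a i)%:C * f (t i).
have cF : ccont (fun x => \sum_i c i * ltr p g (t i) x).
  by apply: ccont_sum => i; apply: ccontM; [exact: ccont_cst|exact: CH_cont].
have PF : pi (iota (mkC cF)) v = \sum_i c i *: orbit_map g v (t i) by exact: rep_sum.
have rs2 : normr_of (pi (iota (conv_elt p_open lambda_haar f g)) v - pi (iota (mkC cF)) v) <= d * normr_of v.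
  apply: rep_fiber_boundB => x xm.
  rewrite -[conv_elt _ _ _ _ x]/(Defs.conv _ _ _ _ _) (conv_ltrE lambda_haar f g xm).
  rewrite -[mkC cF x]/(\sum_(_ < _) _).
  under eq_bigr do rewrite -mulrA.
  apply: (rs (fun y => f y * ltr p g y x)) => [|y y' V']; last exact: ltW (V'.1 x).
  exact: (ccont_slice2 x cG).
apply: le_trans (nc_triB _ (\sum_i (a i)%:C * (f (t i) * ip E (orbit_map g v (t i)) w)) _) _.
apply: (@le_trans _ _ (d * normr_of v * normr_of w + d)); last first.
  by rewrite -mulrA -[X in _ + X]mulr1 -mulrDr /d divfK// gt_eqF.
apply: lerD; last by rewrite nc_distC.
have -> : \sum_i (a i)%:C * (f (t i) * ip E (orbit_map g v (t i)) w) = ip E (pi (iota (mkC cF)) v) w.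
  by rewrite PF ip_suml; apply: eq_bigr => i _; rewrite ipZl mulrA.
rewrite -ipBl; apply: le_trans (cauchy_schwarz _ _) _.
by rewrite ler_wpM2r ?nr_ge0.
Qed.

Section schur.
Context (g : CH R H) (v0 : E).
Local Notation psi := (orbit_map g v0).

Lemma psi_ip_cont w : ccont (fun x => ip E (psi x) w).
Proof. by apply: ip_cont; [exact: orbit_cont|exact: cont_cst]. Qed.

Lemma ip_psi_cont w : ccont (fun x => ip E w (psi x)).
Proof. by apply: ip_cont; [exact: cont_cst|exact: orbit_cont]. Qed.

(** The form of the positive operator that sends [w] to the integral of [<w, psi x> psi x]. It
    commutes with the representation, so Schur's lemma should make it scalar. *)
Definition coeff_form w w' : R[i] := cint m0 (fun x => ip E w (psi x) * ip E (psi x) w').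
Local Notation B := coeff_form.

Lemma coeff_cont w w' : ccont (fun x => ip E w (psi x) * ip E (psi x) w').
Proof. by apply: ccontM; [exact: ip_psi_cont|exact: psi_ip_cont]. Qed.

Lemma coeff_formDl (a : R[i]) u v w : B (a *: u + v) w = a * B u w + B v w.
Proof.
rewrite /B -cintZ; last exact: coeff_cont.
rewrite -cintD; last exact: coeff_cont.
  by apply: eq_cint => x _; rewrite ipDl ipZl; ring.
by apply: ccontM; [exact: ccont_cst|exact: coeff_cont].
Qed.

Lemma coeff_formC u v : B v u = Num.conj (B u v).
Proof.
rewrite /B -cint_conj; last exact: coeff_cont.
by apply: eq_cint => x _; rewrite rmorphM /= -!ipC mulrC.
Qed.

Lemma coeff_formE w : B w w = (rint m0 (fun x => nc (ip E w (psi x)) ^+ 2))%:C.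
Proof.
by rewrite -(cint_real lambda_haar); apply: eq_cint => x _; rewrite [ip E (psi x) w]ipC ncCK.
Qed.

(* Left invariance moves [pi f] across the form. *)
Lemma coeff_form_rep f w w' : B (pi (iota f) w) w' = B w (pi (iota (star_elt p f)) w').
Proof.
have [F cF FE] := mul_ext p (@psi_ip_cont w).
have [F' cF' FE'] := mul_ext p (@psi_ip_cont w').
pose fi y := f (inv y).
have cfi : ccont fi by apply: ccont_comp (@CH_cont _ _ f); exact: gb_inv_continuous.
have starr v u : ip E v (pi (iota (star_elt p f)) u) = ip E (pi (iota f) v) u.
  by rewrite ipC (rep_star A_completion) -ipC.
have cFc : ccont (fun z : H * H => Num.conj (F z)) by exact: ccont_conj.
have c1 : ccont (fun z : H * H => fi z.2 * (Num.conj (F (z.2, z.1)) * ip E (psi z.1) w')).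
  apply: ccontM; first by apply: ccont_comp cfi; exact: cont_snd.
  apply: ccontM; last by apply: ccont_comp (@psi_ip_cont w'); exact: cont_fst.
  by apply: ccont_comp cFc; apply: cont_pair; [exact: cont_snd|exact: cont_fst].
have c2 : ccont (fun z : H * H => ip E w (psi z.2) * F' z).
  apply: ccontM; last exact: cF'.
  by apply: ccont_comp (@ip_psi_cont w); exact: cont_snd.
have c3 : ccont (fun z : H * H => f z.1 * (ip E w (psi z.2) * F' z)).
  apply: ccontM; last exact: c2.
  by apply: ccont_comp (@CH_cont _ _ f); exact: cont_fst.
transitivity (cint m0 (fun x => cint m0 (fun y =>
    fi y * (Num.conj (F (y, x)) * ip E (psi x) w')))).
  apply: eq_cint => x xm.
  have cFx := ccont_slice2 x cF.
  have -> : ip E (pi (iota f) w) (psi x) = cint m0 (fun y => fi y * Num.conj (F (y, x))).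
    rewrite ipC -(rep_star A_completion) rep_weak -cint_conj; last first.
      apply: ccontM; first exact: CH_cont.
      by apply: ip_cont; [exact: orbit_cont|exact: cont_cst].
    apply: eq_cint => y ym; rewrite orbit_translate// rmorphM /= -FE ?ym//; congr (_ * _).
    by rewrite /= /cstar conjCK.
  rewrite mulrC -cintZ; last by apply: ccontM; [exact: cfi|exact: (ccont_conj cFx)].
  by apply: eq_cint => y _; ring.
rewrite (cint_fubini lambda_haar m0 c1) /=.
(* Translating [x] by [y] turns the pair [psi (yx)], [psi x] into [psi x], [psi (y^-1 x)]; the
   inversion of [y] below then replaces [f (y^-1)] by [f y]. *)
transitivity (cint m0 (fun y => fi y * cint m0 (fun x => ip E w (psi x) * F' (inv y, x)))).
  apply: eq_cint => y ym; rewrite cintZ; last first.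
    apply: ccontM; last exact: psi_ip_cont.
    exact: (ccont_slice y cFc).
  congr (_ * _); apply: (cint_translate lambda_haar ym); first exact: (ccont_slice (inv y) c2).
  move=> x xm; rewrite FE ?ym// -ipC FE' ?gb_proj_inv ?gb_proj_mul ?ym ?xm//.
  by rewrite gb_mulKx// ym.
have cI : ccont (fun y => cint m0 (fun x => ip E w (psi x) * F' (y, x))).
  exact (@cint_fiber_cont _ _ _ _ _ lambda_haar m0 H _ c2). 
rewrite (cint_inv lambda_haar m0 (ccontM (@CH_cont _ _ f) cI)).
transitivity (cint m0 (fun y => cint m0 (fun x => f y * (ip E w (psi x) * F' (y, x))))).
  by apply: eq_cint => y _; rewrite cintZ; last exact: (ccont_slice y c2).
rewrite (cint_fubini lambda_haar m0 c3) /=.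
apply: eq_cint => x xm; rewrite starr rep_weak -cintZ; last first.
  apply: ccontM; first exact: CH_cont.
  by apply: ip_cont; [exact: orbit_cont|exact: cont_cst].
apply: eq_cint => y ym; rewrite (orbit_translate _ _ xm ym) FE'; last by rewrite ym xm.
exact: mulrCA.
Qed.

End schur.
End rep_coefficients.

Section norm_topology.
Context (R : realType).

Lemma closed_nrP (V : normedModType R[i]) (Z : set V) :
  (forall w, (forall e : R, 0 < e -> exists2 u, Z u & normr_of (w - u) < e) -> Z w) -> closed Z.
Proof.
move=> h w clw; apply: h => e e0.
have [|u [Zu]] := clw (ball w e%:C); first by apply: nbhsx_ballx; rewrite ltcR.
by rewrite -ball_normE /= normE ltcR => wu; exists u.
Qed.

Lemma closedP_nr (V : normedModType R[i]) (Z : set V) w : closed Z ->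
  (forall e : R, 0 < e -> exists2 u, Z u & normr_of (w - u) < e) -> Z w.
Proof.
move=> clZ h; apply: clZ => B /nbhs_ballP[e /= e0 eB].
have eE : e = (complex.Re e)%:C by move: e0; case: (e) => a b; rewrite ltcE /= => /andP[/eqP -> _].
move: e0 eB; rewrite eE ltcR => e0 eB; have [u Zu wu] := h _ e0.
exists u; split => //; apply: eB.
by rewrite -ball_normE /= normE ltcR.
Qed.

Lemma nr_filter_cvg (V : completeNormedModType R[i]) (F : set_system V) : ProperFilter F ->
  (forall e : R, 0 < e -> exists C : set V, F C /\ forall x y, C x -> C y -> normr_of (x - y) < e) ->
  exists l, forall e : R, 0 < e -> F [set x | normr_of (x - l) < e].
Proof.
move=> PF Fc.
have : cauchy F.
  apply/cauchy_ballP => e e0.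
  have eE : e = (complex.Re e)%:C by move: e0; case: (e) => a b; rewrite ltcE /= => /andP[/eqP -> _].
  move: (e0); rewrite eE ltcR => e0'; have [C [FC CP]] := Fc _ e0'.
  exists (C, C) => //=; case=> x y /= [Cx Cy].
  by rewrite -ball_normE /= normE ltcR; exact: CP.
move=> /cauchy_cvg /cvg_ex [l Fl]; exists l => e e0.
have /Fl : nbhs l (ball l e%:C) by apply: nbhsx_ballx; rewrite ltcR.
by apply: filterS => x; rewrite -ball_normE /= normE ltcR nr_distC.
Qed.

End norm_topology.

Section rep_dimension.
Context (R : realType) (M : topologicalType) (H : ptopologicalType)
  (p : compact_group_bundle M H) (p_open : open_bundle p)
  (lambda : M -> probability (borel H) R)
  (lambda_haar : forall m : M, is_haar p m (lambda m))
  (A : cstar_algebra R) (iota : CH R H -> A)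
  (A_completion : is_group_cstar_algebra p lambda iota) (pi : irrep A).
Implicit Types (x y z : H) (f g h : CH R H).
Notation rint := (rint p lambda).
Notation cint := (cint p lambda).
Local Notation E := (irrep_space pi).
Local Notation m0 := (rep_base A_completion pi).
Implicit Types v w u : E.

Lemma rep_irreducible (F : set E) : closed_subspace F ->
  (forall f v, F v -> F (pi (iota f) v)) -> F = [set 0] \/ F = setT.
Proof.
move=> sF iF; apply: (irrep_irreducible sF) => a v _ Fv.
have [_ _ clF] := sF; apply: closedP_nr clF _ => e e0.
have [f fa] := rep_dense A_completion a v e0; exists (pi (iota f) v); first exact: iF.
by rewrite nr_distC.
Qed.

Section scalar.
Context (g : CH R H) (v0 : E).
Local Notation psi := (orbit_map p iota g v0).
Local Notation B := (coeff_form A_completion g v0).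
Let b (w : E) : R := complex.Re (B w w).

Let BDl (a : R[i]) u v w : B (a *: u + v) w = a * B u w + B v w.
Proof. exact: coeff_formDl. Qed.

Let BC u v : B v u = Num.conj (B u v).
Proof. exact: coeff_formC. Qed.

Let BZl (a : R[i]) u w : B (a *: u) w = a * B u w.
Proof.
have B0 : B 0 w = 0 by have := BDl (-1) 0 0 w; rewrite scaler0 addr0 mulN1r addNr.
by rewrite -[a *: u]addr0 BDl B0 addr0.
Qed.

Let BZr (a : R[i]) u w : B w (a *: u) = Num.conj a * B w u.
Proof. by rewrite BC BZl rmorphM /= -BC. Qed.

Let coeff_scale (r : R) w : b (r%:C *: w) = r ^+ 2 * b w.
Proof.
rewrite /b BZl BZr; have -> : Num.conj (r%:C : R[i]) = r%:C by rewrite -[LHS]/(r +i* - 0) oppr0.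
by rewrite mulrA -rmorphM; case: (B w w) => x y /=; rewrite mul0r subr0.
Qed.

Let sqr_cont w : continuous (fun x => nc (ip E w (psi x)) ^+ 2 : R^o).
Proof.
have cw : ccont (fun x => ip E w (psi x)) by exact: ip_psi_cont.
by have cn := cont_nc cw; move=> x; apply: cvgM; exact: cn.
Qed.

Lemma coeff_ge0 w : 0 <= b w.
Proof.
rewrite /b (coeff_formE lambda_haar A_completion g v0 w) /=.
rewrite -(rint_cst lambda_haar m0 0); apply: rint_le => //.
- exact: cont_cst.
- by move=> x _; exact: sqr_ge0.
Qed.

Lemma orbit_bounded : exists2 K : R, 0 < K & forall x, normr_of (psi x) <= K.
Proof.
by apply: (compact_nr_bounded (gb_compactH p)); exact: (orbit_cont p_open lambda_haar A_completion).
Qed.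

Lemma coeff_bound w w' (K : R) : (forall x, normr_of (psi x) <= K) ->
  nc (B w w') <= K ^+ 2 * (normr_of w * normr_of w').
Proof.
move=> KP; apply: (cint_nr_le lambda_haar).
  exact: (coeff_cont p_open lambda_haar A_completion).
move=> x _; rewrite ncM.
apply: le_trans (ler_pM (nc_ge0 _) (nc_ge0 _) (cauchy_schwarz _ _) (cauchy_schwarz _ _)) _.
have n1 := nr_ge0 w; have n2 := nr_ge0 w'; have n3 := nr_ge0 (psi x); have n4 := KP x.
rewrite [leLHS](_ : _ = normr_of (psi x) ^+ 2 * (normr_of w * normr_of w')); last by ring.
by rewrite ler_wpM2r ?mulr_ge0// ler_pXn2r// nnegrE//; apply: le_trans n4.
Qed.

Hypothesis gv0 : pi (iota g) v0 != 0.

Let S := [set b w | w in [set w : E | normr_of w <= 1]].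

Lemma coeff_has_sup : has_sup S.
Proof.
have [K K0 KP] := orbit_bounded; split; first by exists (b 0), 0 => //=; rewrite nr0.
exists (K ^+ 2) => _ [w /= w1 <-].
apply: le_trans (ler_norm _) _; apply: le_trans (le_nc_Re _) _.
apply: le_trans (coeff_bound w w KP) _; rewrite -[leRHS]mulr1 ler_wpM2l ?sqr_ge0//.
by rewrite -expr2 expr_le1 ?nr_ge0.
Qed.

Let l := sup S.

Let bl w : b w <= l * normr_of w ^+ 2.
Proof.
have [->|w0] := eqVneq w 0.
  by rewrite -(scale0r 0) (coeff_scale 0 0) expr0n mul0r scale0r nr0 expr0n mulr0.
have nw : 0 < normr_of w by rewrite nr_gt0.
have : S (b ((normr_of w)^-1%:C *: w)).
  exists ((normr_of w)^-1%:C *: w) => //=.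
  by rewrite nrZc nc_real ger0_norm ?invr_ge0 ?nr_ge0// mulVf// gt_eqF.
move/(ub_le_sup coeff_has_sup.2); rewrite coeff_scale.
by rewrite exprVn mulrC ler_pdivrMr ?exprn_gt0.
Qed.

Let l0 : 0 < l.
Proof.
pose w := pi (iota g) v0; have w0 : w != 0 by [].
have : 0 < b w.
  rewrite /b (coeff_formE lambda_haar A_completion g v0 w) /=.
  apply: (rint_gt0 lambda_haar (gb_proj_one p m0)).
  - exact: (@sqr_cont w).
  - by move=> x _; exact: sqr_ge0.
  rewrite (orbit1 p_open lambda_haar A_completion) -/w exprn_gt0// ipE nc_real.
  by rewrite normr_gt0 expf_neq0// gt_eqF// nr_gt0.
move=> b0; have := lt_le_trans b0 (bl w).
by rewrite pmulr_lgt0// exprn_gt0// nr_gt0.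
Qed.

(** Semidefinite because [l] is the largest value of [b] on the unit ball. Its null space is the
    eigenspace of the averaged operator for the eigenvalue [l]. *)
Let Q w w' := l%:C * ip E w w' - B w w'.

Let QDl (a : R[i]) u v w : Q (a *: u + v) w = a * Q u w + Q v w.
Proof. by rewrite /Q ipDl ipZl BDl; ring. Qed.

Let QC u v : Q v u = Num.conj (Q u v).
Proof.
rewrite /Q rmorphB rmorphM /= -ipC -BC; congr (_ * _ - _).
by rewrite -[RHS]/(l +i* - 0) oppr0.
Qed.

Let QRe w : complex.Re (Q w w) = l * normr_of w ^+ 2 - b w.
Proof. by rewrite /Q ipE -rmorphM raddfB. Qed.

Let Q0 w : 0 <= complex.Re (Q w w).
Proof. by rewrite QRe subr_ge0. Qed.

(** Near-maximizers of [b] in the unit ball. They generate a filter, and an ultrafilter refining it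
    will be shown to converge in norm. *)
Let Fe (e : R) : set E := [set w | normr_of w <= 1 /\ l - e < b w].

Let Fe_proper : ProperFilter (filter_from [set e : R | 0 < e] Fe).
Proof.
apply: filter_from_proper; last first.
  move=> e e0; have [_ [w /= w1 <-] we] := sup_adherent e0 coeff_has_sup.
  by exists w.
apply: filter_from_filter; first by exists 1; exact: ltr01.
move=> e e' /= e0 e'0; exists (Num.min e e'); first by rewrite /= lt_min e0.
move=> w [w1 we]; split; split => //; apply: le_lt_trans we; rewrite lerD2l lerN2 ge_min lexx ?orbT//.
Qed.

(* A maximizer of the form exists because the form is a uniform limit of forms of finite rank. *)
Let maximizer : exists2 w : E, w != 0 & complex.Re (Q w w) = 0.
Proof.
have [U [uU FU]] := ultraFilterLemma Fe_proper.
have PU := @ultra_proper _ _ uU.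
have UFe e : 0 < e -> U (Fe e) by move=> e0; apply: FU; exists e.
have [K K0 KP] := orbit_bounded.
have [|w0 w0P] := @nr_filter_cvg R E U PU.
  move=> e e0.
  (* For the difference [u] of two near-maximizers, [b u <= 2 * eta] and [Re (Q u u) <= 4 * eta]
     give [l * |u|^2 <= 6 * eta], which is less than [7 * eta = l * e^2]. *)
  pose eta := l * e ^+ 2 / 7.
  have eta0 : 0 < eta by rewrite /eta !(mulr_gt0, exprn_gt0)// invr_gt0; lra.
  (* Since [|u| <= 2], the squared coefficient of [u] oscillates by at most [8 * K * d] on [V]. *)
  pose d := eta / (8 * K); have d0 : 0 < d by rewrite divr_gt0// mulr_gt0.
  pose V x := [set y | normr_of (psi y - psi x) < d].
  have nV x : nbhs x (V x).
    by have /cont_nrP := orbit_cont p_open lambda_haar A_completion (g:=g) (v:=v0); apply.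
  have [n [a [t [a0 a1 tm rs]]]] := riemann_sum lambda_haar m0 (ltW eta0) nV.
  (* Chosen so that [(4 * e2)^2 <= eta], where [4 * e2] bounds the coefficients of [u] at the
     nodes. *)
  pose e2 := Num.min 1 (eta / 16).
  have e20 : 0 < e2 by rewrite lt_min ltr01 divr_gt0.
  have UK (h : R[i] -> R) i : (forall c : R[i], `|h c| <= nc c) -> U [set w | `|h (ip E w (psi (t i)))| <= K].
    move=> hn; apply: (@filterS _ U _ _ _ _ (UFe 1 ltr01)) => w [w1 _] /=.
    apply: le_trans (hn _) _; apply: le_trans (cauchy_schwarz _ _) _.
    by rewrite -[leRHS]mul1r ler_pM ?nr_ge0.
  (* The finitely many coefficients at the nodes converge along [U], so they nearly agree for any
     two vectors of one member of [U]. *)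
  have /choice[r rP] i := ultra_bounded uU (UK (@complex.Re R) i (@le_nc_Re R)).
  have /choice[s sP] i := ultra_bounded uU (UK (@complex.Im R) i (@le_nc_Im R)).
  have Ur : U [set w | forall i, `|complex.Re (ip E w (psi (t i))) - r i| < e2].
    by apply: filter_forall => i; exact: rP.
  have Us : U [set w | forall i, `|complex.Im (ip E w (psi (t i))) - s i| < e2].
    by apply: filter_forall => i; exact: sP.
  exists (Fe eta `&` ([set w | forall i, `|complex.Re (ip E w (psi (t i))) - r i| < e2] `&`
     [set w | forall i, `|complex.Im (ip E w (psi (t i))) - s i| < e2])).
  split; first by apply: filterI; [exact: UFe|exact: filterI].
  move=> w w' [[w1 wb] [wr ws]] [[w1' wb'] [wr' ws']].
  set u := w - w'.
  have u2 : normr_of u <= 2 by apply: le_trans (nrB _ _) _; lra.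
  have ui i : nc (ip E u (psi (t i))) <= 4 * e2.
    rewrite ipBl; apply: le_trans (nr_le_ReIm _) _; rewrite !raddfB /=.
    have := wr i; have := wr' i; have := ws i; have := ws' i.
    rewrite !ltr_norml => /andP[? ?] /andP[? ?] /andP[? ?] /andP[? ?].
    have h1 : `|complex.Re (ip E w (psi (t i))) - complex.Re (ip E w' (psi (t i)))| <= 2 * e2.
      by rewrite ler_norml; apply/andP; split; lra.
    have h2 : `|complex.Im (ip E w (psi (t i))) - complex.Im (ip E w' (psi (t i)))| <= 2 * e2.
      by rewrite ler_norml; apply/andP; split; lra.
    lra.
  have osc x y : V x y -> nc (ip E u (psi y) * ip E (psi y) u - ip E u (psi x) * ip E (psi x) u) <= eta.
    move=> Vxy.
    have -> : ip E u (psi y) * ip E (psi y) u - ip E u (psi x) * ip E (psi x) u =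
       ip E u (psi y - psi x) * ip E (psi y) u + ip E u (psi x) * ip E (psi y - psi x) u.
      by rewrite ipBl ipBr; ring.
    apply: le_trans (ncD _ _) _; rewrite !ncM.
    have c1 := cauchy_schwarz u (psi y - psi x); have c2 := cauchy_schwarz (psi y) u.
    have c3 := cauchy_schwarz u (psi x); have c4 := cauchy_schwarz (psi y - psi x) u.
    have nd := nr_ge0 (psi y - psi x); have nu := nr_ge0 u.
    have i1 : nc (ip E u (psi y - psi x)) <= 2 * d.
      by apply: le_trans c1 _; apply: ler_pM => //; exact: ltW.
    have i2 : nc (ip E (psi y) u) <= K * 2 by apply: le_trans c2 _; apply: ler_pM; rewrite ?nr_ge0.
    have i3 : nc (ip E u (psi x)) <= 2 * K by apply: le_trans c3 _; apply: ler_pM; rewrite ?nr_ge0.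
    have i4 : nc (ip E (psi y - psi x) u) <= d * 2.
      by apply: le_trans c4 _; apply: ler_pM => //; exact: ltW.
    apply: le_trans (lerD (ler_pM (nc_ge0 _) (nc_ge0 _) i1 i2) (ler_pM (nc_ge0 _) (nc_ge0 _) i3 i4)) _.
    have -> : 2 * d * (K * 2) + 2 * K * (d * 2) = d * (8 * K) by ring.
    by rewrite /d divfK// gt_eqF// mulr_gt0.
  have cu : ccont (fun x => ip E u (psi x) * ip E (psi x) u).
    exact: (coeff_cont p_open lambda_haar A_completion).
  have rsu := rs _ cu osc; rewrite -/(B u u) in rsu.
  have bu : b u <= 2 * eta.
    apply: le_trans (ler_norm _) _; apply: le_trans (le_nc_Re _) _.
    apply: le_trans (nc_triD _ (\sum_i (a i)%:C * (ip E u (psi (t i)) * ip E (psi (t i)) u))) _.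
    suff : nc (\sum_i (a i)%:C * (ip E u (psi (t i)) * ip E (psi (t i)) u)) <= eta by lra.
    apply: le_trans (nc_sum _ _ _) _; rewrite -[leRHS]mul1r -a1 mulr_suml.
    apply: ler_sum => i _; rewrite ncM nc_real ger0_norm// ler_wpM2l//.
    rewrite [ip E (psi (t i)) u]ipC ncCK nc_real ger0_norm ?sqr_ge0//.
    apply: (@le_trans _ _ ((4 * e2) ^+ 2)).
      by rewrite ler_pXn2r// nnegrE ?nc_ge0// mulr_ge0// ltW.
    have e2a : e2 <= 1 by rewrite ge_min lexx.
    have e2b : e2 <= eta / 16 by rewrite ge_min lexx orbT.
    have : e2 * e2 <= 1 * (eta / 16) by apply: ler_pM => //; exact: ltW.
    by rewrite exprMn !expr2; lra.
  have qu : complex.Re (Q u u) <= 4 * eta.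
    have hq v : normr_of v <= 1 -> l - eta < b v -> complex.Re (Q v v) <= eta.
      move=> v1 vb; rewrite QRe; have : l * normr_of v ^+ 2 <= l.
        by rewrite -[leRHS]mulr1 ler_wpM2l ?(ltW l0)// expr_le1 ?nr_ge0.
      by lra.
    apply: le_trans (semidefinite_parallelogram QDl QC Q0 w (- w')) _.
    have -> : Q (- w') (- w') = Q w' w'.
      by rewrite /Q -[- w']scaleN1r ipZl ipZr BZl BZr rmorphN rmorph1; ring.
    by have := hq _ w1 wb; have := hq _ w1' wb'; lra.
  move: qu; rewrite QRe => qu.
  have : l * normr_of u ^+ 2 < l * e ^+ 2.
    by rewrite (_ : l * e ^+ 2 = 7 * eta); [lra|rewrite /eta; field].
  rewrite ltr_pM2l// ltr_pXn2r ?nnegrE ?nr_ge0//; exact: ltW.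
have lp := l0.
have near_w0 e : 0 < e -> exists w, [/\ normr_of w <= 1, l - e < b w & normr_of (w - w0) < e].
  move=> e0; have Ue : U (Fe e `&` [set w | normr_of (w - w0) < e]).
    by apply: filterI; [exact: UFe|exact: w0P].
  by have [w [[w1 wb] ww0]] := @filter_ex _ U PU _ Ue; exists w.
exists w0.
  (* If the limit were 0, there would be a near-maximizer of norm below [1/2], with [b] at most
     [l / 4] and yet above [l - l / 4]. *)
  apply/eqP => w00; pose e := Num.min (1/2) (l / 4).
  have e0 : 0 < e by rewrite lt_min; apply/andP; split; [lra|rewrite divr_gt0].
  have [w [_ wb]] := near_w0 e e0; rewrite w00 subr0 => we.
  have ea : e <= 1/2 by rewrite ge_min lexx.
  have eb : e <= l / 4 by rewrite ge_min lexx orbT.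
  have := bl w; have : normr_of w * normr_of w <= 1/2 * (1/2).
    by apply: ler_pM; rewrite ?nr_ge0//; lra.
  rewrite expr2 => /(ler_wpM2l (ltW l0)); lra.
apply/eqP; rewrite eq_le Q0 andbT; apply/ler_addgt0Pr => e e0; rewrite add0r.
(* The parallelogram bound yields [2 * e'] from [w] and [2 * l * e'] from [w0 - w]. *)
pose e' := Num.min 1 (e / (2 + 2 * l)).
have e'0 : 0 < e' by rewrite lt_min ltr01 divr_gt0//; lra.
have [w [w1 wb ww0]] := near_w0 e' e'0.
have e'1 : e' <= 1 by rewrite ge_min lexx.
have e'e : e' * (2 + 2 * l) <= e by rewrite -ler_pdivlMr ?ge_min ?lexx ?orbT//; lra.
rewrite -(subrK w w0) addrC; apply: le_trans (semidefinite_parallelogram QDl QC Q0 _ _) _.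
have h1 : complex.Re (Q w w) <= e'.
  rewrite QRe; have : l * normr_of w ^+ 2 <= l.
    by rewrite -[leRHS]mulr1 ler_wpM2l ?(ltW l0)// expr_le1 ?nr_ge0.
  by lra.
have h2 : complex.Re (Q (w0 - w) (w0 - w)) <= l * e'.
  rewrite QRe; have := coeff_ge0 (w0 - w).
  have : l * normr_of (w0 - w) ^+ 2 <= l * e'.
    rewrite ler_wpM2l ?(ltW l0)// expr2 nr_distC -[leRHS]mul1r; apply: ler_pM; rewrite ?nr_ge0//; lra.
  by lra.
lra.
Qed.

(** Schur's lemma: the null space of [Q] is closed and invariant, and by [maximizer] it is not zero,
    so it is everything. *)
Lemma coeff_form_scalar : exists2 r : R, 0 < r & forall w w', B w w' = r%:C * ip E w w'.
Proof.
exists l => //; pose Z := [set w : E | forall w', Q w w' = 0].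
have [K K0 KP] := orbit_bounded.
have sZ : closed_subspace Z.
  have Q00 w : Q 0 w = 0 by have := QDl (-1) 0 0 w; rewrite scaler0 addr0 mulN1r addNr.
  split => [//|a u v Zu Zv w|].
    by rewrite QDl Zu Zv mulr0 addr0.
  apply: closed_nrP => w h w'; apply: nc_le0_eq0 => e e0.
  pose C := (l + K ^+ 2) * (normr_of w' + 1).
  have nw' := nr_ge0 w'.
  have C0 : 0 < C by rewrite mulr_gt0//; [rewrite addr_gt0// exprn_gt0|lra].
  have [|u Zu wu] := h (e / C); first by rewrite divr_gt0.
  have -> : Q w w' = Q (w - u) w'.
    by rewrite [w - u]addrC -scaleN1r QDl Zu mulr0 add0r.
  apply: le_trans (ncB _ _) _; rewrite ncM nc_real gtr0_norm//.
  have := cauchy_schwarz (w - u) w'; have := coeff_bound (w - u) w' KP.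
  move=> h1 /(ler_wpM2l (ltW l0)) h2; apply: le_trans (lerD h2 h1) _.
  rewrite -mulrDl; apply: (@le_trans _ _ ((l + K ^+ 2) * ((e / C) * (normr_of w' + 1)))).
    apply: ler_wpM2l; first by rewrite addr_ge0 ?sqr_ge0// ltW.
    by apply: ler_pM; rewrite ?nr_ge0 ?(ltW wu)//; lra.
  by rewrite mulrCA -/C divfK// gt_eqF.
have iZ f w : Z w -> Z (pi (iota f) w).
  move=> Zw w'; have := Zw (pi (iota (star_elt p f)) w'); rewrite /Q.
  rewrite (coeff_form_rep p_open lambda_haar A_completion) => <-; congr (_ * _ - _).
  by rewrite [RHS]ipC (rep_star A_completion) -ipC.
have [Z0|ZT] := rep_irreducible sZ iZ.
  have [w w0 qw] := maximizer.
  have : Z w by move=> w'; exact: (semidefinite_null QDl QC Q0).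
  by rewrite Z0 => /= ww; rewrite ww eqxx in w0.
move=> w w'; have : Z w by rewrite ZT.
by move=> /(_ w') /eqP; rewrite subr_eq0 eq_sym => /eqP.
Qed.

End scalar.
End rep_dimension.

(** * Finite dimension *)

Section orthonormal.
Context (R : realType) (E : hilbert R).
Implicit Types u v w : E.

(** An orthonormal family; it is a basis only together with [onb_complete]. *)
Definition onb n (e : 'I_n -> E) := forall i j, ip E (e i) (e j) = (i == j)%:R.

Definition onb_complete n (e : 'I_n -> E) := forall v, v = \sum_i ip E v (e i) *: e i.

Lemma onb_ip_sum n (e : 'I_n -> E) (c : 'I_n -> R[i]) j : onb e ->
  ip E (\sum_i c i *: e i) (e j) = c j.
Proof.
move=> oe; rewrite ip_suml (bigD1 j) //= ipZl oe eqxx mulr1 big1 ?addr0//.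
by move=> i ij; rewrite ipZl oe (negbTE ij) mulr0.
Qed.

Lemma bessel n (e : 'I_n -> E) u : onb e ->
  \sum_i nc (ip E u (e i)) ^+ 2 <= normr_of u ^+ 2.
Proof.
move=> oe; pose s := \sum_i ip E u (e i) *: e i.
have us : ip E u s = (\sum_i nc (ip E u (e i)) ^+ 2)%:C.
  rewrite ip_sumr rmorph_sum; apply: eq_bigr => i _.
  by rewrite ipZr mulrC ncCK.
have ss : normr_of s ^+ 2 = \sum_i nc (ip E u (e i)) ^+ 2.
  apply: (@complexI R); rewrite -ipE [in RHS]rmorph_sum {2}/s ip_sumr; apply: eq_bigr => i _.
  by rewrite ipZr onb_ip_sum// mulrC ncCK.
have := sqr_ge0 (normr_of (u - s)); rewrite nr_sqrB us ss /=; lra.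
Qed.

(** An orthonormal family of maximal length in [F] spans [F], since a Gram-Schmidt step would
    otherwise lengthen it. *)
Lemma onb_exists (F : set E) (N : nat) : F 0 ->
  (forall (a : R[i]) u v, F u -> F v -> F (a *: u + v)) ->
  (forall n (e : 'I_n -> E), onb e -> (n <= N)%N) ->
  exists d (e : 'I_d -> E), [/\ onb e, forall i, F (e i) &
    forall v, F v -> v = \sum_i ip E v (e i) *: e i].
Proof.
move=> F0 FD bN; pose P n := `[< exists e : 'I_n -> E, onb e /\ forall i, F (e i) >].
have P0 : exists n, P n.
  by exists 0%N; apply/asboolP; exists (fun=> 0); split=> -[].
have PN n : P n -> (n <= N)%N by move=> /asboolP[e [oe _]]; exact: bN oe.
case: (ex_maxnP P0 PN) => d /asboolP[e [oe eF]] dmax.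
exists d, e; split => // v Fv; apply/eqP; rewrite -subr_eq0; apply/negP => /negP.
set s := \sum_i _; have Fs : F s.
  rewrite /s; elim/big_rec: _ => [//|i w _ Fw]; exact: FD.
set u := v - _ => u0; have Fu : F u by rewrite /u addrC -scaleN1r; exact: FD.
have ue j : ip E u (e j) = 0 by rewrite ipBl onb_ip_sum// subrr.
have nu : 0 < normr_of u by rewrite nr_gt0.
pose u' := (normr_of u)^-1%:C *: u.
have Fu' : F u' by rewrite /u' -[_ *: _]addr0; exact: FD.
have u'e j : ip E u' (e j) = 0 by rewrite ipZl ue mulr0.
have u'u' : ip E u' u' = 1.
  rewrite ipE nrZc nc_real ger0_norm ?invr_ge0 ?nr_ge0// mulVf ?gt_eqF//.
  by rewrite expr1n.
suff : P d.+1 by move=> /dmax; rewrite ltnn.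
apply/asboolP; exists (fun i => if unlift ord_max i is Some j then e j else u').
split; last by move=> i; case: unliftP.
move=> i j; case: unliftP => [i'|] ->; case: unliftP => [j'|] ->.
- by rewrite oe (inj_eq (@lift_inj _ _)).
- by rewrite ipC u'e rmorph0 eq_sym (negbTE (neq_lift _ _)).
- by rewrite u'e (negbTE (neq_lift _ _)).
- by rewrite u'u' eqxx.
Qed.

Section criterion.
Context (d : nat) (e : 'I_d -> E).
Hypotheses (oe : onb e) (ce : onb_complete e).

(** The sum of all [|<e_i, e'_j>|^2] equals [n] by Parseval for [e] and is at most [d] by Bessel for
    [e']. *)
Lemma onb_leq n (e' : 'I_n -> E) : onb e' -> (n <= d)%N.
Proof.
move=> oe'; have nr1 k (b : 'I_k -> E) i : onb b -> normr_of (b i) ^+ 2 = 1.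
  by move=> ob; apply: (@complexI R); rewrite -ipE ob eqxx.
rewrite -(ler_nat R).
have -> : n%:R = \sum_(j < n) \sum_i nc (ip E (e i) (e' j)) ^+ 2 :> R.
  rewrite (eq_bigr (fun=> 1)) ?sumr_const ?card_ord// => j _.
  rewrite -(nr1 _ _ j oe'); apply: (@complexI R); rewrite -ipE {3}(ce (e' j)) ip_sumr rmorph_sum.
  by apply: eq_bigr => i _; rewrite ipZr [ip E (e i) _]ipC nc_conj mulrC ncCK.
rewrite exchange_big /=; apply: (@le_trans _ _ (\sum_(i < d) 1)).
  by apply: ler_sum => i _; rewrite -(nr1 _ _ i oe); exact: bessel.
by rewrite sumr_const card_ord.
Qed.

Lemma subspace_orthogonal (F : set E) : F 0 ->
  (forall (a : R[i]) u v, F u -> F v -> F (a *: u + v)) -> F <> setT ->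
  exists2 w, w != 0 & forall v, F v -> ip E v w = 0.
Proof.
move=> F0 FD FT; have [n [b [ob bF cb]]] := onb_exists F0 FD onb_leq.
have [v Fv] : exists v, ~ F v.
  by apply: contrapT => h; apply: FT; apply/seteqP; split=> // v _; apply: contrapT => Fv; apply: h; exists v.
pose s := \sum_i ip E v (b i) *: b i.
have Fs : F s by rewrite /s; elim/big_rec: _ => [//|i w _ Fw]; exact: FD.
exists (v - s).
  by apply/eqP => /eqP; rewrite subr_eq0 => /eqP vs; apply: Fv; rewrite vs.
move=> u /cb ->; rewrite ip_suml big1// => i _.
by rewrite ipZl [ip E (b i) (v - s)]ipC ipBl onb_ip_sum// subrr conjC0 mulr0.
Qed.

(** A proper invariant subspace has a nonzero vector [w] orthogonal to it, and all coefficients of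
    its elements against [w] vanish. *)
Lemma coefficient_irreducible (I : Type) (D : set I) (T : I -> E -> E) :
  (forall v w, (forall i, D i -> ip E (T i v) w = 0) -> v = 0 \/ w = 0) ->
  topologically_irreducible D T.
Proof.
move=> h F [F0 FD _] iF; have [->|FT] := EM (F = setT); first by right.
have [w w0 wF] := subspace_orthogonal F0 FD FT.
left; apply/seteqP; split=> [v Fv|_ ->//] /=.
have vw i : D i -> ip E (T i v) w = 0 by move=> Di; apply: wF; exact: iF.
by have [//|wE] := h v w vw; rewrite wE eqxx in w0.
Qed.

End criterion.

End orthonormal.

Section rep_finite.
Context (R : realType) (M : topologicalType) (H : ptopologicalType)
  (p : compact_group_bundle M H) (p_open : open_bundle p)
  (lambda : M -> probability (borel H) R)
  (lambda_haar : forall m : M, is_haar p m (lambda m))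
  (A : cstar_algebra R) (iota : CH R H -> A)
  (A_completion : is_group_cstar_algebra p lambda iota) (pi : irrep A).
Implicit Types (x y z : H) (f g h : CH R H).
Local Notation E := (irrep_space pi).
Implicit Types v w u : E.

(** A trace estimate: [n] orthonormal vectors contribute [n * r] to the trace of the averaged
    operator, whereas Bessel under the integral bounds their contribution by [K ^+ 2]. *)
Lemma rep_finite_dim : exists d (e : 'I_d -> E), onb e /\ onb_complete e.
Proof.
have [g [v0 gv0]] := rep_nonzero A_completion pi.
have [r r0 rP] := coeff_form_scalar p_open lambda_haar A_completion gv0.
have [K K0 KP] := orbit_bounded p_open lambda_haar A_completion g v0.
have [N Nr] : exists N : nat, K ^+ 2 / r < N%:R.
  exists (Num.bound (K ^+ 2 / r)); apply: le_lt_trans (archi_boundP _).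
    exact: lexx.
  by rewrite divr_ge0 ?sqr_ge0// ltW.
suff bN n (e : 'I_n -> E) : onb e -> (n <= N)%N.
  have [||d [e [oe _ ce]]] := @onb_exists _ _ setT N _ _ bN; [by []|by []|].
  by exists d, e; split=> // v; exact: ce.
move=> oe.
suff : n%:R * r <= K ^+ 2.
  by rewrite -ler_pdivlMr// => /le_lt_trans/(_ Nr); rewrite ltr_nat => /ltnW.
have cc i : ccont (fun x => ip E (e i) (orbit_map p iota g v0 x) * ip E (orbit_map p iota g v0 x) (e i)).
  exact: coeff_cont.
have sumE : \sum_i coeff_form A_completion g v0 (e i) (e i) = (n%:R * r)%:C.
  rewrite (eq_bigr (fun=> r%:C)); last by move=> i _; rewrite rP oe eqxx mulr1.
  by rewrite sumr_const card_ord -rmorphMn mulr_natl.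
have -> : n%:R * r = nc (\sum_i coeff_form A_completion g v0 (e i) (e i)).
  by rewrite sumE nc_real ger0_norm// mulr_ge0// ltW.
rewrite -(cint_sum lambda_haar _ _ _ cc); apply: (cint_nr_le lambda_haar).
  exact: ccont_sum.
move=> x _; set u := orbit_map _ _ _ _ _.
rewrite (eq_bigr (fun i => (nc (ip E u (e i)) ^+ 2)%:C)); last first.
  by move=> i _; rewrite mulrC [ip E (e i) u]ipC ncCK.
rewrite -rmorph_sum nc_real ger0_norm; last by apply: sumr_ge0 => i _; exact: sqr_ge0.
apply: le_trans (bessel u oe) _.
by rewrite ler_pXn2r ?nnegrE ?nr_ge0 ?(ltW K0)//; exact: KP.
Qed.

End rep_finite.

(** * Deforming a matrix representation to nearby fibers *)

Section matrix_norm.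
Context (R : realType).
Local Notation C := R[i].

(** The entrywise l^1 norm: submultiplicative, dominating every entry, and continuous as soon as the
    entries are. *)
Definition mxn m n (A : 'M[C]_(m, n)) : R := \sum_i \sum_j nc (A i j).

Lemma mxn_ge0 m n (A : 'M[C]_(m, n)) : 0 <= mxn A.
Proof. by apply: sumr_ge0 => i _; apply: sumr_ge0 => j _; exact: nc_ge0. Qed.

Lemma le_mxn m n (A : 'M[C]_(m, n)) i j : nc (A i j) <= mxn A.
Proof.
rewrite /mxn (bigD1 i) //= (bigD1 j) //= -addrA lerDl addr_ge0//.
  by apply: sumr_ge0 => k _; exact: nc_ge0.
by apply: sumr_ge0 => k _; apply: sumr_ge0 => l _; exact: nc_ge0.
Qed.

Lemma mxn0 m n : mxn (0 : 'M[C]_(m, n)) = 0.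
Proof. by rewrite /mxn big1// => i _; rewrite big1// => j _; rewrite mxE nc0. Qed.

Lemma mxn_eq0 m n (A : 'M[C]_(m, n)) : mxn A = 0 -> A = 0.
Proof.
move=> A0; apply/matrixP => i j; rewrite mxE; apply: nc_eq0; apply/eqP.
by rewrite eq_le nc_ge0 andbT -A0 le_mxn.
Qed.

Lemma mxnD m n (A B : 'M[C]_(m, n)) : mxn (A + B) <= mxn A + mxn B.
Proof.
rewrite /mxn -big_split /=; apply: ler_sum => i _; rewrite -big_split /=.
by apply: ler_sum => j _; rewrite mxE; exact: ncD.
Qed.

Lemma mxnN m n (A : 'M[C]_(m, n)) : mxn (- A) = mxn A.
Proof. by apply: eq_bigr => i _; apply: eq_bigr => j _; rewrite mxE ncN. Qed.

Lemma mxnB m n (A B : 'M[C]_(m, n)) : mxn (A - B) <= mxn A + mxn B.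
Proof. by rewrite -(mxnN B); exact: mxnD. Qed.

Lemma mxnM m n k (A : 'M[C]_(m, n)) (B : 'M[C]_(n, k)) : mxn (A *m B) <= mxn A * mxn B.
Proof.
rewrite /mxn mulr_suml; apply: ler_sum => i _.
apply: (@le_trans _ _ (\sum_j \sum_l nc (A i l) * nc (B l j))).
  apply: ler_sum => j _; rewrite mxE; apply: le_trans (nc_sum _ _ _) _.
  by apply: ler_sum => l _; rewrite ncM.
rewrite exchange_big mulr_suml /=; apply: ler_sum => l _.
rewrite -mulr_sumr ler_wpM2l ?nc_ge0//.
rewrite [leRHS](bigD1 l) //= lerDl; apply: sumr_ge0 => l' _.
by apply: sumr_ge0 => j _; exact: nc_ge0.
Qed.

(** A row vector killed by [A] is reproduced up to sign by [A - 1], which shrinks norms strictly. *)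
Lemma near1_unitmx n (A : 'M[C]_n) : mxn (A - 1%:M) < 1 -> A \in unitmx.
Proof.
move=> A1; rewrite -row_free_unit -kermx_eq0; apply/negPn/negP => /rowV0Pn[v].
move=> /sub_kermxP vA v0.
have : mxn v <= mxn v * mxn (A - 1%:M).
  by rewrite -{1}(mxnN v) (_ : - v = v *m (A - 1%:M)) ?mxnM// mulmxBr vA mulmx1 add0r.
have nv : 0 < mxn v by rewrite lt_neqAle mxn_ge0 andbT eq_sym; apply: contraNneq v0 => /mxn_eq0 ->.
by rewrite -ler_pdivrMl// mulVf ?gt_eqF// => /le_lt_trans/(_ A1); rewrite ltxx.
Qed.

Definition mcont (T : topologicalType) m n (F : T -> 'M[C]_(m, n)) :=
  forall i j, ccont (fun x => F x i j).

Lemma mcontM (T : topologicalType) m n k (F : T -> 'M[C]_(m, n)) (G : T -> 'M[C]_(n, k)) :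
  mcont F -> mcont G -> mcont (fun x => F x *m G x).
Proof.
move=> cF cG i j; under eq_fun do rewrite mxE.
by apply: ccont_sum => l; apply: ccontM; [exact: cF|exact: cG].
Qed.

Lemma mcontD (T : topologicalType) m n (F G : T -> 'M[C]_(m, n)) :
  mcont F -> mcont G -> mcont (fun x => F x + G x).
Proof.
move=> cF cG i j; under eq_fun do rewrite mxE.
by apply: ccontD; [exact: cF|exact: cG].
Qed.

Lemma mcontN (T : topologicalType) m n (F : T -> 'M[C]_(m, n)) :
  mcont F -> mcont (fun x => - F x).
Proof. by move=> cF i j; under eq_fun do rewrite mxE; apply: ccontN; exact: cF. Qed.

Lemma mcontB (T : topologicalType) m n (F G : T -> 'M[C]_(m, n)) :
  mcont F -> mcont G -> mcont (fun x => F x - G x).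
Proof. by move=> cF cG; apply: mcontD; [exact: cF|apply: mcontN; exact: cG]. Qed.

Lemma mcont_cst (T : topologicalType) m n (A : 'M[C]_(m, n)) : mcont (fun _ : T => A).
Proof. by move=> i j; exact: ccont_cst. Qed.

Lemma mcont_comp (S T : topologicalType) m n (f : S -> T) (F : T -> 'M[C]_(m, n)) :
  continuous f -> mcont F -> mcont (fun x => F (f x)).
Proof. by move=> cf cF i j; exact: (ccont_comp cf (cF i j)). Qed.

Lemma mcont_mxn (T : topologicalType) m n (F : T -> 'M[C]_(m, n)) : mcont F ->
  continuous (fun x => mxn (F x) : R^o).
Proof.
move=> cF.
have csum (I : Type) (r : seq I) (h : I -> T -> R^o) :
    (forall i, continuous (h i)) -> continuous (fun x => \sum_(i <- r) h i x : R^o).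
  move=> ch; elim: r => [|i r IHr].
    by under eq_fun do rewrite big_nil; exact: cont_cst.
  by under eq_fun do rewrite big_cons; move=> x; apply: cvgD; [exact: ch|exact: IHr].
by rewrite /mxn; apply: (csum _ _ (fun i x => \sum_j nc (F x i j))) => i; apply: (csum _ _ (fun j x => nc (F x i j))) => j; exact: cont_nc (cF i j).
Qed.

End matrix_norm.

(** * Integrals of matrix-valued functions *)

Section matrix_integral.
Context (R : realType) (M : topologicalType) (H : ptopologicalType)
  (p : compact_group_bundle M H) (lambda : M -> probability (borel H) R)
  (lambda_haar : forall m : M, is_haar p m (lambda m)).
Implicit Types (x y z : H).
Notation rint := (rint p lambda).
Notation cint := (cint p lambda).
Local Notation mul := (gb_mul p).
Local Notation C := R[i].

Definition imx (m : M) a b (F : H -> 'M[C]_(a, b)) : 'M[C]_(a, b) :=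
  \matrix_(i, j) cint m (fun x => F x i j).

Lemma eq_imx m a b (F G : H -> 'M[C]_(a, b)) : (forall x, p x = m -> F x = G x) -> imx m F = imx m G.
Proof. by move=> FG; apply/matrixP => i j; rewrite !mxE; apply: eq_cint => x /FG ->. Qed.

Lemma imxD m a b (F G : H -> 'M[C]_(a, b)) : mcont F -> mcont G ->
  imx m (fun x => F x + G x) = imx m F + imx m G.
Proof.
move=> cF cG; apply/matrixP => i j; rewrite !mxE -cintD; [|exact: cF|exact: cG].
by apply: eq_cint => x _; rewrite mxE.
Qed.

Lemma imxB m a b (F G : H -> 'M[C]_(a, b)) : mcont F -> mcont G ->
  imx m (fun x => F x - G x) = imx m F - imx m G.
Proof.
move=> cF cG; apply/matrixP => i j; rewrite !mxE -cintB; [|exact: cF|exact: cG].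
by apply: eq_cint => x _; rewrite !mxE.
Qed.

Lemma imx_cst m a b (A : 'M[C]_(a, b)) : imx m (fun=> A) = A.
Proof. by apply/matrixP => i j; rewrite mxE (cint_cst lambda_haar). Qed.

Lemma imxMl m a b c (A : 'M[C]_(a, b)) (F : H -> 'M[C]_(b, c)) : mcont F ->
  imx m (fun x => A *m F x) = A *m imx m F.
Proof.
move=> cF; apply/matrixP => i j; rewrite !mxE.
rewrite (@eq_cint _ _ _ _ _ _ _ (fun x => \sum_k A i k * F x k j)); last by move=> x _; rewrite mxE.
rewrite (cint_sum lambda_haar); last first.
  by move=> k; apply: ccontM; [exact: ccont_cst|exact: cF].
by apply: eq_bigr => k _; rewrite mxE cintZ; last exact: cF.
Qed.

Lemma imxMr m a b c (A : 'M[C]_(b, c)) (F : H -> 'M[C]_(a, b)) : mcont F ->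
  imx m (fun x => F x *m A) = imx m F *m A.
Proof.
move=> cF; apply/matrixP => i j; rewrite !mxE.
rewrite (@eq_cint _ _ _ _ _ _ _ (fun x => \sum_k A k j * F x i k)); last first.
  by move=> x _; rewrite mxE; apply: eq_bigr => k _; rewrite mulrC.
rewrite (cint_sum lambda_haar); last first.
  by move=> k; apply: ccontM; [exact: ccont_cst|exact: cF].
by apply: eq_bigr => k _; rewrite mxE mulrC cintZ; last exact: cF.
Qed.

Lemma imx_translate m x a b (F G : H -> 'M[C]_(a, b)) : p x = m -> mcont F ->
  (forall y, p y = m -> G y = F (mul x y)) -> imx m G = imx m F.
Proof.
move=> xm cF GF; apply/matrixP => i j; rewrite !mxE.
by apply: (cint_translate lambda_haar xm (cF i j)) => y /GF ->.
Qed.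

Lemma imx_translater m x a b (F G : H -> 'M[C]_(a, b)) : p x = m -> mcont F -> mcont G ->
  (forall y, p y = m -> G y = F (mul y x)) -> imx m G = imx m F.
Proof.
move=> xm cF cG GF; apply/matrixP => i j; rewrite !mxE.
by apply: (cint_translater lambda_haar xm (cF i j) (cG i j)) => y /GF ->.
Qed.

Lemma imx_norm m a b (F : H -> 'M[C]_(a, b)) (K : R) : mcont F ->
  (forall x, p x = m -> mxn (F x) <= K) -> mxn (imx m F) <= K.
Proof.
move=> cF FK.
have rsum (I : Type) (r : seq I) (h : I -> H -> R^o) : (forall i, continuous (h i)) ->
    continuous (fun x => \sum_(i <- r) h i x : R^o) /\
    rint m (fun x => \sum_(i <- r) h i x) = \sum_(i <- r) rint m (h i).
  move=> ch; elim: r => [|i r [IHc IHr]].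
    split; first by under eq_fun do rewrite big_nil; exact: cont_cst.
    by under [fun x => _]eq_fun do rewrite big_nil; rewrite big_nil (rint_cst lambda_haar).
  split; first by under eq_fun do rewrite big_cons; move=> x; apply: cvgD; [exact: ch|exact: IHc].
  by under [fun x => _]eq_fun do rewrite big_cons; rewrite rintD// IHr big_cons.
have cn i j : continuous (fun x => nc (F x i j) : R^o) by exact: cont_nc (cF i j).
apply: (@le_trans _ _ (rint m (fun x => mxn (F x)))).
  have ci i := (rsum _ (index_enum _) _ (cn i)).1.
  rewrite /mxn (rsum _ _ _ ci).2; apply: ler_sum => i _.
  rewrite (rsum _ _ _ (cn i)).2; apply: ler_sum => j _.
  by rewrite mxE; exact: (cint_nr lambda_haar _ (cF i j)).
rewrite -(rint_cst lambda_haar m K); apply: rint_le; [exact: mcont_mxn|exact: cont_cst|exact: FK].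
Qed.

End matrix_integral.

Section geometric_limits.
Context (R : realType).

(* The limit is squeezed between the monotone sequences [u n -+ C / (1 - q) q ^+ n]. *)
Lemma real_geometric_limit (u : nat -> R) (C q : R) : 0 <= C -> 0 <= q < 1 ->
  (forall n, `|u n.+1 - u n| <= C * q ^+ n) ->
  exists l : R, forall n, `|u n - l| <= C / (1 - q) * q ^+ n.
Proof.
move=> C0 /andP[q0 q1] uC; have q1' : 0 < 1 - q by lra.
pose D := C / (1 - q).
have D0 : 0 <= D by rewrite divr_ge0// ltW.
have Dq n : D * q ^+ n - D * q ^+ n.+1 = C * q ^+ n.
  by rewrite /D exprS; field; rewrite gt_eqF.
have am n k : u n - D * q ^+ n <= u (n + k)%N - D * q ^+ (n + k).
  elim: k => [|k IHk]; first by rewrite addn0.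
  apply: le_trans IHk _; rewrite addnS.
  by have := uC (n + k)%N; rewrite -Dq ler_norml => /andP[]; lra.
have bm n k : u (n + k)%N + D * q ^+ (n + k) <= u n + D * q ^+ n.
  elim: k => [|k IHk]; first by rewrite addn0.
  apply: le_trans IHk; rewrite addnS.
  by have := uC (n + k)%N; rewrite -Dq ler_norml => /andP[]; lra.
have qn n : 0 <= D * q ^+ n by rewrite mulr_ge0// exprn_ge0.
have ab n m : u n - D * q ^+ n <= u m + D * q ^+ m.
  have h1 := am n m; have h2 := bm m n; rewrite addnC in h2.
  by have := qn (n + m)%N; lra.
pose S := [set u n - D * q ^+ n | n in [set: nat]].
have Sn n : S (u n - D * q ^+ n) by exists n.
have Sub m : ubound S (u m + D * q ^+ m) by move=> _ [n _ <-].
exists (sup S) => n.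
have h1 : u n - D * q ^+ n <= sup S by apply: ub_le_sup => //; exists (u n + D * q ^+ n).
have h2 : sup S <= u n + D * q ^+ n by apply: ge_sup => //; exists (u n - D * q ^+ n).
by rewrite ler_norml; apply/andP; split; rewrite -/D; lra.
Qed.

Lemma geometric_limit (u : nat -> R[i]) (C q : R) : 0 <= C -> 0 <= q < 1 ->
  (forall n, nc (u n.+1 - u n) <= C * q ^+ n) ->
  exists l : R[i], forall n, nc (u n - l) <= 2 * (C / (1 - q)) * q ^+ n.
Proof.
move=> C0 q01 uC.
have [|a aP] := @real_geometric_limit (fun n => complex.Re (u n)) C q C0 q01.
  by move=> n; rewrite -raddfB; apply: le_trans (le_nc_Re _) (uC n).
have [|b bP] := @real_geometric_limit (fun n => complex.Im (u n)) C q C0 q01.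
  by move=> n; rewrite -raddfB; apply: le_trans (le_nc_Im _) (uC n).
exists (a +i* b) => n; apply: le_trans (nr_le_ReIm _) _; rewrite !raddfB /=.
by rewrite -mulrA mulr_natl mulr2n; apply: lerD.
Qed.

Lemma within_uniform_limit (T : topologicalType) (D : set T) (f : nat -> T -> R[i]) (l : T -> R[i]) :
  (forall n, ccont (f n)) ->
  (forall e : R, 0 < e -> exists n, forall x, D x -> nc (f n x - l x) <= e) ->
  {within D, continuous (l : T -> R[i]^o)}.
Proof.
move=> cf fl; apply/subspace_continuousP => x Dx; apply/cvgrPdist_lt => e e0.
have eE : e = (complex.Re e)%:C by move: e0; case: (e) => a b; rewrite ltcE /= => /andP[/eqP -> _].
move: e0; rewrite eE ltcR; move: (complex.Re e) => {eE} r r0.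
have r4 : 0 < r / 4 by lra.
have [n nP] := fl _ r4; have /ccontP/(_ x _ r4) := cf n.
rewrite /within /=; apply: filterS => y fxy Dy; rewrite normE ltcR.
apply: le_lt_trans (nc_triB _ (f n x) _) _.
have h1 := nP x Dx; have h2 := nP y Dy.
have h3 := nc_triB (f n x) (f n y) (l y).
by rewrite nc_distC in h1; rewrite nc_distC in fxy; lra.
Qed.

End geometric_limits.

Section near_representation.
Context (R : realType) (M : topologicalType) (H : ptopologicalType)
  (p : compact_group_bundle M H) (p_open : open_bundle p)
  (lambda : M -> probability (borel H) R)
  (lambda_haar : forall m : M, is_haar p m (lambda m)) (d : nat).
Implicit Types (x y z : H) (m : M).
Notation imx := (imx p lambda).
Local Notation mul := (gb_mul p).
Local Notation inv := (gb_inv p).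
Local Notation C := R[i].
Implicit Types (r : H -> 'M[C]_d).

Lemma mx_mul_ext r : mcont r -> exists2 F : H * H -> 'M[C]_d, mcont F &
  forall x y, p x = p y -> F (x, y) = r (mul x y).
Proof.
move=> cr.
have /choice[F FP] (ij : 'I_d * 'I_d) : exists F : H * H -> C, ccont F /\
    forall x y, p x = p y -> F (x, y) = r (mul x y) ij.1 ij.2.
  by have [F cF FE] := mul_ext p (cr ij.1 ij.2); exists F.
exists (fun u : H * H => \matrix_(i, j) F (i, j) u).
  by move=> i j; under eq_fun do rewrite mxE; exact: (FP (i, j)).1.
by move=> x y xy; apply/matrixP => i j; rewrite mxE (FP (i, j)).2.
Qed.

Lemma imx_param_cont (T : topologicalType) (q : T -> M) a b (F : T * H -> 'M[C]_(a, b)) :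
  continuous q -> mcont F -> mcont (fun t : T => imx (q t) (fun y => F (t, y))).
Proof.
move=> cq cF i j; under eq_fun do rewrite mxE.
exact: (cint_param_cont lambda_haar p_open cq (cF i j)).
Qed.

Lemma mcont_slice (S T : topologicalType) a b (F : S * T -> 'M[C]_(a, b)) (s : S) :
  mcont F -> mcont (fun t : T => F (s, t)).
Proof. by move=> cF i j; exact: (ccont_slice s (cF i j)). Qed.

Definition mstep r x : 'M[C]_d :=
  r x + imx (p x) (fun z => (r (mul x z) - r x *m r z) *m r (inv z)).

Lemma mstep_cont r : mcont r -> mcont (mstep r).
Proof.
move=> cr; have [F cF FE] := mx_mul_ext cr.
have -> : mstep r = (fun x => r x + imx (p x) (fun z => (F (x, z) - r x *m r z) *m r (inv z))).
  apply/funext => x; rewrite /mstep; apply: (congr1 (fun X => r x + X)).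
  by apply: eq_imx => z zx; rewrite FE ?zx.
apply: mcontD; first exact: cr.
apply: (@imx_param_cont _ _ _ _ (fun u : H * H => (F u - r u.1 *m r u.2) *m r (inv u.2))).
  exact: gb_proj_continuous.
apply: mcontM; last first.
  apply: mcont_comp cr; apply: cont_comp (@gb_inv_continuous _ _ p); exact: cont_snd.
apply: mcontB; first exact: cF.
by apply: mcontM; apply: mcont_comp cr; [exact: cont_fst|exact: cont_snd].
Qed.

Definition mdefect m r (e : R) := forall x y, p x = m -> p y = m ->
  mxn (r (mul x y) - r x *m r y) <= e.

(* Inserting the defect [D x y = r (mul x y) - r x *m r y] into the cocycle
   identity [D (xy) z + D x y r z = D x (yz) + r x D y z] and integrating over [z]
   cancels the terms linear in [D]. *)
Lemma mstep_defect m r (e K : R) : mcont r -> 0 <= e -> r (gb_one p m) = 1%:M -> mdefect m r e ->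
  (forall x, p x = m -> mxn (r x) <= K) ->
  [/\ mstep r (gb_one p m) = 1%:M, mdefect m (mstep r) ((2 + K ^+ 2) * e ^+ 2)
    & forall x, p x = m -> mxn (mstep r x - r x) <= e * K].
Proof.
move=> cr e0 r1 re rK; have [F cF FE] := mx_mul_ext cr.
have ci : continuous inv by exact: gb_inv_continuous.
have cri : mcont (fun z => r (inv z)) by exact: mcont_comp ci cr.
have im z : p z = m -> p (inv z) = m by rewrite gb_proj_inv.
have mm x y : p x = m -> p y = m -> p (mul x y) = m by move=> xm ym; rewrite gb_proj_mul ?xm ?ym.
(* The defect on the fiber over [m], written with the extension [F] so as to be continuous on all of
   [H]. *)
pose W x y := F (x, y) - r x *m r y.
have WE x y : p x = m -> p y = m -> W x y = r (mul x y) - r x *m r y.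
  by move=> xm ym; rewrite /W FE ?xm ?ym.
have We x y : p x = m -> p y = m -> mxn (W x y) <= e by move=> xm ym; rewrite WE//; exact: re.
have cW x : mcont (W x).
  apply: mcontB; first exact: mcont_slice.
  by apply: mcontM; [exact: mcont_cst|exact: cr].
pose t x := imx m (fun z => W x z *m r (inv z)).
have ct x : mcont (fun z => W x z *m r (inv z)) by apply: mcontM; [exact: cW|exact: cri].
have stepE x : p x = m -> mstep r x = r x + t x.
  move=> xm; rewrite /mstep xm; apply: (congr1 (fun X => r x + X)).
  by apply: eq_imx => z zm; rewrite WE.
have K0 : 0 <= K by apply: le_trans (rK _ (gb_proj_one p m)); exact: mxn_ge0.
have tn x : p x = m -> mxn (t x) <= e * K.
  move=> xm; apply: (imx_norm lambda_haar (ct x)) => z zm.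
  apply: le_trans (mxnM _ _) _; apply: ler_pM; rewrite ?mxn_ge0//; [exact: We|].
  by apply: rK; exact: im.
split; last by move=> x xm; rewrite stepE// addrC addKr; exact: tn.
  rewrite stepE ?gb_proj_one// r1 (_ : t _ = 0) ?addr0//.
  rewrite /t (@eq_imx _ _ _ _ _ _ _ _ _ (fun=> 0)) ?(imx_cst lambda_haar)// => z zm.
  by rewrite WE ?gb_proj_one// gb_mul1// r1 mul1mx subrr mul0mx.
move=> x y xm ym.
pose I1 := imx m (fun z => W z (inv z)).
pose I2 := imx m (fun u => W x u *m W (inv u) y).
have cF' : mcont (fun z => F (inv z, y)).
  apply: mcont_comp cF; apply: cont_pair; [exact: ci|exact: cont_cst].
have cWiy : mcont (fun u => W (inv u) y).
  by apply: mcontB; [exact: cF'|apply: mcontM; [exact: cri|exact: mcont_cst]].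
have cWd : mcont (fun z => W z (inv z)).
  apply: mcontB; last by apply: mcontM; [exact: cr|exact: cri].
  by apply: mcont_comp cF; apply: cont_pair; [move=> ?; exact: cvg_id|exact: ci].
have I1e : mxn I1 <= e by apply: (imx_norm lambda_haar cWd) => z zm; apply: We => //; exact: im.
have cWW : mcont (fun u => W x u *m W (inv u) y) by apply: mcontM; [exact: cW|exact: cWiy].
have I2e : mxn I2 <= e * e.
  apply: (imx_norm lambda_haar cWW) => z zm; apply: le_trans (mxnM _ _) _.
  by apply: ler_pM; rewrite ?mxn_ge0//; apply: We => //; exact: im.
have crr : mcont (fun z => r z *m r (inv z)) by apply: mcontM; [exact: cr|exact: cri].
have rr : imx m (fun z => r z *m r (inv z)) = 1%:M - I1.
  rewrite -[in RHS](imx_cst lambda_haar m 1%:M) -imxB; [|exact: mcont_cst|exact: cWd].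
  apply: eq_imx => z zm; rewrite WE ?im// gb_mulxV zm r1.
  by rewrite opprB addrCA subrr addr0.
(* The cocycle identity multiplied on the right by [r (z^-1)] and integrated over [z]. *)
have key : t (mul x y) - r x *m t y + W x y *m (1%:M - I1) = t x *m r y + I2.
  have cB1 : mcont (fun z => r x *m (W y z *m r (inv z))) by apply: mcontM; [exact: mcont_cst|exact: ct].
  have cB2 : mcont (fun z => W x y *m (r z *m r (inv z))) by apply: mcontM; [exact: mcont_cst|exact: crr].
  transitivity (imx m (fun z => W (mul x y) z *m r (inv z) - r x *m (W y z *m r (inv z)) +
      W x y *m (r z *m r (inv z)))).
    rewrite imxD; [|by apply: mcontB; [exact: ct|exact: cB1]|exact: cB2].
    rewrite (imxB p lambda m (ct _) cB1) (imxMl lambda_haar m _ (ct y)).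
    by rewrite (imxMl lambda_haar m _ crr) rr.
  have cG : mcont (fun u => W x u *m F (inv u, y)) by apply: mcontM; [exact: cW|exact: cF'].
  (* Substituting [u = yz] turns [r (z^-1)] into [r (u^-1 y)], which differs from [r (u^-1) *m r y]
     by a second defect; that defect gives [I2]. *)
  transitivity (imx m (fun u => W x u *m F (inv u, y))).
    apply: (imx_translate lambda_haar ym cG) => z zm.
    rewrite FE ?gb_proj_inv ?gb_proj_mul ?ym ?zm//.
    rewrite gb_invM ?ym ?zm// gb_mulxVK ?gb_proj_inv ?ym ?zm//.
    rewrite !mulmxA -!mulmxBl -mulmxDl; congr (_ *m _).
    rewrite !WE ?mm// mulmxBr mulmxBl !mulmxA gb_mulA ?xm ?ym ?zm//.
    move: (r (mul (mul x y) z)) (r (mul x y) *m r z) (r x *m r (mul y z)) (r x *m r y *m r z).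
    by move=> b1 b2 b3 b4; apply/matrixP => i j; rewrite !mxE; ring.
  transitivity (imx m (fun u => W x u *m r (inv u) *m r y + W x u *m W (inv u) y)).
    apply: eq_imx => u um; rewrite -mulmxA -mulmxDr; congr (_ *m _).
    by rewrite WE ?im// FE ?gb_proj_inv ?um ?ym// addrC subrK.
  rewrite (imxD p lambda m (mcontM (ct x) (@mcont_cst _ _ _ _ (r y))) cWW).
  by rewrite (imxMr lambda_haar m _ (ct x)).
(* Every term is now a product of two defects. The first two are at most [e ^+ 2], and [t] is at
   most [e * K], whence the constant [2 + K ^+ 2]. *)
have -> : mstep r (mul x y) - mstep r x *m mstep r y = W x y *m I1 + I2 - t x *m t y.
  rewrite (stepE _ (mm _ _ xm ym)) (stepE _ xm) (stepE _ ym).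
  have -> : t (mul x y) = t x *m r y + I2 + r x *m t y - W x y *m (1%:M - I1).
    rewrite -key; move: (t (mul x y)) (r x *m t y) (W x y *m _) => b1 b2 b3.
    by apply/matrixP => i j; rewrite !mxE; ring.
  rewrite mulmxBr mulmx1 !mulmxDl !mulmxDr {1}WE//.
  move: (r (mul x y)) (r x *m r y) (t x *m r y) (r x *m t y) (W x y *m I1) (t x *m t y) => a1 a2 a3 a4 a5 a6.
  by apply/matrixP => i j; rewrite !mxE; ring.
apply: le_trans (mxnB _ _) _; apply: le_trans (lerD (mxnD _ _) (lexx _)) _.
have h1 : mxn (W x y *m I1) <= e * e.
  by apply: le_trans (mxnM _ _) _; apply: ler_pM; rewrite ?mxn_ge0//; exact: We.
have h2 : mxn (t x *m t y) <= (e * K) * (e * K).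
  by apply: le_trans (mxnM _ _) _; apply: ler_pM; rewrite ?mxn_ge0//; exact: tn.
rewrite (_ : (2 + K ^+ 2) * e ^+ 2 = e * e + e * e + (e * K) * (e * K)); last by ring.
by apply: lerD => //; exact: lerD.
Qed.

End near_representation.

Section near_representation.
Context (R : realType) (M : topologicalType) (H : ptopologicalType)
  (p : compact_group_bundle M H) (p_open : open_bundle p)
  (lambda : M -> probability (borel H) R)
  (lambda_haar : forall m : M, is_haar p m (lambda m)) (d : nat).
Implicit Types (x y z : H) (m : M).
Local Notation mul := (gb_mul p).
Local Notation C := R[i].
Implicit Types (r : H -> 'M[C]_d).
Local Notation step := (mstep p lambda (d := d)).

Definition is_mxrep m r := r (gb_one p m) = 1%:M /\
  forall x y, p x = m -> p y = m -> r (mul x y) = r x *m r y.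

(** The condition [e <= 1/4] keeps all iterates below [2 * K]. With this bound, the second condition
    turns the quadratic estimate into a halving of the defect, a linear rate that suffices for
    convergence. *)
Lemma iter_step_bounds m r (e K : R) : mcont r -> 0 <= e -> r (gb_one p m) = 1%:M ->
  mdefect p m r e -> (forall x, p x = m -> mxn (r x) <= K) ->
  e <= 1/4 -> (2 + (2 * K) ^+ 2) * e <= 1/2 -> forall n,
  [/\ iter n step r (gb_one p m) = 1%:M, mdefect p m (iter n step r) (e * (1/2) ^+ n),
      forall x, p x = m -> mxn (iter n step r x) <= K + 4 * K * e * (1 - (1/2) ^+ n)
    & forall x, p x = m -> mxn (iter n.+1 step r x - iter n step r x) <= 2 * K * e * (1/2) ^+ n].
Proof.
move=> cr e0 r1 re rK e4 eK.
have K0 : 0 <= K by apply: le_trans (rK _ (gb_proj_one p m)); exact: mxn_ge0.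
have citer n : mcont (iter n step r).
  by elim: n => [//|n IHn]; exact: (mstep_cont p_open lambda_haar IHn).
have q0 n : 0 <= (1/2 : R) ^+ n by apply: exprn_ge0; lra.
have q1 n : (1/2 : R) ^+ n <= 1 by rewrite exprn_ile1//; lra.
have kb n : 4 * K * e * (1 - (1/2) ^+ n) <= K.
  have := q0 n; have := q1 n; move: ((1/2 : R) ^+ n) => q h1 h2.
  have : K * (4 * e * (1 - q)) <= K * 1 by apply: ler_wpM2l => //; nra.
  by rewrite mulr1; apply: le_trans; rewrite le_eqVlt; apply/orP; left; apply/eqP; ring.
have main n : iter n step r (gb_one p m) = 1%:M ->
    mdefect p m (iter n step r) (e * (1/2) ^+ n) ->
    (forall x, p x = m -> mxn (iter n step r x) <= K + 4 * K * e * (1 - (1/2) ^+ n)) ->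
    [/\ iter n.+1 step r (gb_one p m) = 1%:M,
       mdefect p m (iter n.+1 step r) (e * (1/2) ^+ n.+1)
     & forall x, p x = m -> mxn (iter n.+1 step r x - iter n step r x) <= 2 * K * e * (1/2) ^+ n].
  move=> i1 i2 i3.
  have i3' x : p x = m -> mxn (iter n step r x) <= 2 * K.
    by move=> /i3; have := kb n; lra.
  have [|j1 j2 j3] := mstep_defect lambda_haar (citer n) _ i1 i2 i3'; first by rewrite mulr_ge0.
  split => // [x y xm ym|x xm]; last by apply: le_trans (j3 x xm) _; rewrite le_eqVlt; apply/orP; left; apply/eqP; ring.
  apply: le_trans (j2 x y xm ym) _.
  have := q0 n; have := q1 n; rewrite [_ ^+ n.+1]exprS; move: ((1/2 : R) ^+ n) => q h1 h2.
  have -> : (2 + (2 * K) ^+ 2) * (e * q) ^+ 2 = ((2 + (2 * K) ^+ 2) * e) * (e * q * q) by ring.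
  apply: (@le_trans _ _ (1/2 * (e * q * q))).
    by apply: ler_wpM2r => //; rewrite !mulr_ge0.
  rewrite [leRHS](_ : _ = 1/2 * (e * q * 1)); last by ring.
  by apply: ler_wpM2l; [lra|apply: ler_wpM2l; [rewrite mulr_ge0|]].
elim=> [|n [i1 i2 i3 i4]].
  have h0 : iter 0 step r (gb_one p m) = 1%:M by [].
  have h1 : mdefect p m (iter 0 step r) (e * (1/2) ^+ 0) by rewrite expr0 mulr1.
  have h2 : forall x, p x = m -> mxn (iter 0 step r x) <= K + 4 * K * e * (1 - (1/2) ^+ 0).
    by move=> x xm; rewrite expr0 subrr mulr0 addr0; exact: rK.
  by have [_ _ h3] := main 0%N h0 h1 h2; split.
have [j1 j2 _] := main n i1 i2 i3.
have j3 x : p x = m -> mxn (iter n.+1 step r x) <= K + 4 * K * e * (1 - (1/2) ^+ n.+1).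
  move=> xm; rewrite -(subrK (iter n step r x) (iter n.+1 step r x)).
  apply: le_trans (mxnD _ _) _; have := i3 x xm; have := i4 x xm.
  rewrite exprS; move: ((1/2 : R) ^+ n) => q h1 h2.
  have -> : K + 4 * K * e * (1 - 1/2 * q) = 2 * K * e * q + (K + 4 * K * e * (1 - q)) by field.
  exact: lerD.
by have [_ _ j4] := main n.+1 j1 j2 j3; split.
Qed.

(** The correction term integrates the defect, which is 0 where [r] is multiplicative. *)
Lemma rep_fixed m r n x : mcont r -> is_mxrep m r -> p x = m -> iter n step r x = r x.
Proof.
move=> cr rr xm.
suff : is_mxrep m (iter n step r) /\ forall x, p x = m -> iter n step r x = r x by case=> _; exact.
elim: n => [//|n [[i1 iM] ir]].
have ir' y : p y = m -> iter n.+1 step r y = r y.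
  move=> ym; rewrite iterS /mstep ym ir//.
  rewrite (@eq_imx _ _ _ _ _ _ _ _ _ (fun=> 0)) ?(imx_cst lambda_haar) ?addr0// => z zm.
  by rewrite iM// ir// subrr mul0mx.
split=> //; split; first by rewrite ir' ?gb_proj_one//; case: rr.
by move=> y z ym zm; rewrite !ir' ?gb_proj_mul ?ym ?zm//; case: rr => _; exact.
Qed.

Lemma near_mxrep m0 r : mcont r -> is_mxrep m0 r ->
  exists (rho : H -> 'M[C]_d) (O : set M), [/\ open O, O m0, mcont rho,
    forall m, O m -> is_mxrep m rho & forall x, p x = m0 -> rho x = r x].
Proof.
move=> cr rr.
(* The correction step needs the value [1] at every identity element; this normalization provides it
   and leaves [r] unchanged over [m0]. *)
pose s x := r x + (1%:M - r (gb_one p (p x))).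
have cs : mcont s.
  apply: mcontD; first exact: cr.
  apply: mcontB; first exact: mcont_cst.
  by apply: mcont_comp cr; apply: cont_comp (@gb_one_continuous _ _ p); exact: gb_proj_continuous.
have s1 m : s (gb_one p m) = 1%:M by rewrite /s gb_proj_one addrC subrK.
have sr x : p x = m0 -> s x = r x by move=> xm; rewrite /s xm rr.1 subrr addr0.
have srep : is_mxrep m0 s.
  by split=> // x y xm ym; rewrite !sr ?gb_proj_mul ?xm ?ym//; exact: rr.2.
have [K K0 sK] : exists2 K : R, 0 < K & forall x, mxn (s x) <= K.
  have [K K0 KP] := real_compact_bounded p (mcont_mxn cs).
  by exists K => // x; apply: le_trans (KP x); exact: ler_norm.
(* The two entries of the minimum are the two smallness conditions of [iter_step_bounds]. *)
pose e : R := Num.min (1/4) (1 / (2 * (2 + (2 * K) ^+ 2))).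
have D0 : 0 < 2 + (2 * K) ^+ 2 by rewrite ltr_pwDl// sqr_ge0.
have e0 : 0 < e by rewrite lt_min; apply/andP; split; [lra|rewrite divr_gt0// mulr_gt0].
have e4 : e <= 1/4 by rewrite ge_min lexx.
have eK : (2 + (2 * K) ^+ 2) * e <= 1/2.
  rewrite mulrC -ler_pdivlMr// ge_min; apply/orP; right.
  by rewrite -[leRHS]mulrA -invfM.
have [F cF FE] := mx_mul_ext p cs.
pose W (u : H * H) := F u - s u.1 *m s u.2.
have cW : mcont W.
  apply: mcontB; first exact: cF.
  by apply: mcontM; apply: mcont_comp cs; [exact: cont_fst|exact: cont_snd].
have oU : open [set u : H * H | mxn (W u) < e].
  by have := mcont_mxn cW => /continuousP /(_ [set t : R^o | t < e]); apply; exact: open_lt.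
have cpp : continuous (fun u : H * H => (p u.1, p u.2)).
  apply: cont_pair; [apply: cont_comp (@gb_proj_continuous _ _ p); exact: cont_fst|].
  by apply: cont_comp (@gb_proj_continuous _ _ p); exact: cont_snd.
have Wm0 (u : H * H) : (p u.1, p u.2) = (m0, m0) -> [set u | mxn (W u) < e] u.
  move=> [u1 u2] /=; rewrite /W [F u](_ : _ = F (u.1, u.2)); last by case: (u).
  by rewrite FE ?u1 ?u2// srep.2// subrr mxn0.
(* [fiber_nbhs] is applied to [p] times [p] over [M * M] and then pulled back along the diagonal of
   [M]. *)
have nH := fiber_nbhs (compact_prod (gb_compactH p) (gb_compactH p))
  (prod_hausdorff (gb_hausdorffM p) (gb_hausdorffM p)) cpp oU Wm0.
pose N := [set m | forall u : H * H, (p u.1, p u.2) = (m, m) -> [set u | mxn (W u) < e] u].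
have nN : nbhs m0 N.
  have cdiag : continuous (fun m : M => (m, m)) by apply: cont_pair => ?; exact: cvg_id.
  exact: (cdiag m0 _ nH).
have Ndef m : N m -> mdefect p m s e.
  by move=> Nm x y xm ym; have := Nm (x, y); rewrite /= xm ym => /(_ erefl) /ltW; rewrite /W FE ?xm ?ym.
have [g [cg g1 g01 gN]] := urysohn_bump R (gb_compactM p) (gb_hausdorffM p) nN.
(* A closed neighborhood, as Tietze asks for when the limit of the iterates is extended to [H]; the
   open set where [1/2 < g] becomes [O]. *)
pose V := [set m | 1/2 <= g m].
have VN m : V m -> N m.
  by rewrite /V /= => gm; apply: contrapT => /gN gm0; move: gm; rewrite gm0; lra.
have bounds n m : V m -> [/\ iter n step s (gb_one p m) = 1%:M, mdefect p m (iter n step s) (e * (1/2) ^+ n),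
      forall x, p x = m -> mxn (iter n step s x) <= K + 4 * K * e * (1 - (1/2) ^+ n)
    & forall x, p x = m -> mxn (iter n.+1 step s x - iter n step s x) <= 2 * K * e * (1/2) ^+ n].
  by move=> Vm; exact: (iter_step_bounds cs (ltW e0) (s1 m) (Ndef m (VN m Vm)) (fun x _ => sK x) e4 eK).
have Ke : 0 <= 2 * K * e by rewrite !mulr_ge0// ltW.
have q01 : 0 <= (1/2 : R) < 1 by apply/andP; split; lra.
have /choice[l lP] : forall x, exists L : 'M[C]_d, V (p x) ->
    forall n i j, nc ((iter n step s x) i j - L i j) <= 2 * (2 * K * e / (1 - 1/2)) * (1/2) ^+ n.
  move=> x; have [Vx|nV] := pselect (V (p x)); last by exists 0.
  have /choice[L LP] (ij : 'I_d * 'I_d) : exists l, forall n,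
      nc ((iter n step s x) ij.1 ij.2 - l) <= 2 * (2 * K * e / (1 - 1/2)) * (1/2) ^+ n.
    apply: geometric_limit => // n; have [_ _ _ /(_ x erefl)] := bounds n _ Vx.
    by apply: le_trans; have := le_mxn (iter n.+1 step s x - iter n step s x) ij.1 ij.2; rewrite !mxE.
  by exists (\matrix_(i, j) L (i, j)) => _ n i j; rewrite mxE; exact: LP (i, j) n.
set Q := 2 * (2 * K * e / (1 - 1/2)) in lP.
have Q0 : 0 <= Q by rewrite mulr_ge0// divr_ge0//; lra.
have clV : closed (p @^-1` V).
  apply: preimage_closed; last first.
    have -> : V = g @^-1` [set t : R^o | 1/2 <= t] by [].
    by apply: preimage_closed; [move=> ? _; exact: cg|exact: closed_ge].
  by move=> ? _; exact: gb_proj_continuous.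
have citer n : mcont (iter n step s).
  by elim: n => [//|n IHn]; exact: (mstep_cont p_open lambda_haar IHn).
have cl i j : {within p @^-1` V, continuous ((fun x => l x i j) : H -> R[i]^o)}.
  apply: (@within_uniform_limit _ _ _ (fun n x => iter n step s x i j)).
    by move=> n; exact: citer.
  move=> t t0; have [n nP] := geometric_cvg0 Q0 q01 t0; exists n => x Vx.
  by apply: le_trans (lP x Vx n i j) _; apply: ltW; exact: nP.
have /choice[rho rhoP] (ij : 'I_d * 'I_d) : exists f : H -> C, ccont f /\ forall x, V (p x) -> f x = l x ij.1 ij.2.
  have [f cf fl] := ccont_tietze (gb_compactH p) (gb_hausdorffH p) clV (cl ij.1 ij.2).
  by exists f.
exists (fun x => \matrix_(i, j) rho (i, j) x), [set m | 1/2 < g m].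
have rhoE x : V (p x) -> \matrix_(i, j) rho (i, j) x = l x.
  by move=> Vx; apply/matrixP => i j; rewrite mxE (rhoP (i, j)).2.
have Vm0 : V m0 by rewrite /V /= g1; lra.
split.
- by move: cg => /continuousP /(_ [set t : R^o | 1/2 < t]); apply; exact: open_gt.
- by rewrite /= g1; lra.
- by move=> i j; under eq_fun do rewrite mxE; exact: (rhoP (i, j)).1.
- move=> m /= /ltW Vm; split.
    rewrite rhoE ?gb_proj_one//; apply/matrixP => i j; apply/eqP; rewrite -subr_eq0; apply/eqP.
    apply: nc_le0_eq0 => t t0; have [n nP] := geometric_cvg0 Q0 q01 t0.
    have [i1 _ _ _] := bounds n m Vm; rewrite -i1 nc_distC.
    by apply: le_trans (lP _ _ n i j) _; [rewrite gb_proj_one|apply: ltW; exact: nP].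
  move=> x y xm ym; rewrite !rhoE ?gb_proj_mul ?xm ?ym//.
  have cvgn z (zm : p z = m) n : mxn (iter n step s z - l z) <= d%:R * d%:R * Q * (1/2) ^+ n.
    rewrite /mxn; apply: (@le_trans _ _ (\sum_(i < d) \sum_(j < d) Q * (1/2) ^+ n)).
      apply: ler_sum => i _; apply: ler_sum => j _; rewrite !mxE.
      by apply: lP; rewrite zm.
    by rewrite !sumr_const !card_ord -mulrnA -[leLHS]mulr_natl natrM !mulrA.
  apply/eqP; rewrite -subr_eq0; apply/eqP/mxn_eq0/eqP; rewrite eq_le mxn_ge0 andbT.
  apply/ler_addgt0Pr => t t0; rewrite add0r.
  have xym : p (mul x y) = m by rewrite gb_proj_mul ?xm ?ym.
  pose D : R := d%:R * d%:R * Q.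
  have D00 : 0 <= D by apply: mulr_ge0 => //; apply: mulr_ge0; exact: ler0n.
  (* Collects the defect [e] of the iterate and the cost of replacing iterates by limits in [l (xy)]
     and in the product; all of it decays like [q]. *)
  pose B : R := D * (1 + 4 * K + D) + e.
  have B0 : 0 <= B by apply: addr_ge0; [apply: mulr_ge0 => //; lra|exact: ltW].
  have [n nP] := geometric_cvg0 B0 q01 t0; apply: le_trans (ltW (nP n (leqnn n))).
  have [_ i2 i3 _] := bounds n m Vm.
  set a := iter n step s in i2 i3 *; have q0 : 0 <= (1/2 : R) ^+ n by apply: exprn_ge0; lra.
  have q1 : (1/2 : R) ^+ n <= 1 by rewrite exprn_ile1//; lra.
  have cv z : p z = m -> mxn (a z - l z) <= D * (1/2) ^+ n by move=> zm; exact: cvgn.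
  move: q0 q1 i2 i3 cv; set q := (1/2 : R) ^+ n => q0 q1 i2 i3 cv.
  have a2 z : p z = m -> mxn (a z) <= 2 * K.
    move=> zm; apply: le_trans (i3 z zm) _.
    have : K * (4 * e * (1 - q)) <= K * 1.
      by apply: ler_wpM2l; [exact: ltW|have := ltW e0; nra].
    by rewrite mulr1 => h; rewrite (_ : 4 * K * e * (1 - q) = K * (4 * e * (1 - q))); [lra|ring].
  have l2 z : p z = m -> mxn (l z) <= 2 * K + D.
    move=> zm; rewrite -(subKr (a z) (l z)); apply: le_trans (mxnB _ _) _.
    apply: lerD; first exact: a2.
    by apply: le_trans (cv z zm) _; rewrite -[leRHS]mulr1 ler_wpM2l.
  have -> : l (mul x y) - l x *m l y = (a (mul x y) - a x *m a y) - (a (mul x y) - l (mul x y))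
     + (a x *m (a y - l y) + (a x - l x) *m l y).
    rewrite mulmxBr mulmxBl.
    move: (a (mul x y)) (l (mul x y)) (a x *m a y) (a x *m l y) (l x *m l y) => b1 b2 b3 b4 b5.
    by apply/matrixP => i j; rewrite !mxE; ring.
  have B1 := mxnM (a x) (a y - l y); have B2 := mxnM (a x - l x) (l y).
  have C1 : mxn (a x) * mxn (a y - l y) <= (2 * K) * (D * q).
    by apply: ler_pM; rewrite ?mxn_ge0//; [exact: a2|exact: cv].
  have C2 : mxn (a x - l x) * mxn (l y) <= (D * q) * (2 * K + D).
    by apply: ler_pM; rewrite ?mxn_ge0//; [exact: cv|exact: l2].
  apply: le_trans (mxnD _ _) _; apply: le_trans (lerD (mxnB _ _) (mxnD _ _)) _.
  have := i2 x y xm ym; have := cv _ xym => h1 h2.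
  have -> : B * q = e * q + D * q + (2 * K * (D * q) + D * q * (2 * K + D)) by rewrite /B; ring.
  by apply: lerD; apply: lerD => //; [exact: le_trans B1 C1|exact: le_trans B2 C2].
move=> x xm; rewrite rhoE ?xm//; apply/matrixP => i j; apply/eqP; rewrite -subr_eq0; apply/eqP.
apply: nc_le0_eq0 => t t0; have [n nP] := geometric_cvg0 Q0 q01 t0.
have := lP x; rewrite xm => /(_ Vm0 n i j); rewrite (rep_fixed _ cs srep xm) sr// nc_distC => h.
by apply: le_trans h _; apply: ltW; exact: nP.
Qed.

End near_representation.

(** * Matrix coordinates of an irreducible representation *)

Section coordinates.
Context (R : realType) (E : hilbert R) (d : nat) (e : 'I_d -> E).
Hypotheses (oe : onb e) (ce : onb_complete e).
Implicit Types (u v w : E) (A B : 'M[R[i]]_d).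

Definition colv v : 'cV[R[i]]_d := \col_i ip E v (e i).
Definition vecv (c : 'cV[R[i]]_d) : E := \sum_i c i 0 *: e i.

Lemma colvK v : vecv (colv v) = v.
Proof. by rewrite [RHS]ce; apply: eq_bigr => i _; rewrite mxE. Qed.

Lemma vecvK c : colv (vecv c) = c.
Proof. by apply/matrixP => i j; rewrite mxE onb_ip_sum// ord1. Qed.

Lemma colv_linear (a : R[i]) u v : colv (a *: u + v) = a *: colv u + colv v.
Proof. by apply/matrixP => i j; rewrite !mxE ipDl ipZl. Qed.

Lemma vecv_linear (a : R[i]) c c' : vecv (a *: c + c') = a *: vecv c + vecv c'.
Proof.
rewrite /vecv scaler_sumr -big_split /=; apply: eq_bigr => i _.
by rewrite !mxE scalerDl scalerA.
Qed.

Definition opm A v : E := vecv (A *m colv v).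

Lemma opm_is_linear A : linear (opm A).
Proof. by move=> a u v; rewrite /opm colv_linear mulmxDr -scalemxAr vecv_linear. Qed.

HB.instance Definition _ A := GRing.isLinear.Build R[i] E E *:%R (opm A) (opm_is_linear A).

Lemma colv_opm A v : colv (opm A v) = A *m colv v.
Proof. by rewrite vecvK. Qed.

Lemma colv_inj : injective colv.
Proof. by move=> u v uv; rewrite -(colvK u) uv colvK. Qed.

Lemma opmM A B v : opm (A *m B) v = opm A (opm B v).
Proof. by apply: colv_inj; rewrite !colv_opm mulmxA. Qed.

Lemma opm1 v : opm 1%:M v = v.
Proof. by apply: colv_inj; rewrite colv_opm mul1mx. Qed.

Lemma ip_colv v w : ip E v w = \sum_i colv v i 0 * Num.conj (colv w i 0).
Proof.
by rewrite {1}[w]ce ip_sumr; apply: eq_bigr => i _; rewrite ipZr !mxE mulrC.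
Qed.

Lemma ip_opm A v w : ip E (opm A v) w = \sum_i \sum_j A i j * (colv v j 0 * Num.conj (colv w i 0)).
Proof.
rewrite ip_colv; apply: eq_bigr => i _; rewrite colv_opm mxE mulr_suml.
by apply: eq_bigr => j _; rewrite mulrA.
Qed.

Lemma nr_onb i : normr_of (e i) = 1.
Proof.
have := oe i i; rewrite ipE eqxx => /(@complexI R) /eqP.
by rewrite sqrf_eq1 => /orP[/eqP//|/eqP h]; have := nr_ge0 (e i); rewrite h; lra.
Qed.

Lemma nr_vecv c : normr_of (vecv c) <= mxn c.
Proof.
apply: le_trans (nr_sum _ _ _) _; apply: ler_sum => i _.
by rewrite nrZc nr_onb mulr1 big_ord1.
Qed.

Lemma nr_opm A v : normr_of (opm A v) <= mxn A * normr_of v.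
Proof.
apply: le_trans (nr_vecv _) _; rewrite /mxn mulr_suml; apply: ler_sum => i _.
rewrite big_ord1 mxE mulr_suml; apply: le_trans (nc_sum _ _ _) _; apply: ler_sum => j _.
rewrite ncM ler_wpM2l ?nc_ge0// mxE; apply: le_trans (cauchy_schwarz _ _) _.
by rewrite nr_onb mulr1.
Qed.

Lemma opm_continuous A : continuous (opm A).
Proof.
apply/cont_nrP => x t t0.
have d0 : 0 < t / (mxn A + 1) by rewrite divr_gt0// ltr_wpDl ?mxn_ge0.
have cid : continuous (fun v : E => v) by move=> v; exact: cvg_id.
have /cont_nrP/(_ x _ d0) := cid; apply: filterS => y xy.
rewrite -linearB; apply: le_lt_trans (nr_opm _ _) _.
apply: (@le_lt_trans _ _ ((mxn A + 1) * normr_of (y - x))).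
  by rewrite ler_wpM2r ?nr_ge0// lerDl.
by rewrite mulrC -ltr_pdivlMr// ltr_wpDl ?mxn_ge0.
Qed.

Lemma nr_colv v : (normr_of v ^+ 2)%:C = \sum_i colv v i 0 * Num.conj (colv v i 0).
Proof. by rewrite -ipE ip_colv. Qed.

End coordinates.

Section base_representation.
Context (R : realType) (M : topologicalType) (H : ptopologicalType)
  (p : compact_group_bundle M H) (p_open : open_bundle p)
  (lambda : M -> probability (borel H) R)
  (lambda_haar : forall m : M, is_haar p m (lambda m))
  (A : cstar_algebra R) (iota : CH R H -> A)
  (A_completion : is_group_cstar_algebra p lambda iota) (pi : irrep A).
Implicit Types (x y z : H) (f g h : CH R H).
Notation cint := (cint p lambda).
Local Notation mul := (gb_mul p).
Local Notation inv := (gb_inv p).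
Local Notation E := (irrep_space pi).
Local Notation m0 := (rep_base A_completion pi).
Implicit Types v w u : E.

(** The unitarity of the group representation to come: translating both [f] and [g] by [x] does not
    alter the convolution of [g^*] with [f] on the fiber, by right invariance. *)
Lemma orbit_ip f g v x : p x = m0 ->
  ip E (orbit_map p iota f v x) (orbit_map p iota g v x) = ip E (pi (iota f) v) (pi (iota g) v).
Proof.
move=> xm; rewrite /orbit_map -!(rep_star A_completion) -!(rep_conv p_open lambda_haar A_completion).
apply: (congr1 (fun u => ip E u v)); apply: (rep_fiber_eq p_open lambda_haar) => z zm.
have [F1 cF1 F1E] := mul_ext p (@CH_cont _ _ (star_elt p g)).
have [F2 cF2 F2E] := mul_ext p (@CH_cont _ _ (star_elt p (ltr p g x))).
have cfi h : ccont (fun y => h (inv y)).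
  by apply: ccont_comp (@CH_cont _ _ h); exact: gb_inv_continuous.
transitivity (cint m0 (fun y => F2 (z, y) * ltr p f x (inv y))).
  by rewrite -[LHS]/(cint (p z) _) zm; apply: eq_cint => y ym; rewrite F2E ?zm ?ym.
transitivity (cint m0 (fun y => F1 (z, y) * f (inv y))); last first.
  by rewrite -[RHS]/(cint (p z) _) zm; apply: eq_cint => y ym; rewrite F1E ?zm ?ym.
apply: (cint_translater lambda_haar xm).
- by apply: ccontM; [exact: (ccont_slice z cF1)|exact: cfi].
- by apply: ccontM; [exact: (ccont_slice z cF2)|exact: cfi].
move=> y ym; rewrite F1E ?F2E ?gb_proj_mul ?xm ?ym ?zm//.
rewrite ltrE ?gb_proj_inv ?xm ?ym// -gb_invM ?xm ?ym//; congr (_ * _).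
rewrite -[star_elt p _ _]/(Num.conj (ltr p g x (inv (mul z y)))).
rewrite -[RHS]/(Num.conj (g (inv (mul z (mul y x))))); congr (Num.conj _).
rewrite ltrE ?gb_proj_inv ?gb_proj_mul ?xm ?ym ?zm//.
by rewrite -gb_invM ?gb_proj_mul ?xm ?ym ?zm// gb_mulA ?xm ?ym ?zm.
Qed.

(** The closure [Z] of the orbit of [v0] is closed and invariant, hence 0 or everything. *)
Lemma rep_cyclic_dense v0 : v0 != 0 -> forall v (t : R), 0 < t ->
  exists f, normr_of (v - pi (iota f) v0) < t.
Proof.
move=> v00; pose Z := [set w : E | forall t : R, 0 < t -> exists f, normr_of (w - pi (iota f) v0) < t].
have sZ : closed_subspace Z.
  split.
  - move=> t t0; exists (mkC (@ccont_cst R H 0)).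
    have -> : pi (iota (mkC (@ccont_cst R H 0))) v0 = 0.
      apply: nr_eq0; apply/eqP; rewrite eq_le nr_ge0 andbT -(mul0r (normr_of v0)).
      by apply: (rep_fiber_bound p_open lambda_haar) => x _; rewrite nc0.
    by rewrite subrr nr0.
  - move=> a u v Zu Zv t t0.
    have t1 : 0 < t / 2 / (nc a + 1) by rewrite !divr_gt0// ltr_wpDl ?nc_ge0.
    have t2 : 0 < t / 2 by lra.
    have [f uf] := Zu _ t1; have [g vg] := Zv _ t2.
    have ch : ccont (fun x => a * f x + g x).
      by apply: ccontD; [apply: ccontM; [exact: ccont_cst|exact: CH_cont]|exact: CH_cont].
    exists (mkC ch); rewrite (@rep_linear _ _ _ _ _ _ _ A_completion pi a f g (mkC ch))//.
    rewrite opprD addrACA -scalerBr; apply: le_lt_trans (nrD _ _) _.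
    rewrite [t]splitr nrZc; apply: ler_ltD => //.
    apply: (@le_trans _ _ ((nc a + 1) * (t / 2 / (nc a + 1)))).
      by apply: ler_pM; rewrite ?nc_ge0 ?nr_ge0 ?lerDl// ltW.
    by rewrite mulrC divfK// gt_eqF// ltr_wpDl ?nc_ge0.
  - apply: closed_nrP => w wZ t t0; have t2 : 0 < t / 2 by lra.
    have [u Zu wu] := wZ _ t2; have [f uf] := Zu _ t2; exists f.
    by apply: le_lt_trans (nr_triB _ u _) _; rewrite [t]splitr ltrD.
have iZ f v : Z v -> Z (pi (iota f) v).
  move=> Zv t t0.
  have t1 : 0 < t / (normr_of (iota f) + 1) by rewrite divr_gt0// ltr_wpDl ?nr_ge0.
  have [g vg] := Zv _ t1; exists (conv_elt p_open lambda_haar f g).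
  rewrite (rep_conv p_open lambda_haar A_completion) -linearB.
  apply: le_lt_trans (irrep_contract _ _) _.
  apply: (@le_lt_trans _ _ ((normr_of (iota f) + 1) * normr_of (v - pi (iota g) v0))).
    by rewrite ler_wpM2r ?nr_ge0// lerDl.
  by rewrite mulrC -ltr_pdivlMr// ltr_wpDl ?nr_ge0.
have [Z0|ZT] := rep_irreducible A_completion sZ iZ; last first.
  by move=> v; have : Z v by rewrite ZT.
(* If [Z = 0], then [v0] lies in the common kernel [N]. This is again closed and invariant, so it is
   everything, which contradicts [rep_nonzero]. *)
exfalso; pose N := [set w : E | forall f, pi (iota f) w = 0].
have N0 : N v0.
  move=> f; have : Z (pi (iota f) v0) by move=> t t0; exists f; rewrite subrr nr0.
  by rewrite Z0.
have sN : closed_subspace N.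
  split; first by move=> f; rewrite linear0.
    by move=> a u v Nu Nv f; rewrite linearP Nu Nv scaler0 addr0.
  apply: closed_nrP => w wN f; apply: nr_eq0; apply/eqP; rewrite eq_le nr_ge0 andbT.
  apply/ler_addgt0Pr => t t0; rewrite add0r.
  have t1 : 0 < t / (normr_of (iota f) + 1) by rewrite divr_gt0// ltr_wpDl ?nr_ge0.
  have [u Nu wu] := wN _ t1.
  rewrite -[pi _ w]subr0 -(Nu f) -linearB; apply: le_trans (irrep_contract _ _) _.
  apply: (@le_trans _ _ ((normr_of (iota f) + 1) * (t / (normr_of (iota f) + 1)))).
    by apply: ler_pM; rewrite ?nr_ge0 ?lerDl// ltW.
  by rewrite mulrC divfK// gt_eqF// ltr_wpDl ?nr_ge0.
have iN f v : N v -> N (pi (iota f) v) by move=> Nv g; rewrite Nv linear0.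
have [NN|NT] := rep_irreducible A_completion sN iN.
  by move: N0; rewrite NN => /= v0E; rewrite v0E eqxx in v00.
have [f [v /eqP]] := rep_nonzero A_completion pi; apply.
by have : N v by rewrite NT.
Qed.

End base_representation.

Lemma opm_ip_cont (R : realType) (E : hilbert R) (d : nat) (e : 'I_d -> E) (T : topologicalType)
  (r : T -> 'M[R[i]]_d) v w : onb e -> onb_complete e -> mcont r ->
  ccont (fun x => ip E (opm e (r x) v) w).
Proof.
move=> oe ce cr; under eq_fun do rewrite (ip_opm oe ce).
apply: ccont_sum => i; apply: ccont_sum => j; apply: ccontM; last exact: ccont_cst.
exact: cr.
Qed.

Section base_representation.
Context (R : realType) (M : topologicalType) (H : ptopologicalType)
  (p : compact_group_bundle M H) (p_open : open_bundle p)
  (lambda : M -> probability (borel H) R)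
  (lambda_haar : forall m : M, is_haar p m (lambda m))
  (A : cstar_algebra R) (iota : CH R H -> A)
  (A_completion : is_group_cstar_algebra p lambda iota) (pi : irrep A).
Implicit Types (x y z : H) (f g h : CH R H).
Notation cint := (cint p lambda).
Local Notation E := (irrep_space pi).
Local Notation m0 := (rep_base A_completion pi).
Implicit Types v w u : E.
Context (d : nat) (e : 'I_d -> E).
Hypotheses (oe : onb e) (ce : onb_complete e).

Lemma CH_sum n (c : 'I_n -> R[i]) (F : 'I_n -> CH R H) :
  exists h : CH R H, forall x, h x = \sum_i c i * F i x.
Proof.
have ch : ccont (fun x => \sum_i c i * F i x).
  by apply: ccont_sum => i; apply: ccontM; [exact: ccont_cst|exact: CH_cont].
by exists (mkC ch).
Qed.

(** Density becomes equality in finite dimension: vectors of the orbit close to the basis have a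
    coordinate matrix close to the identity, hence invertible, and so they span. *)
Lemma rep_cyclic v0 : v0 != 0 -> forall v, exists f, pi (iota f) v0 = v.
Proof.
move=> v00 v; pose t : R := ((d * d)%:R + 1)^-1.
have t0 : 0 < t by rewrite invr_gt0 ltr_wpDl ?ler0n.
have /choice[F FP] i := rep_cyclic_dense p_open lambda_haar A_completion v00 (e i) t0.
pose a : 'M[R[i]]_d := \matrix_(i, j) ip E (pi (iota (F i)) v0) (e j).
have ua : a \in unitmx.
  apply: near1_unitmx; apply: (@le_lt_trans _ _ ((d * d)%:R * t)); last first.
    by rewrite ltr_pdivrMr ?mul1r ?ltrDl// ltr_wpDl ?ler0n.
  apply: (@le_trans _ _ (\sum_(i < d) \sum_(j < d) t)).
    apply: ler_sum => i _; apply: ler_sum => j _; rewrite !mxE -oe -ipBl.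
    apply: le_trans (cauchy_schwarz _ _) _; rewrite (nr_onb oe) mulr1 nr_distC.
    exact: ltW.
  by rewrite !sumr_const !card_ord -mulrnA mulr_natl.
pose c : 'rV_d := (colv e v)^T *m invmx a.
have [h hE] := CH_sum (fun i => c 0 i) F.
exists h; rewrite (rep_sum p_open lambda_haar (F := F) (c := fun i => c 0 i)); last by move=> x _; exact: hE.
apply: (colv_inj ce); apply/matrixP => j k; rewrite ord1 mxE ip_suml.
transitivity ((c *m a) 0 j); first by rewrite mxE; apply: eq_bigr => i _; rewrite ipZl !mxE.
by rewrite mulmxKV// mxE.
Qed.

Variable v0 : E.
Hypothesis v00 : v0 != 0.
Let cyc := choice (fun i => rep_cyclic v00 (e i)).
Let F := projT1 cyc.
Let FP i : pi (iota (F i)) v0 = e i.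
Proof. exact: (projT2 cyc i). Qed.
Local Notation orbit := (orbit_map p iota).

(** The matrix of the group element [x] in the basis [e], since [e j = pi (iota (F j)) v0]. The
    extended translates behind [orbit] make it continuous on all of [H], while it is known to be
    multiplicative over the base point only. *)
Definition base_mx x : 'M[R[i]]_d := \matrix_(i, j) ip E (orbit (F j) v0 x) (e i).
Local Notation r := base_mx.

Lemma base_mx_cont : mcont r.
Proof.
move=> i j; under eq_fun do rewrite mxE.
exact: (psi_ip_cont p_open lambda_haar A_completion).
Qed.

Lemma opm_base_mx x v : opm e (r x) v = \sum_j colv e v j 0 *: orbit (F j) v0 x.
Proof.
apply: (colv_inj ce); rewrite (colv_opm oe); apply/matrixP => i k.
rewrite ord1 !mxE ip_suml; apply: eq_bigr => j _.
by rewrite ipZl !mxE mulrC.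
Qed.

(** Well-definedness: by the isometry [orbit_ip], the orbit of [f] depends only on the vector
    [pi (iota f) v0], so [f] may be replaced by a combination of the [F j]. *)
Lemma base_mx_orbit f x : p x = m0 -> opm e (r x) (pi (iota f) v0) = orbit f v0 x.
Proof.
move=> xm; pose c (j : 'I_d) : R[i] := colv e (pi (iota f) v0) j 0.
have [h hE] := CH_sum c F.
have hf : pi (iota h) v0 = pi (iota f) v0.
  rewrite (rep_sum p_open lambda_haar (F := F) (c := c)); last by move=> y _; exact: hE.
  by rewrite -[RHS](colvK ce); apply: eq_bigr => j _; rewrite FP.
rewrite opm_base_mx; transitivity (orbit h v0 x).
  rewrite [RHS](rep_sum p_open lambda_haar (F := fun j => ltr p (F j) x) (c := c))// => y ym.
  by rewrite ltrE ?xm// hE; apply: eq_bigr => j _; rewrite ltrE ?xm.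
have oip f1 f2 := orbit_ip p_open lambda_haar f1 f2 v0 xm.
apply/eqP; rewrite -subr_eq0; apply/eqP/nr_eq0/eqP.
rewrite -sqrf_eq0; apply/eqP/(@complexI R); rewrite -ipE.
by rewrite ipBl !ipBr !oip hf !subrr.
Qed.

Lemma base_mx_rep : is_mxrep p m0 r.
Proof.
have inj (B C : 'M[R[i]]_d) : (forall f, opm e B (pi (iota f) v0) = opm e C (pi (iota f) v0)) -> B = C.
  move=> BC; apply/matrixP => i j; have := BC (F j); rewrite FP => /(congr1 (colv e)).
  rewrite !(colv_opm oe) => /matrixP/(_ i 0).
  have cE k : colv e (e j) k 0 = (j == k)%:R by rewrite mxE oe.
  have sE (D : 'M[R[i]]_d) : (D *m colv e (e j)) i 0 = D i j.
    rewrite mxE (bigD1 j)//= cE eqxx mulr1 big1 ?addr0// => k kj.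
    by rewrite cE eq_sym (negbTE kj) mulr0.
  by rewrite !sE.
split.
  apply: inj => f; rewrite base_mx_orbit ?gb_proj_one// (opm1 oe ce).
  exact: (orbit1 p_open lambda_haar).
move=> x y xm ym; apply: inj => f; rewrite (opmM oe ce (r x) (r y)) (base_mx_orbit f ym).
rewrite (base_mx_orbit (ltr p f y) xm).
by rewrite (orbit_translate p_open lambda_haar)// base_mx_orbit// gb_proj_mul ?xm ?ym.
Qed.

Lemma base_mx_unitary x v w : p x = m0 ->
  ip E (opm e (r x) v) (opm e (r x) w) = ip E v w.
Proof.
move=> xm; have [f <-] := rep_cyclic v00 v; have [g <-] := rep_cyclic v00 w.
by rewrite !base_mx_orbit// (orbit_ip p_open lambda_haar).
Qed.

Lemma base_mx_weak f v w : ip E (pi (iota f) v) w = cint m0 (fun x => f x * ip E (opm e (r x) v) w).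
Proof.
have [g <-] := rep_cyclic v00 v; rewrite (rep_weak p_open lambda_haar).
by apply: eq_cint => x xm; rewrite base_mx_orbit.
Qed.

(** The scalar [t] of [coeff_form_scalar] depends on [v]. Summing over an orthonormal basis and
    using unitarity gives [d * t = |v|^2], so [k] is the inverse of the dimension. *)
Lemma base_mx_schur : exists2 k : R, 0 < k & forall v w w',
  cint m0 (fun x => ip E w (opm e (r x) v) * ip E (opm e (r x) v) w') =
  (k * normr_of v ^+ 2)%:C * ip E w w'.
Proof.
have h v : exists2 t : R, 0 <= t & forall w w',
    cint m0 (fun x => ip E w (opm e (r x) v) * ip E (opm e (r x) v) w') = t%:C * ip E w w'.
  have [g gv] := rep_cyclic v00 v.
  have [v_0|v_0] := eqVneq v 0.
    exists 0 => // w w'; rewrite mul0r -[RHS](cint_cst lambda_haar m0 0).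
    by apply: eq_cint => x _; rewrite v_0 linear0 ip0l mulr0.
  have gv0 : pi (iota g) v0 != 0 by rewrite gv.
  have [t t0 tP] := coeff_form_scalar p_open lambda_haar A_completion gv0.
  exists t => [|w w']; first exact: ltW.
  by rewrite -tP; apply: eq_cint => x xm; rewrite -gv base_mx_orbit.
have cc v w w' : ccont (fun x => ip E w (opm e (r x) v) * ip E (opm e (r x) v) w').
  apply: ccontM; last exact: (opm_ip_cont oe ce base_mx_cont).
  under eq_fun do rewrite ipC; apply: ccont_conj.
  exact: (opm_ip_cont oe ce base_mx_cont).
have d0 : (0 < d)%N.
  rewrite lt0n; apply/eqP => dE; move: v00; rewrite (ce v0) big1 ?eqxx// => i.
  by have := ltn_ord i; rewrite {2}dE.
exists (d%:R^-1) => [|v w w']; first by rewrite invr_gt0 ltr0n.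
have [t t0 tP] := h v; rewrite tP; congr (_%:C * _).
suff : (d%:R * t)%:C = (normr_of v ^+ 2)%:C :> R[i].
  by move=> /(@complexI R) <-; rewrite mulKf// pnatr_eq0 -lt0n.
have <- : \sum_i cint m0 (fun x => ip E (e i) (opm e (r x) v) * ip E (opm e (r x) v) (e i)) = (d%:R * t)%:C.
  rewrite (eq_bigr (fun=> t%:C)); last by move=> i _; rewrite tP oe eqxx mulr1.
  by rewrite sumr_const card_ord -rmorphMn mulr_natl.
rewrite -(cint_sum lambda_haar _ _ _ (fun i => cc v (e i) (e i))) -[RHS](cint_cst lambda_haar m0).
apply: eq_cint => x xm; rewrite -ipE -(base_mx_unitary v v xm) [RHS](ip_colv ce).
by apply: eq_bigr => i _; rewrite !mxE -ipC mulrC.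
Qed.

End base_representation.

(** * Irreducibility and unitarity on nearby fibers *)

Section square_norm.
Context (R : realType).
Local Notation C := R[i].

(** The squared Hilbert-Schmidt norm, in which Schur's relations become an exact identity. *)
Definition mxsq m n (A : 'M[C]_(m, n)) : R := \sum_i \sum_j nc (A i j) ^+ 2.

Lemma mxsq_ge0 m n (A : 'M[C]_(m, n)) : 0 <= mxsq A.
Proof. by apply: sumr_ge0 => i _; apply: sumr_ge0 => j _; exact: sqr_ge0. Qed.

Lemma le_mxsq m n (A : 'M[C]_(m, n)) i j : nc (A i j) ^+ 2 <= mxsq A.
Proof.
rewrite /mxsq (bigD1 i) //= (bigD1 j) //= -addrA lerDl addr_ge0//.
  by apply: sumr_ge0 => k _; exact: sqr_ge0.
by apply: sumr_ge0 => k _; apply: sumr_ge0 => l _; exact: sqr_ge0.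
Qed.

Lemma mxsq_eq0 m n (A : 'M[C]_(m, n)) : mxsq A = 0 -> A = 0.
Proof.
move=> A0; apply/matrixP => i j; rewrite mxE; apply: nc_eq0; apply/eqP.
by rewrite -sqrf_eq0 eq_le sqr_ge0 andbT -A0 le_mxsq.
Qed.

End square_norm.

Section coefficients.
Context (R : realType) (M : topologicalType) (H : ptopologicalType)
  (p : compact_group_bundle M H) (p_open : open_bundle p)
  (lambda : M -> probability (borel H) R)
  (lambda_haar : forall m : M, is_haar p m (lambda m)).
Implicit Types (x y z : H).
Notation cint := (cint p lambda).
Context (d : nat).
Local Notation C := R[i].

(* By Schur's lemma this amounts to irreducibility; unlike invariant subspaces,
   it is visibly stable under conjugation and under small perturbations. *)
Definition faithful_coefficients m (r : H -> 'M[C]_d) := forall (w : 'rV[C]_d) (v : 'cV[C]_d),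
  (forall x, p x = m -> w *m r x *m v = 0) -> w = 0 \/ v = 0.

Let a (w : 'rV[C]_d) (v : 'cV[C]_d) (q : 'I_d * 'I_d) : C := w 0 q.1 * v q.2 0.

Let coeffE (w : 'rV[C]_d) (v : 'cV[C]_d) (B : 'M[C]_d) :
  (w *m B *m v) 0 0 = \sum_q a w v q * B q.1 q.2.
Proof.
rewrite mxE -(pair_bigA _ (fun i j => a w v (i, j) * B i j)) exchange_big /=.
apply: eq_bigr => j _; rewrite mxE mulr_suml; apply: eq_bigr => i _.
by rewrite /a /=; ring.
Qed.

Let a_le w v q q' : nc (a w v q) * nc (a w v q') <= mxsq w * mxsq v.
Proof.
have h t : nc (a w v t) ^+ 2 <= mxsq w * mxsq v.
  by rewrite ncM exprMn; apply: ler_pM; rewrite ?sqr_ge0 ?le_mxsq.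
have := sqr_ge0 (nc (a w v q) - nc (a w v q')); have := h q; have := h q'.
rewrite sqrrB; lra.
Qed.

(** The mean square of a coefficient is a Hermitian form in the entries of the tensor product of [w]
    and [v], with finitely many coefficients that vary continuously with [m]. It is a positive
    multiple of the norm at [m0], so it stays definite nearby, in a neighborhood common to all [w]
    and [v]. *)
Lemma near_faithful_coefficients m0 (r : H -> 'M[C]_d) (k : R) : mcont r -> 0 < k ->
  (forall (w : 'rV[C]_d) (v : 'cV[C]_d), cint m0 (fun x => (w *m r x *m v) 0 0 * Num.conj ((w *m r x *m v) 0 0)) =
    (k * (mxsq w * mxsq v))%:C) ->
  \forall m \near m0, faithful_coefficients m r.
Proof.
move=> cr k0 schur; pose T := ('I_d * 'I_d)%type.
pose g (t : T * T) x := r x t.1.1 t.1.2 * Num.conj (r x t.2.1 t.2.2).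
have cg t : ccont (g t).
  by apply: ccontM; [exact: cr|apply: ccont_conj; exact: cr].
have NE (w : 'rV[C]_d) (v : 'cV[C]_d) m : cint m (fun x => (w *m r x *m v) 0 0 * Num.conj ((w *m r x *m v) 0 0)) =
    \sum_(t : T * T) a w v t.1 * Num.conj (a w v t.2) * cint m (g t).
  have ct t : ccont (fun x => a w v t.1 * Num.conj (a w v t.2) * g t x).
    by apply: ccontM; [exact: ccont_cst|exact: cg].
  under [RHS]eq_bigr => t _ do rewrite -(cintZ p lambda m _ (cg t)).
  rewrite -(cint_sum lambda_haar _ _ _ ct); apply: eq_cint => x _.
  rewrite !coeffE rmorph_sum big_distrlr /= pair_bigA /=; apply: eq_bigr => t _.
  by rewrite rmorphM /g; ring.
pose D : R := #|{: T * T}|%:R.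
(* The form has [D] terms, so it changes by at most [D * e < k] relative to [mxsq w * mxsq v]. *)
pose e := k / (D + 1); have D0 : 0 <= D by rewrite ler0n.
have e0 : 0 < e by rewrite divr_gt0// ltr_wpDl.
have near_g : \forall m \near m0, forall t, nc (cint m (g t) - cint m0 (g t)) < e.
  apply: filter_forall => t.
  by have /ccontP/(_ m0 _ e0) := cint_cont lambda_haar p_open (cg t).
apply: filterS near_g => m mg w v wv0.
have N0 : cint m (fun x => (w *m r x *m v) 0 0 * Num.conj ((w *m r x *m v) 0 0)) = 0.
  rewrite -[RHS](cint_cst lambda_haar m 0); apply: eq_cint => x xm.
  by rewrite wv0// mxE mul0r.
have : k * (mxsq w * mxsq v) <= D * e * (mxsq w * mxsq v).
  have -> : k * (mxsq w * mxsq v) = nc ((k * (mxsq w * mxsq v))%:C : C).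
    by rewrite nc_real ger0_norm// mulr_ge0 ?mulr_ge0 ?mxsq_ge0// ltW.
  rewrite -schur -ncN -[X in nc X]add0r -N0 !NE -sumrB.
  apply: le_trans (nc_sum _ _ _) _.
  apply: (@le_trans _ _ (\sum_(t : T * T) mxsq w * mxsq v * e)); last first.
    by rewrite sumr_const -mulr_natl mulrA mulrAC.
  apply: ler_sum => t _; rewrite -mulrBr ncM [nc (a w v t.1 * _)]ncM nc_conj; apply: ler_pM.
  - by apply: mulr_ge0; exact: nc_ge0.
  - exact: nc_ge0.
  - exact: a_le.
  - exact: ltW.
have De : D * e < k.
  by rewrite /e mulrA ltr_pdivrMr ?ltr_wpDl// mulrC ltr_pM2l// ltrDl.
rewrite -subr_le0 -mulrBl pmulr_rle0 ?subr_gt0// => sq0.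
have /eqP : mxsq w * mxsq v = 0 by apply/eqP; rewrite eq_le sq0 mulr_ge0 ?mxsq_ge0.
by rewrite mulf_eq0 => /orP[]/eqP/mxsq_eq0; [left|right].
Qed.

Lemma faithful_coefficients_conj m r (S : 'M[C]_d) : S \in unitmx ->
  faithful_coefficients m r -> faithful_coefficients m (fun x => S *m r x *m invmx S).
Proof.
move=> uS fr w v wv.
have [|wS|Sv] := fr (w *m S) (invmx S *m v).
- by move=> x /wv <-; rewrite !mulmxA.
- by left; rewrite -[w](mulmxK uS) wS mul0mx.
- by right; rewrite -[v](mulKVmx uS) Sv mulmx0.
Qed.

Lemma faithful_opm m r (E : hilbert R) (e : 'I_d -> E) v w : onb e -> onb_complete e ->
  faithful_coefficients m r -> (forall x, p x = m -> ip E (opm e (r x) v) w = 0) ->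
  v = 0 \/ w = 0.
Proof.
move=> oe ce fr vw.
have [|w0|v0] := fr (\row_i Num.conj (colv e w i 0)) (colv e v).
- move=> x xm; apply/matrixP => i j; rewrite !ord1 [RHS]mxE -(vw x xm) (ip_colv ce).
  rewrite -mulmxA mxE; apply: eq_bigr => k _; rewrite mxE mulrC; congr (_ * _).
  by rewrite (colv_opm oe).
- right; apply: (colv_inj ce); apply/matrixP => i j; rewrite ord1.
  have /matrixP/(_ 0 i) := w0; rewrite mxE [RHS]mxE => /(congr1 (Num.conj : C -> C)).
  by rewrite conjCK conjC0 => ->; rewrite mxE ip0l.
- left; apply: (colv_inj ce); rewrite v0; apply/matrixP => i j.
  by rewrite !mxE ip0l.
Qed.

Lemma faithful_irreducible m r (E : hilbert R) (e : 'I_d -> E) : onb e -> onb_complete e ->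
  faithful_coefficients m r -> topologically_irreducible (fiber p m) (fun x => opm e (r x)).
Proof.
by move=> oe ce fr; apply: (coefficient_irreducible oe ce) => v w; exact: faithful_opm fr.
Qed.

End coefficients.

Local Open Scope sesquilinear_scope.

(** By the spectral theorem [B] is unitarily diagonal with positive eigenvalues; [S] is the
    diagonalizing unitary followed by the square root of the diagonal. *)
Lemma positive_factor (R : realType) d (B : 'M[R[i]]_d) : B ^t* = B ->
  (forall v : 'cV[R[i]]_d, v != 0 -> exists2 t : R, 0 < t & (v ^t* *m B *m v) 0 0 = t%:C) ->
  exists2 S, S \in unitmx & B = S ^t* *m S.
Proof.
move=> hB pB.
have nB : B \is normalmx by apply/normalmxP; rewrite hB.
have /orthomx_spectralP BE := nB.
set P := spectralmx B in BE; set D := spectral_diag B in BE.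
have uP : P \is unitarymx := spectral_unitarymx B.
have PP : P *m P ^t* = 1%:M by apply/unitarymxP.
have /choice[t tP] i : exists t : R, 0 < t /\ D 0 i = t%:C.
  (* An eigenvector: the form takes the [i]-th eigenvalue at it. *)
  pose v := col i (P ^t*).
  have v0 : v != 0.
    apply/eqP => v0; have /matrixP/(_ i i) := PP; rewrite mxE big1 => [|k _].
      by rewrite !mxE eqxx => /esym/eqP; rewrite oner_eq0.
    by have /matrixP/(_ k 0) := v0; rewrite !mxE => ->; rewrite mulr0.
  have [t t0 tE] := pB _ v0; exists t; split=> //; rewrite -tE.
  have -> : v = P ^t* *m delta_mx i 0 by rewrite -colE.
  rewrite trmx_mul map_mxM /= trmxCK trmx_delta map_delta_mx.
  rewrite {1}BE invmx_unitary// !mulmxA -[_ *m P *m P ^t*]mulmxA PP mulmx1.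
  rewrite -[_ *m P *m P ^t*]mulmxA PP mulmx1 -mulmxA -rowE -colE !mxE eqxx mulr1n.
  by [].
have tgt0 i : 0 < t i := (tP i).1.
pose s := \row_i (Num.sqrt (t i))%:C : 'rV[R[i]]_d.
exists (diag_mx s *m P).
  rewrite unitmx_mul (unitarymx_unit uP) andbT unitmxE det_diag unitfE.
  by apply/prodf_neq0 => i _; rewrite mxE -(rmorph0 (real_complex R)) (inj_eq (@complexI R)) gt_eqF// sqrtr_gt0.
rewrite trmx_mul map_mxM /= mulmxA -[_ *m diag_mx s]mulmxA {1}BE (invmx_unitary uP).
congr (_ *m _ *m _); rewrite tr_diag_mx map_diag_mx mulmx_diag; congr diag_mx.
apply/rowP => i; rewrite !mxE (tP i).2 /=.
rewrite (_ : Num.conj _ = (Num.sqrt (t i))%:C); last exact: conjc_real.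
rewrite -rmorphM /= -expr2 sqr_sqrtr//.
exact: ltW.
Qed.

(** * Weyl's unitary trick *)

Section unitarization.
Context (R : realType) (M : topologicalType) (H : ptopologicalType)
  (p : compact_group_bundle M H)
  (lambda : M -> probability (borel H) R)
  (lambda_haar : forall m : M, is_haar p m (lambda m)).
Implicit Types (x y z : H).
Notation imx := (imx p lambda).
Context (d : nat).
Local Notation C := R[i].

Lemma mcont_adj (T : topologicalType) a b (F : T -> 'M[C]_(a, b)) : mcont F ->
  mcont (fun t => F t ^t* ).
Proof.
move=> cF i j; under eq_fun do rewrite !mxE.
by apply: ccont_conj; exact: cF.
Qed.

Lemma imx_adj m a b (F : H -> 'M[C]_(a, b)) : mcont F ->
  imx m (fun x => F x ^t* ) = (imx m F) ^t*.
Proof.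
move=> cF; apply/matrixP => i j; rewrite !mxE -cint_conj; last exact: cF.
by apply: eq_cint => x _; rewrite !mxE.
Qed.

Lemma adj_square (v : 'cV[C]_d) : (v ^t* *m v) 0 0 = (mxsq v)%:C.
Proof.
rewrite mxE /mxsq rmorph_sum; apply: eq_bigr => i _.
by rewrite big_ord1 !mxE mulrC ncCK.
Qed.

(** The averaged inner product [B] is invariant by right invariance of the integral; once
    [B = S^* S], its invariance says that conjugating by [S] gives unitary matrices. *)
Lemma mxrep_unitary m (r : H -> 'M[C]_d) : mcont r -> is_mxrep p m r ->
  exists2 S, S \in unitmx & forall x, p x = m ->
    (S *m r x *m invmx S) ^t* *m (S *m r x *m invmx S) = 1%:M.
Proof.
move=> cr [r1 rM].
have crr : mcont (fun x => r x ^t* *m r x).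
  by apply: mcontM; [apply: mcont_adj; exact: cr|exact: cr].
pose B := imx m (fun x => r x ^t* *m r x).
have hB : B ^t* = B.
  rewrite -imx_adj; last exact: crr.
  by apply: eq_imx => x _; rewrite trmx_mul map_mxM /= trmxCK.
have pB (v : 'cV[C]_d) : v != 0 -> exists2 t : R, 0 < t & (v ^t* *m B *m v) 0 0 = t%:C.
  move=> v0; exists (rint p lambda m (fun x => mxsq (r x *m v))).
    have sc : continuous (fun x => mxsq (r x *m v) : R^o).
      have -> : (fun x => mxsq (r x *m v)) = (fun x => complex.Re (((r x *m v) ^t* *m (r x *m v)) 0 0)).
        by apply/funext => x; rewrite adj_square.
      have crv : mcont (fun x => r x *m v) by apply: mcontM; [exact: cr|exact: mcont_cst].
      have crr0 : mcont (fun x => (r x *m v) ^t* *m (r x *m v)).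
        by apply: mcontM; [apply: mcont_adj; exact: crv|exact: crv].
      exact: (ccont_Re (crr0 0 0)).
    apply: (rint_gt0 lambda_haar (gb_proj_one p m) sc) => [y _|]; first exact: mxsq_ge0.
    rewrite r1 mul1mx lt_def mxsq_ge0 andbT; apply/eqP => /mxsq_eq0 vE.
    by rewrite vE eqxx in v0.
  have crrv : mcont (fun x => r x ^t* *m r x *m v).
    by apply: mcontM; [exact: crr|exact: mcont_cst].
  rewrite -mulmxA -(imxMr lambda_haar m _ crr) -(imxMl lambda_haar m _ crrv) mxE.
  rewrite -(cint_real lambda_haar); apply: eq_cint => x _.
  by rewrite -adj_square trmx_mul map_mxM /= !mulmxA.
have [S uS BS] := positive_factor hB pB.
exists S => // x xm.
have Br : r x ^t* *m B *m r x = B.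
  have crrx : mcont (fun y => r y ^t* *m r y *m r x).
    by apply: mcontM; [exact: crr|exact: mcont_cst].
  have crrxx : mcont (fun y => r x ^t* *m (r y ^t* *m r y *m r x)).
    by apply: mcontM; [exact: mcont_cst|exact: crrx].
  rewrite -mulmxA -(imxMr lambda_haar m _ crr) -(imxMl lambda_haar m _ crrx).
  apply: (imx_translater lambda_haar xm crr crrxx) => y ym.
  by rewrite rM// trmx_mul map_mxM /= !mulmxA.
have uS' : S ^t* \in unitmx by rewrite map_unitmx unitmx_tr.
have SS : (invmx S) ^t* *m S ^t* = 1%:M.
  by rewrite -map_mxM -trmx_mul mulmxV// trmx1 map_mx1.
rewrite !trmx_mul !map_mxM /= !mulmxA -[_ *m S ^t* *m S]mulmxA -BS.
rewrite -[_ *m _ *m B]mulmxA -[_ *m _ *m r x]mulmxA Br BS mulmxA SS mul1mx.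
exact: mulmxV.
Qed.

End unitarization.

(** * From fiber representations to the spectrum *)

Section integrated_representation.
Context (R : realType) (M : topologicalType) (H : ptopologicalType)
  (p : compact_group_bundle M H) (p_open : open_bundle p)
  (lambda : M -> probability (borel H) R)
  (lambda_haar : forall m : M, is_haar p m (lambda m)).
Implicit Types (x y z : H) (f g h : CH R H).
Notation rint := (rint p lambda).
Notation cint := (cint p lambda).
Notation imx := (imx p lambda).
Local Notation C := R[i].
Local Notation mul := (gb_mul p).
Context (E : hilbert R) (d : nat) (e : 'I_d -> E).
Hypotheses (oe : onb e) (ce : onb_complete e).
Implicit Types (v w : E).
Context (m : M) (r : H -> 'M[C]_d).
Hypotheses (cr : mcont r) (rr : is_mxrep p m r).
Hypothesis ru : forall x v w, p x = m -> ip E (opm e (r x) v) (opm e (r x) w) = ip E v w.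

Lemma opm_mcont v : continuous (fun x => opm e (r x) v).
Proof.
apply/cont_nrP => x t t0.
have crx : mcont (fun y => r y - r x) by apply: mcontB; [exact: cr|exact: mcont_cst].
have d0 : 0 < t / (normr_of v + 1) by rewrite divr_gt0// ltr_wpDl ?nr_ge0.
have /cont_nrP/(_ x _ d0) := cont_real (mcont_mxn crx); apply: filterS => y.
rewrite subrr mxn0 -rmorphB nr_real subr0 ger0_norm ?mxn_ge0// => xy.
have -> : opm e (r y) v - opm e (r x) v = opm e (r y - r x) v.
  apply: (colv_inj ce); rewrite -[_ - _]addrC -scaleN1r colv_linear !(colv_opm oe) mulmxBl.
  by rewrite scaleN1r addrC.
apply: le_lt_trans (nr_opm oe _ _) _.
apply: (@le_lt_trans _ _ (mxn (r y - r x) * (normr_of v + 1))).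
  by rewrite ler_wpM2l ?mxn_ge0// lerDl.
by rewrite -ltr_pdivlMr// ltr_wpDl ?nr_ge0.
Qed.

Lemma mxrep_irreducible_unitary : faithful_coefficients p m r -> (0 < d)%N ->
  is_irreducible_unitary_rep p m (fun x => opm e (r x) : {linear E -> E}).
Proof.
move=> fr d0; split.
- by move=> v /=; rewrite rr.1 (opm1 oe ce).
- by move=> x y xm ym v /=; rewrite rr.2// (opmM oe ce).
- by move=> x xm v w; exact: ru.
- by move=> v; apply: continuous_subspaceT; exact: opm_mcont.
- exists (e (Ordinal d0)); apply/eqP => e0; have := nr_onb oe (Ordinal d0).
  by rewrite e0 nr0 => /eqP; rewrite eq_sym oner_eq0.
- exact: faithful_irreducible.
Qed.

Definition int_mx f : 'M[C]_d := imx m (fun x => f x *: r x).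

Lemma int_mxE f i j : int_mx f i j = cint m (fun x => f x * r x i j).
Proof. by rewrite mxE; apply: eq_cint => x _; rewrite mxE. Qed.

Lemma int_mx_weak f v w :
  ip E (opm e (int_mx f) v) w = cint m (fun x => f x * ip E (opm e (r x) v) w).
Proof.
pose k i j : C := colv e v j 0 * Num.conj (colv e w i 0).
have ck i j : ccont (fun x => k i j * (f x * r x i j)).
  by apply: ccontM; [exact: ccont_cst|apply: ccontM; [exact: CH_cont|exact: cr]].
transitivity (cint m (fun x => \sum_i \sum_j k i j * (f x * r x i j))); last first.
  apply: eq_cint => x _; rewrite (ip_opm oe ce) mulr_sumr; apply: eq_bigr => i _.
  by rewrite mulr_sumr; apply: eq_bigr => j _; rewrite /k; ring.
rewrite (cint_sum lambda_haar); last by move=> i; apply: ccont_sum => j; exact: ck.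
rewrite (ip_opm oe ce); apply: eq_bigr => i _.
rewrite (cint_sum lambda_haar); last by move=> j; exact: ck.
apply: eq_bigr => j _; rewrite cintZ; last by apply: ccontM; [exact: CH_cont|exact: cr].
rewrite [LHS]mulrC; congr (_ * _); rewrite mxE; apply: eq_cint => x _; by rewrite mxE.
Qed.

Lemma coeff_mcont f v w : ccont (fun x => f x * ip E (opm e (r x) v) w).
Proof. by apply: ccontM; [exact: CH_cont|exact: (opm_ip_cont oe ce cr)]. Qed.

Lemma nr_opm_rep x v : p x = m -> normr_of (opm e (r x) v) = normr_of v.
Proof.
move=> xm; apply/eqP; rewrite -(eqrXn2 (n := 2))// ?nr_ge0//; apply/eqP.
by apply: (@complexI R); rewrite -!ipE ru.
Qed.

(** Pairing [u = opm e (int_mx f) v] with itself bounds [|u|^2] by the integral of [|f|] times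
    [|u| |v|]. *)
Lemma int_mx_bound f v :
  normr_of (opm e (int_mx f) v) <= rint m (fun x => nc (f x)) * normr_of v.
Proof.
set u := opm _ _ _; have [->|u0] := eqVneq u 0.
  rewrite nr0 mulr_ge0 ?nr_ge0// -(rint_cst lambda_haar m 0).
  by apply: rint_le => [||x _]; [exact: cont_cst|exact: cont_nc (@CH_cont _ _ f)|exact: nc_ge0].
have nu : 0 < normr_of u by rewrite nr_gt0.
rewrite -(ler_pM2r nu) -expr2.
have -> : normr_of u ^+ 2 = nc (ip E u u).
  by rewrite ipE nc_real ger0_norm// sqr_ge0.
rewrite {1}/u int_mx_weak; apply: le_trans (cint_nr lambda_haar m (@coeff_mcont f v u)) _.
rewrite -mulrA mulrC -rintZ; last exact: cont_nc (@CH_cont _ _ f).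
apply: rint_le => //.
- exact: cont_nc (@coeff_mcont f v u).
- by move=> x; apply: cvgMl_tmp; exact: (cont_nc (@CH_cont _ _ f)).

move=> x xm; rewrite ncM mulrC ler_wpM2r ?nc_ge0//.
by apply: le_trans (cauchy_schwarz _ _) _; rewrite nr_opm_rep.
Qed.

Lemma int_mx_linear (a : C) f g h : (forall x, h x = a * f x + g x) ->
  int_mx h = a *: int_mx f + int_mx g.
Proof.
move=> hE; apply/matrixP => i j; rewrite [RHS]mxE [X in _ = X + _]mxE.
rewrite [LHS]int_mxE [X in _ = a * X + _]int_mxE [X in _ = _ + X]int_mxE.
have cfr (k : CH R H) : ccont (fun x => k x * r x i j).
  by apply: ccontM; [exact: CH_cont|exact: cr].
have cafr : ccont (fun x => a * (f x * r x i j)).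
  by apply: ccontM; [exact: ccont_cst|exact: cfr].
rewrite -(cintZ p lambda m a (@cfr f)) -(cintD p lambda m cafr (@cfr g)).
by apply: eq_cint => x _; rewrite hE mulrDl mulrA.
Qed.

(** Fubini, followed by the substitution [x = yz] and multiplicativity of [r] in the inner
    integral. *)
Lemma int_mx_conv f g h : (forall x, h x = Defs.conv p lambda f g x) ->
  int_mx h = int_mx f *m int_mx g.
Proof.
move=> hE; apply/matrixP => i j; rewrite [LHS]int_mxE [RHS]mxE.
have cF : ccont (fun z : H * H => f z.2 * ltr_fun p g (z.2, z.1) * r z.1 i j).
  apply: ccontM; first apply: ccontM.
  - exact: (ccont_comp (@cont_snd _ _) (@CH_cont _ _ f)).
  - exact: (ccont_comp (cont_pair (@cont_snd _ _) (@cont_fst _ _)) (@ltr_fun_cont _ _ _ p g)).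
  - by apply: (@ccont_comp R _ _ fst (fun x => r x i j)); [exact: cont_fst|exact: cr].
transitivity (cint m (fun x => cint m (fun y => f y * ltr_fun p g (y, x) * r x i j))).
  apply: eq_cint => x xm; rewrite hE (@conv_ltrE _ _ _ p lambda lambda_haar f g m x xm) mulrC.
  rewrite -cintZ; last first.
    by apply: ccontM; [exact: CH_cont|exact: (ccont_slice2 x (@ltr_fun_cont _ _ _ p g))].
  by apply: eq_cint => y ym; rewrite mulrC.
rewrite (cint_fubini lambda_haar m cF).
have cg k l : ccont (fun x => g x * r x k l) by apply: ccontM; [exact: CH_cont|exact: cr].
have cf k l : ccont (fun x => f x * r x k l) by apply: ccontM; [exact: CH_cont|exact: cr].
transitivity (cint m (fun y => \sum_k cint m (fun x => g x * r x k j) * (f y * r y i k))); last first.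
  rewrite (cint_sum lambda_haar); last first.
    by move=> k; apply: ccontM; [exact: ccont_cst|exact: cf].
  apply: eq_bigr => k _; rewrite (cintZ p lambda m _ (@cf i k)) mulrC; congr (_ * _).
    by rewrite int_mxE.
  by rewrite int_mxE.
apply: eq_cint => y ym.
transitivity (cint m (fun x => f y * \sum_k r y i k * (g x * r x k j))).
  have cy : ccont (fun x => f y * ltr_fun p g (y, x) * r x i j).
    apply: ccontM; last exact: cr.
    by apply: ccontM; [exact: ccont_cst|exact: (ccont_slice y (@ltr_fun_cont _ _ _ p g))].
  apply/esym; apply: (cint_translate lambda_haar ym cy) => z zm.
  rewrite -[ltr_fun _ _ _]/(ltr p g y (mul y z)) ltrE ?gb_proj_mul ?ym ?zm//.
  rewrite gb_mulKx ?ym ?zm// rr.2// mxE -mulrA [in RHS]mulr_sumr; congr (_ * _).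
  by apply: eq_bigr => k _; ring.
have csum : ccont (fun x => \sum_k r y i k * (g x * r x k j)).
  by apply: ccont_sum => k; apply: ccontM; [exact: ccont_cst|exact: cg].
rewrite cintZ; last exact: csum.
rewrite (cint_sum lambda_haar); last by move=> k; apply: ccontM; [exact: ccont_cst|exact: cg].
rewrite mulr_sumr; apply: eq_bigr => k _; rewrite cintZ; last exact: cg.
by rewrite mulrA mulrC.
Qed.

End integrated_representation.

Section bounded_representation.
Context (R : realType) (M : topologicalType) (H : ptopologicalType)
  (p : compact_group_bundle M H) (p_open : open_bundle p)
  (lambda : M -> probability (borel H) R)
  (lambda_haar : forall m : M, is_haar p m (lambda m)).
Implicit Types (x y z : H) (f g h : CH R H).
Notation rint := (rint p lambda).
Local Notation C := R[i].
Local Notation inv := (gb_inv p).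
Context (E : hilbert R) (d : nat) (e : 'I_d -> E).
Hypotheses (oe : onb e) (ce : onb_complete e).
Implicit Types (v w : E).
Context (m : M) (r : H -> 'M[C]_d).
Hypotheses (cr : mcont r) (rr : is_mxrep p m r).
Hypothesis ru : forall x v w, p x = m -> ip E (opm e (r x) v) (opm e (r x) w) = ip E v w.
Local Notation Phi := (int_mx p lambda m r).

Let ic v w : ccont (fun x => ip E (opm e (r x) v) w).
Proof. exact: (opm_ip_cont oe ce cr). Qed.

Lemma opm_inv x v w : p x = m -> ip E (opm e (r (inv x)) v) w = ip E v (opm e (r x) w).
Proof.
move=> xm; rewrite -(ru _ _ xm) -(opmM oe ce) -rr.2 ?gb_proj_inv// gb_mulxV xm rr.1.
by rewrite (opm1 oe ce).
Qed.

Lemma int_mx_star f h v w : (forall x, h x = cstar p f x) ->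
  ip E (opm e (Phi h) v) w = ip E v (opm e (Phi f) w).
Proof.
move=> hE; rewrite [RHS]ipC (int_mx_weak lambda_haar oe ce m cr h v w) (int_mx_weak lambda_haar oe ce m cr f w v).
have cfw : ccont (fun x => f x * ip E (opm e (r x) w) v).
  by apply: ccontM; [exact: CH_cont|exact: ic].
rewrite -cint_conj; last exact: cfw.
rewrite -(cint_inv lambda_haar m (ccont_conj cfw)); apply: eq_cint => x xm.
rewrite hE rmorphM -[cstar p f x]/(Num.conj (f (inv x))); congr (_ * _).
by rewrite (opm_inv _ _ xm) [LHS]ipC.
Qed.

(** Testing with [f] the conjugate of the coefficient makes its mean square 0, and it is
    continuous. *)
Lemma coefficient_vanish v w : (forall f, ip E (opm e (Phi f) v) w = 0) ->
  forall x, p x = m -> ip E (opm e (r x) v) w = 0.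
Proof.
move=> vw x xm; pose f : CH R H := mkC (ccont_conj (@ic v w)).
have := vw f; rewrite (int_mx_weak lambda_haar oe ce m cr f v w).
rewrite (@eq_cint _ _ _ _ _ _ _ (fun x => (nc (ip E (opm e (r x) v) w) ^+ 2)%:C)); last first.
  by move=> y _; rewrite mulrC ncCK.
rewrite (cint_real lambda_haar) => /(@complexI R) i0.
apply: nc_eq0; apply/eqP; rewrite -sqrf_eq0; apply/negPn/negP => n0.
have cn : continuous (fun x => nc (ip E (opm e (r x) v) w) ^+ 2 : R^o).
  under eq_fun do rewrite expr2.
  by move=> y; apply: cvgM; exact: (cont_nc (@ic v w)).
have := rint_gt0 lambda_haar xm cn (fun y _ => sqr_ge0 _).
by rewrite i0 ltxx lt_def n0 sqr_ge0 => /(_ isT).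
Qed.

(** For [w] orthogonal to the span, [coefficient_vanish] at the identity of the fiber gives
    [<w, w> = 0]. *)
Lemma mxrep_nondegenerate : lin [set opm e (Phi f) v | f in [set: CH R H] & v in [set: E]] = setT.
Proof.
set S := image2 _ _ _; apply: contrapT => linT.
have [||w w0 wP] := subspace_orthogonal oe ce _ _ linT.
- by exists 0%N, (fun=> 0), (fun=> 0); split=> [[]//|]; rewrite big_ord0.
- move=> a u v [n1 [a1 [s1 [S1 ->]]]] [n2 [a2 [s2 [S2 ->]]]].
  exists (n1 + n2)%N.
  exists (fun i => match fintype.split i with inl j => a * a1 j | inr j => a2 j end).
  exists (fun i => match fintype.split i with inl j => s1 j | inr j => s2 j end).
  split=> [i|]; first by case: (fintype.split i).
  rewrite big_split_ord /= scaler_sumr; congr (_ + _); apply: eq_bigr => i _.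
    case: splitP => j /= ij; first by rewrite (_ : j = i) ?scalerA//; apply: ord_inj.
    by have := ltn_ord i; rewrite ij -ltn_subRL subnn.
  case: splitP => j /= ij; first by have := ltn_ord j; rewrite -ij -ltn_subRL subnn.
  by rewrite (_ : j = i)//; apply: ord_inj; move: ij => /addnI.
have : ip E w w = 0.
  rewrite -{1}(opm1 oe ce w) -rr.1; apply: coefficient_vanish; last exact: gb_proj_one.
  move=> f; apply: wP; exists 1%N, (fun=> 1), (fun=> opm e (Phi f) w).
  by split=> [_|]; [exists f => //; exists w|rewrite big_ord1 scale1r].
by rewrite ipE => /(@complexI R) /eqP; rewrite sqrf_eq0 gt_eqF// nr_gt0.
Qed.

Lemma mxrep_bounded_rep : is_bounded_rep p lambda (fun f => opm e (Phi f) : {linear E -> E}).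
Proof.
split.
- by move=> f; exact: opm_continuous.
- move=> a f g h hE v.
  have opmP (X Y Z : 'M[C]_d) : X = a *: Y + Z -> opm e X v = a *: opm e Y v + opm e Z v.
    move=> ->; apply: (colv_inj ce).
    by rewrite colv_linear !(colv_opm oe) mulmxDl scalemxAl.
  exact: opmP (int_mx_linear p lambda m cr hE).
- move=> f g h hE v.
  have opmMP (X Y Z : 'M[C]_d) : X = Y *m Z -> opm e X v = opm e Y (opm e Z v).
    by move=> ->; exact: opmM.
  exact: opmMP (int_mx_conv lambda_haar cr rr hE).
- by move=> f h hE v w; exact: int_mx_star.
- move=> f; rewrite /opnorm.
  apply: ge_sup; first by exists (normr_of (opm e (Phi f) 0)), 0 => //=; rewrite nr0.
  move=> _ [v /= v1 <-]; apply: le_trans (int_mx_bound lambda_haar oe ce cr ru f v) _.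
  have r0 m' : 0 <= rint m' (fun x => nc (f x)).
    rewrite -(rint_cst lambda_haar m' 0).
    by apply: rint_le => [||x _]; [exact: cont_cst|exact: cont_nc (@CH_cont _ _ f)|exact: nc_ge0].
  apply: (@le_trans _ _ (rint m (fun x => nc (f x)))).
    by rewrite -[leRHS]mulr1 ler_wpM2l.
  apply: ub_le_sup; last by exists m.
  have [b b0 fb] := compact_nc_bounded (gb_compactH p) (@CH_cont _ _ f).
  exists b => _ [m' _ <-]; rewrite -[b in leRHS](rint_cst lambda_haar m' b).
  by apply: rint_le => [||x _]; [exact: cont_nc (@CH_cont _ _ f)|exact: cont_cst|exact: fb].
- by move=> O [v Ov] _; exists v; split=> //; rewrite mxrep_nondegenerate.
Qed.

Variables (A : cstar_algebra R) (iota : CH R H -> A).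
Hypothesis A_completion : is_group_cstar_algebra p lambda iota.

(** The norm of [iota f] is a supremum over all bounded representations, and this is one of them. *)
Lemma int_mx_contract f v : normr_of (opm e (Phi f) v) <= normr_of (iota f) * normr_of v.
Proof.
have nT u : normr_of u <= 1 -> normr_of (opm e (Phi f) u) <= normr_of (iota f).
  move=> u1; apply: (@le_trans _ _ (opnorm (opm e (Phi f)))).
    apply: ub_le_sup; last by exists u.
    exists (mxn (Phi f)) => _ [z /= z1 <-]; apply: le_trans (nr_opm oe _ _) _.
    by rewrite -[leRHS]mulr1 ler_wpM2l ?mxn_ge0.
  rewrite (gca_norm A_completion); apply: ub_le_sup; last first.
    by exists E, (fun f => opm e (Phi f)); split=> //; exact: mxrep_bounded_rep.
  exists (sup [set rint m (fun x => nc (f x)) | m in [set: M]]).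
  by move=> _ [E' [pi' [pib ->]]]; exact: (brep_bound pib f).
have [->|v0] := eqVneq v 0; first by rewrite linear0 !nr0 mulr0.
have nv : 0 < normr_of v by rewrite nr_gt0.
have := nT ((normr_of v)^-1%:C *: v).
rewrite linearZ /= !nrZc nc_real ger0_norm ?invr_ge0 ?nr_ge0// mulVf ?gt_eqF// => /(_ (lexx _)).
by rewrite mulrC ler_pdivrMr.
Qed.

End bounded_representation.

Section cstar_norm.
Context (R : realType) (A : cstar_algebra R).
Implicit Types a b : A.

Lemma nr_star_le a : normr_of a <= normr_of (ca_star a).
Proof.
have [->|a0] := eqVneq a 0; first by rewrite nr0 nr_ge0.
have na : 0 < normr_of a by rewrite nr_gt0.
by rewrite -(ler_pM2r na) -expr2 -nr_ca_star; exact: nr_ca_mul.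
Qed.

Lemma nr_starB a b : normr_of (ca_star a - ca_star b) = normr_of (a - b).
Proof.
have -> : ca_star a - ca_star b = ca_star (a - b).
  have -> : a - b = -1 *: b + a by rewrite scaleN1r addrC.
  by rewrite ca_starD rmorphN rmorph1 scaleN1r addrC.
apply/eqP; rewrite eq_le nr_star_le andbT -{2}(ca_starK (a - b)).
exact: nr_star_le.
Qed.

End cstar_norm.

Lemma nc_subACA (R : realType) (u u' v v' : R[i]) (X Y : R) :
  nc (u - u') <= X -> nc (v - v') <= Y -> nc ((u - v) - (u' - v')) <= X + Y.
Proof.
move=> uX vY; have -> : u - v - (u' - v') = (u - u') - (v - v') by ring.
by apply: le_trans (ncB _ _) _; exact: lerD.
Qed.

(** * Extension by continuity to the group algebra *)

Section extension.
Context (R : realType) (M : topologicalType) (H : ptopologicalType)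
  (p : compact_group_bundle M H) (p_open : open_bundle p)
  (lambda : M -> probability (borel H) R)
  (lambda_haar : forall m : M, is_haar p m (lambda m))
  (A : cstar_algebra R) (iota : CH R H -> A)
  (A_completion : is_group_cstar_algebra p lambda iota).
Local Notation C := R[i].
Context (E : hilbert R) (d : nat) (e : 'I_d -> E).
Hypotheses (oe : onb e) (ce : onb_complete e).
Implicit Types (f g h : CH R H) (a b : A) (v w : E).

(* Identities on [A] are proved by applying this to one variable after another. *)
Lemma dense_zero (T : A -> C) (K : R) :
  (forall a b, nc (T a - T b) <= K * normr_of (a - b)) -> (forall f, T (iota f) = 0) ->
  forall a, T a = 0.
Proof.
move=> TK T0 a; apply: nc_le0_eq0 => t t0.
have d0 : 0 < t / (`|K| + 1) by rewrite divr_gt0// ltr_wpDl.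
have [f fa] := iota_approx A_completion a d0.
rewrite -[T a]subr0 -(T0 f); apply: le_trans (TK _ _) _.
apply: (@le_trans _ _ ((`|K| + 1) * (t / (`|K| + 1)))); last first.
  by rewrite mulrC divfK// gt_eqF// ltr_wpDl.
have Kn := ler_norm K; have := normr_ge0 K; have := nr_ge0 (a - iota f).
move: fa; rewrite nr_distC => fa n0 K0; apply: (@le_trans _ _ ((`|K| + 1) * normr_of (a - iota f))).
  by apply: ler_wpM2r => //; lra.
by apply: ler_wpM2l; [lra|exact: ltW].
Qed.

Lemma opm_entry (B : 'M[C]_d) i j : ip E (opm e B (e j)) (e i) = B i j.
Proof.
have -> : ip E (opm e B (e j)) (e i) = colv e (opm e B (e j)) i 0 by rewrite mxE.
rewrite (colv_opm oe) mxE (bigD1 j)//= mxE oe eqxx mulr1 big1 ?addr0// => k kj.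
by rewrite mxE oe eq_sym (negbTE kj) mulr0.
Qed.

Variable Phi : CH R H -> 'M[C]_d.
Hypothesis Phi_linear : forall (k : C) f g h, (forall x, h x = k * f x + g x) ->
  Phi h = k *: Phi f + Phi g.
Hypothesis Phi_conv : forall f g h, (forall x, h x = Defs.conv p lambda f g x) ->
  Phi h = Phi f *m Phi g.
Hypothesis Phi_star : forall f h v w, (forall x, h x = cstar p f x) ->
  ip E (opm e (Phi h) v) w = ip E v (opm e (Phi f) w).
Hypothesis Phi_contract : forall f v,
  normr_of (opm e (Phi f) v) <= normr_of (iota f) * normr_of v.

Lemma Phi_lipschitz f g i j : nc (Phi f i j - Phi g i j) <= normr_of (iota f - iota g).
Proof.
have ch : ccont (fun x => (-1) * g x + f x).
  by apply: ccontD; [apply: ccontM; [exact: ccont_cst|exact: CH_cont]|exact: CH_cont].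
have hE x : mkC ch x = (-1) * g x + f x by [].
have PE : Phi f i j - Phi g i j = Phi (mkC ch) i j.
  by rewrite (Phi_linear hE) [RHS]mxE [X in _ = X + _]mxE mulN1r addrC.
have IE : iota f - iota g = iota (mkC ch).
  by rewrite (gca_linear A_completion hE) scaleN1r addrC.
rewrite PE IE -opm_entry; apply: le_trans (cauchy_schwarz _ _) _.
by rewrite (nr_onb oe) mulr1; apply: le_trans (Phi_contract _ _) _; rewrite (nr_onb oe) mulr1.
Qed.

(** The value is the limit of [Phi (F n) i j] along any approximation of [a]. It is recorded by its
    distance to every [Phi f], a form from which the Lipschitz bound and the algebraic identities
    follow directly. *)
Lemma extension_entry a i j : exists l : C, forall f, nc (l - Phi f i j) <= normr_of (a - iota f).
Proof.
have /choice[F FP] (n : nat) : exists f, normr_of (iota f - a) < n.+1%:R^-1.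
  by apply: (iota_approx A_completion); rewrite invr_gt0 ltr0n.
have small (t : R) : 0 < t -> exists N : nat, forall n, (N <= n)%N -> n.+1%:R^-1 < t :> R.
  move=> t0; exists (Num.truncn t^-1).+1 => n Nn.
  rewrite invf_plt ?posrE ?ltr0n//; apply: lt_le_trans (truncnS_gt _) _.
  by rewrite ler_nat ltnW// ltnS.
(* Completeness of [E] is used on multiples of the unit vector [e i] to obtain a limit of complex
   numbers. *)
have [|L LP] := @nr_cauchy_cvg R E (fun n => Phi (F n) i j *: e i).
  move=> t t0; have t2 : 0 < t / 2 by lra.
  have [N NP] := small _ t2; exists N => n n' Nn Nn'.
  rewrite -scalerBl nrZc (nr_onb oe) mulr1; apply: le_lt_trans (Phi_lipschitz _ _ _ _) _.
  apply: le_lt_trans (nr_triB _ a _) _; rewrite [t]splitr ltrD//.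
    exact: lt_trans (FP n) (NP n Nn).
  by rewrite nr_distC; exact: lt_trans (FP n') (NP n' Nn').
pose l := ip E L (e i).
have lP (t : R) : 0 < t -> exists N : nat, forall n, (N <= n)%N -> nc (Phi (F n) i j - l) < t.
  move=> /LP[N NP]; exists N => n /NP; apply: le_lt_trans.
  rewrite -(mulr1 (normr_of _)) -(nr_onb oe i); apply: le_trans (cauchy_schwarz _ _).
  by rewrite ipBl ipZl oe eqxx mulr1.
exists l => f; apply/ler_addgt0Pr => t t0; have t2 : 0 < t / 2 by lra.
have [N NP] := small _ t2; have [N' NP'] := lP _ t2.
pose n := maxn N N'.
apply: le_trans (nc_triB _ (Phi (F n) i j) _) _.
have h1 : nc (l - Phi (F n) i j) < t / 2.
  by rewrite nc_distC; apply: NP'; exact: leq_maxr.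
have h2 := Phi_lipschitz (F n) f i j.
have h3 := nr_triB (iota (F n)) a (iota f).
have h4 : normr_of (iota (F n) - a) < t / 2.
  by apply: lt_trans (FP n) (NP n _); exact: leq_maxl.
lra.
Qed.

Definition extension a : 'M[C]_d := \matrix_(i, j) sval (cid (extension_entry a i j)).
Local Notation B := extension.

Lemma extension_le a i j f : nc (B a i j - Phi f i j) <= normr_of (a - iota f).
Proof. by rewrite mxE; case: cid => l /= lP; exact: lP. Qed.

Lemma extensionE f : B (iota f) = Phi f.
Proof.
apply/matrixP => i j; apply/eqP; rewrite -subr_eq0; apply/eqP/nc_le0_eq0 => t t0.
by apply: le_trans (extension_le _ _ _ _) _; rewrite subrr nr0 ltW.
Qed.

Lemma extension_lipschitz a b i j : nc (B a i j - B b i j) <= normr_of (a - b).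
Proof.
apply/ler_addgt0Pr => t t0; have t2 : 0 < t / 2 by lra.
have [f fa] := iota_approx A_completion b t2.
have h1 := extension_le a i j f; have h2 := extension_le b i j f.
have h3 := nc_triB (B a i j) (Phi f i j) (B b i j).
have h4 := nr_triB a b (iota f).
rewrite nc_distC in h2; rewrite nr_distC in fa.
move: h3; rewrite [nc (Phi f i j - _)]nc_distC in h2 * => h3; lra.
Qed.

Lemma extension_linear (k : C) a b : B (k *: a + b) = k *: B a + B b.
Proof.
apply/matrixP => i j; rewrite [RHS]mxE [X in _ = X + _]mxE.
apply/eqP; rewrite -subr_eq0; apply/eqP.
pose T1 f b := B (k *: iota f + b) i j - (k * Phi f i j + B b i j).
have T1_0 f : forall b, T1 f b = 0.
  apply: (@dense_zero _ (1 + 1)) => [b1 b2|g].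
    rewrite mulrDl mul1r; apply: nc_subACA.
      by apply: le_trans (extension_lipschitz _ _ _ _) _; rewrite opprD addrACA subrr add0r.
    by rewrite opprD addrACA subrr add0r extension_lipschitz.
  have ch : ccont (fun x => k * f x + g x).
    by apply: ccontD; [apply: ccontM; [exact: ccont_cst|exact: CH_cont]|exact: CH_cont].
  have hE x : mkC ch x = k * f x + g x by [].
  rewrite /T1 -(gca_linear A_completion hE) !extensionE (Phi_linear hE).
  by rewrite [X in X - _]mxE [X in X + _ - _]mxE subrr.
apply: (@dense_zero (fun a => B (k *: a + b) i j - (k * B a i j + B b i j)) (nc k + nc k)) => [a1 a2|f].
  rewrite mulrDl; apply: nc_subACA.
    apply: le_trans (extension_lipschitz _ _ _ _) _.
    by rewrite opprD addrACA subrr addr0 -scalerBr nrZc.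
  by rewrite opprD addrACA subrr addr0 -mulrBr ncM ler_wpM2l ?nc_ge0 ?extension_lipschitz.
by have := T1_0 f b; rewrite /T1 extensionE.
Qed.

Lemma extension_mul a b : B (ca_mul a b) = B a *m B b.
Proof.
apply/matrixP => i j; rewrite [RHS]mxE.
apply/eqP; rewrite -subr_eq0; apply/eqP.
pose T1 f b := B (ca_mul (iota f) b) i j - \sum_k Phi f i k * B b k j.
have T1_0 f : forall b, T1 f b = 0.
  apply: (@dense_zero _ (normr_of (iota f) + \sum_k nc (Phi f i k))) => [b1 b2|g].
    rewrite mulrDl; apply: nc_subACA.
      apply: le_trans (extension_lipschitz _ _ _ _) _.
      by rewrite -ca_mulBr nr_ca_mul.
    rewrite -sumrB mulr_suml; apply: le_trans (nc_sum _ _ _) _; apply: ler_sum => l _.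
    by rewrite -mulrBr ncM ler_wpM2l ?nc_ge0 ?extension_lipschitz.
  have hE x : conv_elt p_open lambda_haar f g x = Defs.conv p lambda f g x by [].
  rewrite /T1 -(gca_conv A_completion hE) !extensionE (Phi_conv hE) mxE.
  by rewrite subrr.
apply: (@dense_zero (fun a => B (ca_mul a b) i j - \sum_k B a i k * B b k j)
    (normr_of b + \sum_k nc (B b k j))) => [a1 a2|f].
  rewrite mulrDl; apply: nc_subACA.
    apply: le_trans (extension_lipschitz _ _ _ _) _.
    by rewrite -ca_mulBl mulrC nr_ca_mul.
  rewrite -sumrB mulr_suml; apply: le_trans (nc_sum _ _ _) _; apply: ler_sum => l _.
  by rewrite -mulrBl ncM mulrC ler_wpM2l ?nc_ge0 ?extension_lipschitz.
by have := T1_0 f b; rewrite /T1 extensionE.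
Qed.

Lemma extension_star a v w :
  ip E (opm e (B (ca_star a)) v) w = ip E v (opm e (B a) w).
Proof.
have BS i j : B (ca_star a) i j = Num.conj (B a j i).
  apply/eqP; rewrite -subr_eq0; apply/eqP.
  apply: (@dense_zero (fun a => B (ca_star a) i j - Num.conj (B a j i)) (1 + 1)) => [a1 a2|f].
    rewrite mulrDl mul1r; apply: nc_subACA.
      by rewrite -nr_starB extension_lipschitz.
    by rewrite -rmorphB nc_conj extension_lipschitz.
  have sE x : star_elt p f x = cstar p f x by [].
  rewrite -(gca_star A_completion sE) !extensionE -!opm_entry (Phi_star _ _ sE).
  by rewrite -ipC subrr.
rewrite [RHS]ipC !(ip_opm oe ce) rmorph_sum exchange_big; apply: eq_bigr => j _ /=.
rewrite rmorph_sum; apply: eq_bigr => i _ /=.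
by rewrite BS !rmorphM /= conjCK [X in _ = _ * X]mulrC.
Qed.

End extension.

Section extended_irrep.
Context (R : realType) (M : topologicalType) (H : ptopologicalType)
  (p : compact_group_bundle M H) (p_open : open_bundle p)
  (lambda : M -> probability (borel H) R)
  (lambda_haar : forall m : M, is_haar p m (lambda m))
  (A : cstar_algebra R) (iota : CH R H -> A)
  (A_completion : is_group_cstar_algebra p lambda iota).
Local Notation C := R[i].
Context (E : hilbert R) (d : nat) (e : 'I_d -> E).
Hypotheses (oe : onb e) (ce : onb_complete e).
Implicit Types (f g h : CH R H) (a b : A) (v w : E).
Variable Phi : CH R H -> 'M[C]_d.
Hypothesis Phi_linear : forall (k : C) f g h, (forall x, h x = k * f x + g x) ->
  Phi h = k *: Phi f + Phi g.
Hypothesis Phi_conv : forall f g h, (forall x, h x = Defs.conv p lambda f g x) ->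
  Phi h = Phi f *m Phi g.
Hypothesis Phi_star : forall f h v w, (forall x, h x = cstar p f x) ->
  ip E (opm e (Phi h) v) w = ip E v (opm e (Phi f) w).
Hypothesis Phi_contract : forall f v,
  normr_of (opm e (Phi f) v) <= normr_of (iota f) * normr_of v.
Hypothesis Phi_coefficient : forall v w, (forall f, ip E (opm e (Phi f) v) w = 0) -> v = 0 \/ w = 0.
Hypothesis d_gt0 : (0 < d)%N.

Let B := extension A_completion oe Phi_linear Phi_contract.
Let T a : {linear E -> E} := opm e (B a).

Let T_continuous a : continuous (T a).
Proof. exact: opm_continuous. Qed.

Let T_linear (k : C) a b v : T (k *: a + b) v = k *: T a v + T b v.
Proof.
rewrite /T /= /B extension_linear; apply: (colv_inj ce).
by rewrite colv_linear !(colv_opm oe) mulmxDl scalemxAl.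
Qed.

Let T_mul a b v : T (ca_mul a b) v = T a (T b v).
Proof. by rewrite /T /= /B (extension_mul p_open lambda_haar)// (opmM oe ce). Qed.

Let T_star a v w : ip E (T (ca_star a) v) w = ip E v (T a w).
Proof. exact: extension_star. Qed.

Let T_iota f v : T (iota f) v = opm e (Phi f) v.
Proof. by rewrite /T /= /B extensionE. Qed.

Let T_nonzero : exists a v, T a v != 0.
Proof.
apply: contrapT => h; pose e0 := e (Ordinal d_gt0).
have : e0 = 0 \/ e0 = 0.
  apply: Phi_coefficient => f; rewrite -T_iota (_ : T _ _ = 0) ?ip0l//.
  by apply/eqP/negPn/negP => n; apply: h; exists (iota f), e0.
by case=> e00; have := nr_onb oe (Ordinal d_gt0); rewrite -/e0 e00 nr0 => /eqP;
  rewrite eq_sym oner_eq0.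
Qed.

Let T_irreducible : topologically_irreducible [set: A] T.
Proof.
apply: (coefficient_irreducible oe ce) => v w vw; apply: Phi_coefficient => f.
by rewrite -T_iota; exact: vw.
Qed.

Definition extended_irrep : irrep A :=
  Irrep T_continuous T_linear T_mul T_star T_nonzero T_irreducible.

Lemma extended_irrepE f v : extended_irrep (iota f) v = opm e (Phi f) v.
Proof. exact: T_iota. Qed.

End extended_irrep.

Section fiber_irrep.
Context (R : realType) (M : topologicalType) (H : ptopologicalType)
  (p : compact_group_bundle M H) (p_open : open_bundle p)
  (lambda : M -> probability (borel H) R)
  (lambda_haar : forall m : M, is_haar p m (lambda m))
  (A : cstar_algebra R) (iota : CH R H -> A)
  (A_completion : is_group_cstar_algebra p lambda iota).
Local Notation C := R[i].
Notation cint := (cint p lambda).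
Context (E : hilbert R) (d : nat) (e : 'I_d -> E).
Hypotheses (oe : onb e) (ce : onb_complete e).
Implicit Types (f g h : CH R H) (a b : A) (v w : E).
Context (m : M) (r : H -> 'M[C]_d).
Hypotheses (cr : mcont r) (rr : is_mxrep p m r).
Hypothesis ru : forall x v w, p x = m -> ip E (opm e (r x) v) (opm e (r x) w) = ip E v w.
Hypothesis fr : faithful_coefficients p m r.
Hypothesis d_gt0 : (0 < d)%N.
Local Notation Phi := (int_mx p lambda m r).

Lemma mxrep_irrep : exists (pi : irrep A) (b : 'I_d -> irrep_space pi),
  [/\ onb b, onb_complete b, dual_fiber p lambda iota m (spec_of pi) &
    forall f, \sum_i ip _ (pi (iota f) (b i)) (b i) = cint m (fun x => f x * \tr (r x))].
Proof.
have Pl (k : C) f g h (hE : forall x, h x = k * f x + g x) : Phi h = k *: Phi f + Phi g.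
  exact: (int_mx_linear p lambda m cr hE).
have Pc f g h (hE : forall x, h x = Defs.conv p lambda f g x) : Phi h = Phi f *m Phi g.
  exact: (int_mx_conv lambda_haar cr rr hE).
have Ps f h v w (hE : forall x, h x = cstar p f x) :
    ip E (opm e (Phi h) v) w = ip E v (opm e (Phi f) w).
  exact: (int_mx_star lambda_haar oe ce cr rr ru v w hE).
have Pn f v : normr_of (opm e (Phi f) v) <= normr_of (iota f) * normr_of v.
  exact: (int_mx_contract lambda_haar oe ce cr rr ru A_completion).
have Pf v w : (forall f, ip E (opm e (Phi f) v) w = 0) -> v = 0 \/ w = 0.
  move=> vw; apply: (faithful_opm oe ce fr).
  exact: (coefficient_vanish lambda_haar oe ce cr vw).
pose pi := extended_irrep p_open lambda_haar A_completion oe ce Pl Pc Ps Pn Pf d_gt0.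
exists pi, e; split=> //.
  exists pi, (fun x => opm e (r x)); split=> //.
    exact: mxrep_irreducible_unitary.
  move=> f v w; rewrite extended_irrepE.
  exact: (int_mx_weak lambda_haar oe ce m cr f v w).
move=> f; rewrite (eq_bigr (fun i => cint m (fun x => f x * r x i i))); last first.
  by move=> i _; rewrite extended_irrepE (opm_entry oe) int_mxE.
rewrite -(cint_sum lambda_haar); last by move=> i; apply: ccontM; [exact: CH_cont|exact: cr].
by apply: eq_cint => x _; rewrite mulr_sumr.
Qed.

End fiber_irrep.

Section matrix_coordinates.
Context (R : realType) (E : hilbert R) (d : nat) (e : 'I_d -> E).
Hypotheses (oe : onb e) (ce : onb_complete e).
Local Notation C := R[i].

Lemma nr_vecv_sqr (v : 'cV[C]_d) : normr_of (vecv e v) ^+ 2 = mxsq v.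
Proof.
apply: (@complexI R); rewrite (nr_colv ce) (vecvK oe) rmorph_sum; apply: eq_bigr => i _.
by rewrite big_ord1 ncCK.
Qed.

Lemma ip_opm_vecv (w : 'rV[C]_d) (B : 'M[C]_d) (v : 'cV[C]_d) :
  ip E (opm e B (vecv e v)) (vecv e (w ^t* )) = (w *m B *m v) 0 0.
Proof.
rewrite (ip_colv ce) (colv_opm oe) !(vecvK oe) -mulmxA [RHS]mxE; apply: eq_bigr => i _.
by rewrite [in X in _ * X]mxE [in X in _ * X]mxE conjCK mulrC.
Qed.

Lemma mxsq_adj m n (B : 'M[C]_(m, n)) : mxsq (B ^t* ) = mxsq B.
Proof.
rewrite /mxsq exchange_big; apply: eq_bigr => i _; apply: eq_bigr => j _.
by rewrite !mxE nc_conj.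
Qed.

Lemma opm_isometry (B : 'M[C]_d) v w : B ^t* *m B = 1%:M ->
  ip E (opm e B v) (opm e B w) = ip E v w.
Proof.
move=> BB; have ipE' u u' : ip E u u' = ((colv e u') ^t* *m colv e u) 0 0.
  rewrite (ip_colv ce) mxE; apply: eq_bigr => i _.
  by rewrite [in RHS]mxE [in RHS]mxE mulrC.
rewrite !ipE' !(colv_opm oe) trmx_mul map_mxM /=.
by rewrite mulmxA -[_ *m _ *m B]mulmxA BB mulmx1.
Qed.

End matrix_coordinates.

Section local_family.
Context (R : realType) (M : topologicalType) (H : ptopologicalType)
  (p : compact_group_bundle M H) (p_open : open_bundle p)
  (lambda : M -> probability (borel H) R)
  (lambda_haar : forall m : M, is_haar p m (lambda m))
  (A : cstar_algebra R) (iota : CH R H -> A)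
  (A_completion : is_group_cstar_algebra p lambda iota).
Local Notation C := R[i].
Notation cint := (cint p lambda).
Implicit Types (x y : H) (f g h : CH R H).

(** The last condition says, in integrated form, that [chi] restricts to the character on the fiber
    over [m]. Sharing [d] and [chi] is what ties together representations over different fibers. *)
Definition irrep_over d (chi : H -> C) m (pi : irrep A) :=
  exists b : 'I_d -> irrep_space pi,
  [/\ onb b, onb_complete b, dual_fiber p lambda iota m (spec_of pi) &
    forall f, \sum_i ip _ (pi (iota f) (b i)) (b i) = cint m (fun x => f x * chi x)].

Lemma irrep_local_family (pi : irrep A) : exists d chi m0 (O : set M),
  [/\ ccont chi, open O, O m0, irrep_over d chi m0 pi &
    forall m, O m -> exists pi', irrep_over d chi m pi'].
Proof.
pose E := irrep_space pi; pose m0 := rep_base A_completion pi.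
have [d [e [oe ce]]] := rep_finite_dim p_open lambda_haar A_completion pi.
have [a0 [v0 /eqP pv0]] := irrep_nonzero pi.
have v00 : v0 != 0 by apply/eqP => v0E; apply: pv0; rewrite v0E linear0.
have d0 : (0 < d)%N.
  rewrite lt0n; apply/eqP => dE; move: v00; rewrite (ce v0) big1 ?eqxx// => i.
  by have := ltn_ord i; rewrite {2}dE.
set r := base_mx p_open lambda_haar A_completion oe ce v00.
have cr : mcont r by exact: base_mx_cont.
have rr : is_mxrep p m0 r by exact: base_mx_rep.
have ru x v w : p x = m0 -> ip E (opm e (r x) v) (opm e (r x) w) = ip E v w.
  exact: base_mx_unitary.
have rw f v w : ip E (pi (iota f) v) w = cint m0 (fun x => f x * ip E (opm e (r x) v) w).
  exact: base_mx_weak.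
have [k k0 schur] := base_mx_schur p_open lambda_haar A_completion oe ce v00.
rewrite -/r in schur; move: (r) cr rr ru rw schur => {}r cr rr ru rw schur.
have [rho [V [Vo Vm0 crho Vrho rhor]]] := near_mxrep p_open lambda_haar cr rr.
have schurm (w : 'rV[C]_d) (v : 'cV[C]_d) :
    cint m0 (fun x => (w *m rho x *m v) 0 0 * Num.conj ((w *m rho x *m v) 0 0)) =
    (k * (mxsq w * mxsq v))%:C.
  rewrite [mxsq w * _]mulrC -(mxsq_adj w) -!(nr_vecv_sqr oe ce) mulrA.
  rewrite rmorphM /= -ipE -schur; apply: eq_cint => x xm.
  by rewrite rhor// -(ip_opm_vecv oe ce) -ipC mulrC.
have near_fr := near_faithful_coefficients p_open lambda_haar crho k0 schurm.
have fr0 : faithful_coefficients p m0 r.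
  move=> w v wv; apply: (nbhs_singleton near_fr) => x xm; rewrite rhor//; exact: wv.
exists d, (fun x => \tr (rho x)), m0, (V `&` interior [set m | faithful_coefficients p m rho]).
split.
- by apply: ccont_sum => i; exact: crho.
- by apply: openI => //; exact: open_interior.
- by split=> //; exact: near_fr.
- exists e; split=> //.
    exists pi, (fun x => opm e (r x)); split=> //.
    exact: mxrep_irreducible_unitary.
  move=> f; rewrite (eq_bigr (fun i => cint m0 (fun x => f x * r x i i))); last first.
    by move=> i _; rewrite rw; apply: eq_cint => x _; rewrite (opm_entry oe).
  rewrite -(cint_sum lambda_haar); last by move=> i; apply: ccontM; [exact: CH_cont|exact: cr].
  by apply: eq_cint => x xm; rewrite -mulr_sumr rhor.
move=> m [Vm /interior_subset frm]; have rrm := Vrho _ Vm.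
have [S uS SS] := mxrep_unitary lambda_haar crho rrm.
pose s x := S *m rho x *m invmx S.
have cs : mcont s.
  by apply: mcontM; [apply: mcontM; [exact: mcont_cst|exact: crho]|exact: mcont_cst].
have srep : is_mxrep p m s.
  split; first by rewrite /s rrm.1 mulmx1 mulmxV.
  by move=> x y xm ym; rewrite /s rrm.2// !mulmxA mulmxKV.
have su x v w : p x = m -> ip E (opm e (s x) v) (opm e (s x) w) = ip E v w.
  by move=> xm; apply: (opm_isometry oe ce); exact: SS.
have sf : faithful_coefficients p m s by exact: faithful_coefficients_conj.
have [pi' [b [ob cb db trb]]] :=
  mxrep_irrep p_open lambda_haar A_completion oe ce cs srep su sf d0.
exists pi', b; split=> // f; rewrite trb; apply: eq_cint => x _; congr (_ * _).
(* The matrix [S] is chosen separately for each [m], but conjugation leaves the trace of [rho]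
   unchanged. *)
by rewrite /s mxtrace_mulC mulKmx.
Qed.

End local_family.

(** * The local section *)

Section sections.
Context (R : realType) (M : topologicalType) (H : ptopologicalType)
  (p : compact_group_bundle M H) (p_open : open_bundle p)
  (lambda : M -> probability (borel H) R)
  (lambda_haar : forall m : M, is_haar p m (lambda m))
  (A : cstar_algebra R) (iota : CH R H -> A)
  (A_completion : is_group_cstar_algebra p lambda iota).
Local Notation C := R[i].
Local Notation cint := (cint p lambda).
Implicit Types (x y : H) (f g h : CH R H) (c : spectrum A).

(** Multiplying some [f] not killed by [pi] by a function on [M] that is 1 at [m] and 0 at [m']
    separates the kernels, whereas equivalent representations have equal kernels. *)
Lemma dual_fiber_unique m m' c :
  dual_fiber p lambda iota m c -> dual_fiber p lambda iota m' c -> m = m'.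
Proof.
move=> [pi [rho [_ piE ->]]] [pi' [rho' [_ pi'E cE]]].
have eqv : equivalent pi' pi.
  have : spec_of pi' pi by rewrite -cE; exact: equivalent_refl.
  by [].
apply: contrapT => mm'.
have [f [v fv]] := rep_nonzero A_completion pi.
have nU : nbhs m (~` [set m']).
  apply: open_nbhs_nbhs; split=> //; apply: closed_openC.
  exact: (accessible_closed_set1 (hausdorff_accessible (gb_hausdorffM p))).
have [g [cg gm _ gU]] := urysohn_bump R (gb_compactM p) (gb_hausdorffM p) nU.
have cgp : continuous (fun x => g (p x) : R^o).
  by apply: cont_comp cg; exact: gb_proj_continuous.
have ck : ccont (fun x => f x * (g (p x))%:C).
  by apply: ccontM; [exact: CH_cont|exact: (ccont_real cgp)].
pose k : CH R H := mkC ck.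
have pi'k v' : pi' (iota k) v' = 0.
  apply: ip_eq0 => w; rewrite pi'E -[LHS]/(cint m' _) -[RHS](cint_cst lambda_haar m' 0).
  apply: eq_cint => x xm; rewrite -[k x]/(f x * (g (p x))%:C) xm gU ?mulr0 ?mul0r//.
  by move=> /(_ erefl).
have := equivalent_ker eqv pi'k v.
suff -> : pi (iota k) v = pi (iota f) v by move=> f0; rewrite f0 eqxx in fv.
apply: ip_inj => w; rewrite !piE -![cintegral _ _ _]/(cint m _).
by apply: eq_cint => x xm; rewrite -[k x]/(f x * (g (p x))%:C) xm gm mulr1.
Qed.

Lemma dual_projE m c : dual_fiber p lambda iota m c -> dual_proj p lambda iota c = m.
Proof. by move=> mc; apply: xget_unique => // m'; move=> /dual_fiber_unique; apply. Qed.

Lemma irrep_trace_lipschitz d (pi : irrep A) (b : 'I_d -> irrep_space pi) (a a' : A) : onb b ->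
  nc (\sum_i ip _ (pi a (b i)) (b i) - \sum_i ip _ (pi a' (b i)) (b i)) <=
  d%:R * normr_of (a - a').
Proof.
move=> ob; rewrite -sumrB; apply: le_trans (nc_sum _ _ _) _.
rewrite -[d in leRHS]card_ord mulr_natl -sumr_const; apply: ler_sum => i _.
rewrite -ipBl -irrepB; apply: le_trans (cauchy_schwarz _ _) _.
rewrite (nr_onb ob) mulr1; apply: le_trans (irrep_contract _ _) _.
by rewrite (nr_onb ob) mulr1.
Qed.

Lemma irrep_trace_square d (pi : irrep A) (b : 'I_d -> irrep_space pi) (a : A) :
  \sum_i ip _ (pi (ca_mul (ca_star a) a) (b i)) (b i) = (\sum_i normr_of (pi a (b i)) ^+ 2)%:C.
Proof.
by rewrite rmorph_sum; apply: eq_bigr => i _; rewrite irrep_mul irrep_star ipE.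
Qed.

(** The trace at [a^* a] is positive exactly when the representation does not kill [a].
    Approximating [a^* a] by [iota f] costs the same over every fiber, as all the dimensions equal
    [d], and the trace at [iota f] is an integral against [chi], continuous in [m]. *)
Lemma irrep_over_near d chi (O : set M) (F : M -> irrep A) m1 a v : ccont chi -> open O -> O m1 ->
  (forall m, O m -> irrep_over p lambda iota d chi m (F m)) -> F m1 a v != 0 ->
  \forall m \near m1, O m /\ exists w, F m a w != 0.
Proof.
move=> cchi Oo Om1 FO av; pose a' := ca_mul (ca_star a) a.
have [b [ob cb _ trb]] := FO _ Om1.
pose tau := \sum_i normr_of (F m1 a (b i)) ^+ 2.
have tau0 : 0 < tau.
  rewrite lt_def sumr_ge0 ?andbT => [|i _]; last exact: sqr_ge0.
  apply/eqP => /eqP; rewrite psumr_eq0 => [/allP h|i _]; last exact: sqr_ge0.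
  move: av; rewrite (cb v) linear_sum big1 ?eqxx// => i _.
  have := h i; rewrite mem_index_enum => /(_ isT) /=.
  by rewrite sqrf_eq0 => /eqP/nr_eq0 bi; rewrite linearZ /= bi scaler0.
(* Two approximations and one step from [m1] to [m] cost at most [tau / 4] each, which cannot take
   the trace from [tau] to 0. *)
pose e := tau / (4 * (d%:R + 1)); have d0 : 0 <= d%:R :> R := ler0n _ _.
have e0 : 0 < e by rewrite divr_gt0// mulr_gt0// ltr_wpDl.
have de : d%:R * e <= tau / 4.
  rewrite /e mulrA ler_pdivrMr ?mulr_gt0 ?ltr_wpDl//.
  by rewrite mulrA divfK// mulrC ler_wpM2l ?lerDl// ltW.
have [f fa] := iota_approx A_completion a' e0.
have cf : ccont (fun x => f x * chi x) by apply: ccontM; [exact: CH_cont|exact: cchi].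
have tau4 : 0 < tau / 4 by lra.
have /ccontP/(_ m1 _ tau4) := cint_cont lambda_haar p_open cf.
move=> near_f; near=> m; have Om : O m by near: m; exact: open_nbhs_nbhs.
split=> //; apply: contrapT => nw.
have a0 w : F m a w = 0 by apply/eqP/negPn/negP => aw; apply: nw; exists w.
have [b' [ob' _ _ trb']] := FO _ Om.
have h1 := irrep_trace_lipschitz a' (iota f) ob.
have h2 := irrep_trace_lipschitz (iota f) a' ob'.
have tr0 : \sum_i ip _ (F m a' (b' i)) (b' i) = 0.
  by rewrite irrep_trace_square big1// => i _; rewrite a0 nr0 expr0n.
rewrite trb irrep_trace_square -/tau nr_distC in h1; rewrite trb' tr0 in h2.
have h3 : nc (cint m (fun x => f x * chi x) - cint m1 (fun x => f x * chi x)) < tau / 4.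
  by near: m.
have fa' : d%:R * normr_of (iota f - a') <= tau / 4.
  by apply: le_trans de; rewrite ler_wpM2l// ltW.
set I := cint m1 _ in h1 h3; set I' := cint m _ in h2 h3.
have h4 := nc_triB (tau%:C : C) I I'; have h5 := nc_triB (tau%:C : C) I' 0.
have h6 : nc ((tau%:C : C) - 0) = tau by rewrite subr0 nc_real ger0_norm// ltW.
rewrite h6 in h5; rewrite nc_distC in h3; lra.
Unshelve. all: by end_near. Qed.

End sections.

Theorem theorem3p18 (R : realType) (M : topologicalType) (H : ptopologicalType)
    (p : compact_group_bundle M H) (p_open : open_bundle p)
    (lambda : M -> probability (borel H) R)
    (lambda_haar : forall m : M, is_haar p m (lambda m))
    (A : cstar_algebra R) (iota : CH R H -> A)
    (A_completion : is_group_cstar_algebra p lambda iota)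
    (c : spectrum A) :
  exists (O : set M) (sigma : M -> spectrum A),
    [/\ O (dual_proj p lambda iota c),
        is_local_continuous_section p lambda iota O sigma
      & sigma (dual_proj p lambda iota c) = c].
Proof.
have [pi ->] := spec_ofP c.
have [d [chi [m0 [V [cchi Vo Vm0 pi0 near_pi]]]]] :=
  irrep_local_family p_open lambda_haar A_completion pi.
(* Over [m0] the choice is [pi] itself, so that the section takes the prescribed value there;
   outside [V] any representation will do. *)
have /choice[F FP] m : exists pi' : irrep A,
    (V m -> irrep_over p lambda iota d chi m pi') /\ (m = m0 -> pi' = pi).
  have [->|mm0] := EM (m = m0); first by exists pi.
  have [/near_pi[pi' pi'm]|Vm] := EM (V m); first by exists pi'.
  by exists pi.
have FV m : V m -> irrep_over p lambda iota d chi m (F m) := (FP m).1.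
have m0E : dual_proj p lambda iota (spec_of pi) = m0.
  by case: pi0 => b [_ _ db _]; apply: (dual_projE lambda_haar A_completion).
exists V, (fun m => spec_of (F m)); rewrite m0E; split=> //; last by rewrite (FP m0).2.
split=> //.
- move=> U Uo; rewrite openE => m1 [Vm1 Um1].
  (* The class of [F m1] is outside the hull-kernel closure of the complement of [U], as some [a]
     kills that complement but not [F m1]. Wherever [F m] does not kill [a], its class is then in
     [U]. *)
  have [a [aU ac]] : exists a, (forall c', ~ U c' -> spec_ker c' a) /\ ~ spec_ker (spec_of (F m1)) a.
    apply: contrapT => na; apply: (Uo (spec_of (F m1))) => // a aU.
    by apply: contrapT => ac; apply: na; exists a.
  have [v av] : exists v, F m1 a v != 0.
    apply: contrapT => nv; apply: ac; rewrite spec_ker_of => v /=.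
    by apply/eqP/negPn/negP => av; apply: nv; exists v.
  have := irrep_over_near p_open lambda_haar A_completion cchi Vo Vm1 FV av.
  apply: filterS => m [Vm [w /eqP aw]]; split=> //; apply: contrapT => /aU.
  by rewrite spec_ker_of => /(_ w).
- move=> m /FV[b [_ _ db _]]; exact: (dual_projE lambda_haar A_completion).
Qed.
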